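(* Let $\mathcal H$ be an infinite dimensional Hilbert space, $A$ a maximal dissipative operator on $\mathcal H$ with domain $D(A)$, and $B$ an operator on $\mathcal H$ such that $B-c$ and $-B-c'$ generate contraction semigroups on $\mathcal H$ leaving $D(A)$ invariant, for some real constants $c\ge 0$ and $c'\ge 0$. Assume that $A+uB$ is maximal dissipative with domain $D(A)$ for every $u\in\mathbf R$ and that the map $t\in\mathbf R\mapsto e^{tB}Ae^{-tB}\in L(D(A),\mathcal H)$, where $D(A)$ is endowed with the graph norm, is locally Lipschitz. Then, for every $T>0$ and every $\psi_0\in\mathcal H$, there exists a unique continuous extension to $L^1([0,T],\mathbf R)$ of the end-point mapping $u\mapsto \Upsilon^u_T\psi_0\in\mathcal H$ of the system $\frac{d}{dt}x(t)=(A+u(t)B)x(t)$ (initially defined for piecewise constant $u$). Moreover the set $$\bigcup_{T\ge 0}\ \bigcup_{u\in L^1([0,T],\mathbf R)}\{\Upsilon^u_{t,0}\psi_0\mid t\in[0,T]\}$$ is contained in a countable union of compact subsets of $\mathcal H$.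
   Context: An operator $A$ on a Hilbert space is dissipative if $\Re\langle\phi,A\phi\rangle\le 0$ for all $\phi\in D(A)$, and maximal dissipative if it has no proper dissipative extension; equivalently it generates a $C^0$ semigroup of contractions (operators of norm at most one). $L(X,Y)$ denotes the bounded linear operators from $X$ to $Y$. Since $B-c$ and $-B-c'$ generate semigroups, $B$ generates a strongly continuous group $(e^{tB})_{t\in\mathbf R}$. For a right-continuous piecewise constant function $u=\sum_{j=1}^p u_j\mathbb I_{[\tau_j,\tau_{j+1})}$ on $[0,T)$ with real values $u_j$ and $0=\tau_1<\tau_2<\dots<\tau_{p+1}=T$, the propagator is $$\Upsilon^u_{t,0}=e^{(t-\tau_j)(A+u_jB)}\circ e^{(\tau_j-\tau_{j-1})(A+u_{j-1}B)}\circ\cdots\circ e^{(\tau_2-\tau_1)(A+u_1B)}\quad\text{for } t\in[\tau_j,\tau_{j+1}],$$ and $\Upsilon^u_t:=\Upsilon^u_{t,0}$. For $u\in L^1([0,T],\mathbf R)$ and $t\in[0,T]$, $\Upsilon^u_{t,0}\psi_0$ denotes the value of the continuous extension to $L^1([0,t],\mathbf R)$ of the end-point mapping at time $t$, evaluated at the restriction of $u$ to $[0,t]$. *)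

(* Defs.v *)
From HB Require Import structures.
From mathcomp Require Import all_boot all_order all_algebra.
From mathcomp Require Import complex.
From mathcomp Require Import all_classical all_reals all_analysis.
Set Implicit Arguments.
Unset Strict Implicit.
Unset Printing Implicit Defensive.
Import Order.TTheory GRing.Theory Num.Theory.
Import numFieldNormedType.Exports.
Local Open Scope classical_set_scope.
Local Open Scope complex_scope.
Local Open Scope ring_scope.

Section Operators.
Context {K : numFieldType} {H : normedModType K}.

(* The values of [op_app] outside [op_dom] carry no meaning: every notion below
   looks at an operator only through its graph. *)
Record operator := Operator {
  op_dom : set H;
  op_app :> H -> H;
  op_dom0 : op_dom 0;
  op_domP : forall a x y, op_dom x -> op_dom y -> op_dom (a *: x + y);
  op_linP : forall a x y, op_dom x -> op_dom y ->
    op_app (a *: x + y) = a *: op_app x + op_app y }.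

Definition op_id : operator :=
  @Operator setT id I (fun _ _ _ _ _ => I) (fun _ _ _ _ _ => erefl).

Fact op_scale_linP (a : K) (A : operator) b x y : op_dom A x -> op_dom A y ->
  a *: A (b *: x + y) = b *: (a *: A x) + a *: A y.
Proof.
by move=> Dx Dy; rewrite op_linP// scalerDr !scalerA [a * b]mulrC.
Qed.

Definition op_scale (a : K) (A : operator) : operator :=
  @Operator (op_dom A) (fun x => a *: A x) (op_dom0 A) (@op_domP A)
    (@op_scale_linP a A).

Fact op_add_domP (A B : operator) a x y :
  (op_dom A `&` op_dom B) x -> (op_dom A `&` op_dom B) y ->
  (op_dom A `&` op_dom B) (a *: x + y).
Proof. by move=> [? ?] [? ?]; split; exact: op_domP. Qed.

Fact op_add_linP (A B : operator) a x y :
  (op_dom A `&` op_dom B) x -> (op_dom A `&` op_dom B) y ->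
  A (a *: x + y) + B (a *: x + y) = a *: (A x + B x) + (A y + B y).
Proof. by move=> [? ?] [? ?]; rewrite !op_linP// scalerDr addrACA. Qed.

Definition op_add (A B : operator) : operator :=
  @Operator (op_dom A `&` op_dom B) (fun x => A x + B x)
    (conj (op_dom0 A) (op_dom0 B)) (@op_add_domP A B) (@op_add_linP A B).

Definition op_extends (A A' : operator) :=
  op_dom A `<=` op_dom A' /\ forall x, op_dom A x -> A' x = A x.

(* [opnorm_le A F M] : the restriction of F to D(A), with D(A) under the graph
   norm of A, has operator norm at most M. *)
Definition opnorm_le (A : operator) (F : H -> H) (M : K) :=
  forall x, op_dom A x -> `|F x| <= M * (`|x| + `|A x|).

End Operators.
Arguments operator {K} H.

Section Semigroups.
Context {R : realType} {H : completeNormedModType R[i]}.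
Implicit Types (A B : operator H) (S G : R -> H -> H).

(* Only the values of S at nonnegative times are constrained. *)
Definition C0_semigroup S :=
  [/\ forall t, 0 <= t -> linear (S t) /\ continuous (S t),
      forall x, S 0 x = x,
      forall s t, 0 <= s -> 0 <= t -> forall x, S (s + t) x = S s (S t x)
    & forall x, S t x @[t --> 0^'+] --> x].

Definition contractive S := forall t, 0 <= t -> forall x, `|S t x| <= `|x|.

Definition generates_semigroup A S := C0_semigroup S /\
  forall x y, (op_dom A x /\ A x = y) <->
    (t^-1)%:C *: (S t x - x) @[t --> 0^'+] --> y.

Definition generates_contractions A :=
  exists2 S, generates_semigroup A S & contractive S.

(* [expop A t] is e^{tA}, t >= 0, when A generates a C0-semigroup (which is then
   unique on nonnegative times); it is unspecified otherwise. *)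
Definition expop A : R -> H -> H := get (generates_semigroup A).

Definition C0_group G :=
  [/\ forall t, linear (G t) /\ continuous (G t),
      forall x, G 0 x = x,
      forall s t x, G (s + t) x = G s (G t x)
    & forall x, G t x @[t --> 0] --> x].

Definition generates_group B G := C0_group G /\
  forall x y, (op_dom B x /\ B x = y) <->
    (t^-1)%:C *: (G t x - x) @[t --> 0^'] --> y.

(* [expgrp B t] is e^{tB}, t real, when B generates a C0-group. *)
Definition expgrp B : R -> H -> H := get (generates_group B).

(* [F] is a locally Lipschitz map from R to L(D(A), H). *)
Definition locally_lipschitz_graph A (F : R -> H -> H) :=
  (forall t, exists M : R, opnorm_le A (F t) M%:C) /\
  (forall t0 : R, exists2 U, nbhs t0 U & exists L : R, forall s t, U s -> U t ->
    opnorm_le A (fun x => F t x - F s x) (L * `|t - s|)%:C).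

End Semigroups.

Section Hilbert.
Context {R : realType} {H : completeNormedModType R[i]}.
Variable dot : {dot H for @Num.conj R[i]}.

Definition dissipative (A : operator H) :=
  forall x, op_dom A x -> 'Re (dot x (A x)) <= 0.

(* Density of the domain is what makes maximality equivalent to the generation
   of a contraction semigroup. *)
Definition maximal_dissipative (A : operator H) :=
  [/\ dense (op_dom A), dissipative A
    & forall A' : operator H, dissipative A' -> op_extends A A' ->
        op_dom A' `<=` op_dom A].

End Hilbert.

Definition infinite_dimensional (K : numFieldType) (H : normedModType K) :=
  ~ exists (n : nat) (e : 'I_n -> H), forall x : H, exists c : 'I_n -> K,
      x = \sum_(i < n) c i *: e i.

Section Control.
Context {R : realType} {H : completeNormedModType R[i]}.
Variables A B : operator H.

Definition op_ctrl (u : R) : operator H := op_add A (op_scale u%:C B).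

(* u takes the value v j on [tau j, tau j.+1), for j < p, where
   0 = tau 0 < ... < tau p = T; the case p = 0 occurs exactly when T = 0. *)
Definition piecewise_constant (T : R) (p : nat) (tau v : nat -> R) (u : R -> R) :=
  [/\ tau 0%N = 0, tau p = T, forall j, (j < p)%N -> tau j < tau j.+1
    & forall j, (j < p)%N -> forall t, tau j <= t < tau j.+1 -> u t = v j].

(* The propagator from time tau 0 = 0 to time tau p. *)
Fixpoint pc_propagator (tau v : nat -> R) (p : nat) (x : H) : H :=
  if p is j.+1 then
    expop (op_ctrl (v j)) (tau j.+1 - tau j) (pc_propagator tau v j x)
  else x.

(* L^1([0,T], R) is handled through representatives: functions on the line of
   which only the restriction to [0,T] matters. *)
Definition L1 (T : R) (u : R -> R) :=
  lebesgue_measure.-integrable `[0, T] (EFin \o u).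

Definition L1dist (T : R) (u v : R -> R) : R :=
  \int[lebesgue_measure]_(s in `[0, T]) `|u s - v s|.

(* Since [L1dist] is only a pseudometric on representatives, this forces Phi to
   agree on functions that are equal almost everywhere on [0,T]. *)
Definition L1_continuous (T : R) (Phi : (R -> R) -> H) :=
  forall u, L1 T u -> forall e : R, 0 < e -> exists2 d : R, 0 < d &
    forall w, L1 T w -> L1dist T u w < d -> `|Phi u - Phi w| < e%:C.

Definition endpoint_extension (psi0 : H) (T : R) (Phi : (R -> R) -> H) :=
  L1_continuous T Phi /\
  forall p tau v u, piecewise_constant T p tau v u ->
    Phi u = pc_propagator tau v p psi0.

Definition attainable_set (psi0 : H) : set H :=
  [set x | exists T u t Phi, [/\ 0 <= T, L1 T u, 0 <= t <= T,
     endpoint_extension psi0 t Phi & x = Phi u]].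

End Control.

(* Main.v *)
(* Write N x = |x| + |A x| for the graph norm.  The Lipschitz hypothesis at t = 0
   gives N(e^{aB} x) <= e^{k|a|} N x, while e^{hA} does not increase N; by the Trotter
   product formula N(e^{h(A+uB)} x) <= e^{k|u|h} N x, so that a trajectory starting in
   D(A) stays bounded in the graph norm in terms of the L^1 norm of the control only.
   Since B is A-bounded, Duhamel's formula then makes the end-point mapping Lipschitz
   on L^1-bounded sets of step controls for initial data in D(A); density of D(A) and
   contractivity extend this to uniform continuity for all initial data, and density
   of step functions gives the unique extension.
   For compactness, on a time segment of length h on which the control has integral v
   and L^1 norm rho, the propagator differs from e^{vB} e^{hA} by O(h rho) from D(A)
   to H.  Cutting [0, t] into K equal pieces, every trajectory ends within O(1/K) of
   the compact set of K-fold products e^{v_i B} e^{h_i A} with bounded v_i, h_i.  Hence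
   the set reached in time at most n with L^1 norm at most n is relatively compact.
   The differential inequalities all follow from one statement: if a curve has a right
   derivative within M of A y, it stays within M h of the semigroup of A. *)
Require Import Defs.
From mathcomp Require Import all_boot all_order all_algebra.
From mathcomp Require Import complex.
From mathcomp Require Import all_classical all_reals all_analysis.
From mathcomp Require Import ring lra.
Import Order.TTheory GRing.Theory Num.Theory.
Import numFieldNormedType.Exports.
Local Open Scope classical_set_scope.
Local Open Scope complex_scope.
Local Open Scope ring_scope.

Set Implicit Arguments.
Unset Strict Implicit.
Unset Printing Implicit Defensive.
(** * Real norm and real scaling *)

(** The graph-norm bound has to carry the factor 1 in front of its exponential: it is composed over
    the arbitrarily many steps of a control, and a factor C > 1 would become C^p. Maximal
    dissipativity of A + uB by itself only yields a bound with such a factor, depending on u. This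
    rough bound is still enough for the Trotter products to converge; each of their factors obeys a
    bound with front factor 1, and that bound survives in the limit. [expop] and [expgrp] are picked
    by [get] among all semigroups or groups with a given generator, so existence and uniqueness come
    before any estimate. Maximal dissipative operators are shown to generate contractions through
    resolvents and Euler products, and e^{tB} is glued from the semigroups of B - c and - B - c'.
    That B is A-bounded comes from the uniform boundedness principle. *)

Section RealNorm.
Context {R : realType} {H : completeNormedModType R[i]}.
Implicit Types (x y z : H) (a b t : R).

(* H is a module over R[i] whose norm takes values in R[i]; nr and rsc are the
   R-valued norm and the scaling by reals. *)
Definition nr x : R := complex.Re `|x|.
Definition rsc a x : H := a%:C *: x.

Lemma normE x : `|x| = (nr x)%:C.
Proof.
by rewrite /nr; have := normr_ge0 x; case: `|x| => a b; rewrite lecE/= => /andP[/eqP-> _].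
Qed.

Lemma nr_ge0 x : 0 <= nr x. Proof. by rewrite -ler0c -normE. Qed.
Lemma nr0 : nr 0 = 0. Proof. by apply: complexI; rewrite -normE normr0. Qed.
Lemma nr_eq0 x : nr x = 0 -> x = 0.
Proof. by move=> x0; apply/eqP; rewrite -normr_eq0 normE x0. Qed.
Lemma nrD x y : nr (x + y) <= nr x + nr y.
Proof. by rewrite -lecR rmorphD/= -!normE ler_normD. Qed.
Lemma nrN x : nr (- x) = nr x. Proof. by rewrite /nr normrN. Qed.
Lemma nrBC x y : nr (x - y) = nr (y - x). Proof. by rewrite -nrN opprB. Qed.
Lemma nrZ a x : nr (rsc a x) = `|a| * nr x.
Proof.
apply: complexI; rewrite -normE normrZ rmorphM/= normE; congr (_ * _).
by rewrite normc_def/= expr0n/= addr0 sqrtr_sqr.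
Qed.

Lemma rscDr a x y : rsc a (x + y) = rsc a x + rsc a y. Proof. exact: scalerDr. Qed.
Lemma rscDl a b x : rsc (a + b) x = rsc a x + rsc b x.
Proof. by rewrite /rsc rmorphD scalerDl. Qed.
Lemma rscA a b x : rsc a (rsc b x) = rsc (a * b) x.
Proof. by rewrite /rsc scalerA -rmorphM. Qed.
Lemma rsc1 x : rsc 1 x = x. Proof. exact: scale1r. Qed.
Lemma rsc0 x : rsc 0 x = 0. Proof. exact: scale0r. Qed.
Lemma rscN1 x : rsc (-1) x = - x. Proof. by rewrite /rsc rmorphN scaleN1r. Qed.
Lemma rscr0 a : rsc a 0 = 0. Proof. exact: scaler0. Qed.

(** Syntax for a reflexive tactic: [vval_eq] turns an equality of vectors into one scalar equality
    per atom, left to [ring] or [field]. *)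
Inductive vexp := VVar of nat | VZero | VAdd of vexp & vexp | VOpp of vexp | VScale of R & vexp.
Fixpoint vval (env : seq H) e : H := match e with
  | VVar i => nth 0 env i | VZero => 0 | VAdd e f => vval env e + vval env f
  | VOpp e => - vval env e | VScale a e => rsc a (vval env e) end.
Fixpoint vcoef e i : R := match e with
  | VVar j => if i == j then 1 else 0 | VZero => 0 | VAdd e f => vcoef e i + vcoef f i
  | VOpp e => - vcoef e i | VScale a e => a * vcoef e i end.

Lemma vvalE env e : vval env e = \sum_(i < size env) rsc (vcoef e i) (nth 0 env i).
Proof.
elim: e => [j||e IHe f IHf|e IHe|a e IHe] /=.
- have [js|sj] := ltnP j (size env).
    rewrite (bigD1 (Ordinal js))//= eqxx rsc1 big1 ?addr0// => i /eqP ij.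
    case: eqP => [ji|]; last by rewrite rsc0.
    by exfalso; apply: ij; exact: val_inj.
  rewrite nth_default// big1// => i _.
  by rewrite ltn_eqF ?rsc0// (leq_trans (ltn_ord i)).
- by rewrite big1// => i _; rewrite rsc0.
- by rewrite IHe IHf -big_split/=; apply: eq_bigr => i _; rewrite rscDl.
- rewrite IHe -sumrN; apply: eq_bigr => i _.
  by rewrite -rscN1 rscA mulN1r.
- by rewrite IHe [LHS]scaler_sumr; apply: eq_bigr => i _; exact: rscA.
Qed.

Lemma vval_eq env e f :
  foldr (fun i P => vcoef e i = vcoef f i /\ P) True (iota 0 (size env)) ->
  vval env e = vval env f.
Proof.
move=> ef; rewrite !vvalE; apply: eq_bigr => i _; congr (rsc _ _).
have : (i : nat) \in iota 0 (size env) by rewrite mem_iota add0n ltn_ord.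
by elim: (iota _ _) ef => //= j s IHs [ejf /IHs{}IHs]; rewrite inE => /predU1P[->|].
Qed.
End RealNorm.

Ltac vsame x y := match goal with _ => constr_eq x y | _ => unify x y end.
Ltac vmem x l := lazymatch l with
  | nil => constr:(false)
  | ?y :: ?l' => match goal with _ => let _ := match goal with _ => vsame x y end in constr:(true)
                 | _ => vmem x l' end end.
Ltac vatoms e l := lazymatch e with
  | (?x + ?y) => let l := vatoms x l in vatoms y l
  | (- ?x) => vatoms x l
  | (rsc _ ?x) => vatoms x l
  | (@GRing.zero _) => l
  | _ => lazymatch vmem e l with true => l | false => constr:(e :: l) end end.
Ltac vindex x l := lazymatch l with
  | ?y :: ?l' => match goal with _ => let _ := match goal with _ => vsame x y end in constr:(0%N)
                 | _ => let n := vindex x l' in constr:(S n) end end.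
Ltac vreify R e l := lazymatch e with
  | (?x + ?y) => let a := vreify R x l in let b := vreify R y l in constr:(@VAdd R a b)
  | (- ?x) => let a := vreify R x l in constr:(@VOpp R a)
  | (rsc ?t ?x) => let a := vreify R x l in constr:(@VScale R t a)
  | (@GRing.zero _) => constr:(@VZero R)
  | _ => let n := vindex e l in constr:(@VVar R n) end.
(* Equalities between real linear combinations, by comparing coefficients. *)
Ltac lmod_with tac :=
  lazymatch goal with |- @eq ?T ?x ?y =>
    lazymatch type of (@nr _ _ : T -> _) with _ -> Real.sort ?R =>
    let l0 := constr:(@nil T) in
    let l1 := vatoms x l0 in let l := vatoms y l1 in
    let a := vreify R x l in let b := vreify R y l in
    change (vval l a = vval l b);
    apply: vval_eq; rewrite /=; do ?split; tac end end.
Ltac lmod := lmod_with ltac:(first [by [] | by ring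
  | field; repeat (apply/andP; split); first [assumption | by apply: lt0r_neq0 | by []] ]).

Section RealNormTheory.
Context {R : realType} {H : completeNormedModType R[i]}.
Implicit Types (x y z : H) (a b t : R) (u : nat -> H).

Lemma nrB x y : nr (x - y) <= nr x + nr y.
Proof. by apply: le_trans (nrD _ _) _; rewrite nrN. Qed.

Lemma nr_dist x y z : nr (x - z) <= nr (x - y) + nr (y - z).
Proof. have -> : x - z = (x - y) + (y - z) by lmod. exact: nrD. Qed.

Lemma nr_sub x y : nr x - nr y <= nr (x - y).
Proof. by rewrite lerBlDr -{1}(subrK y x) nrD. Qed.

Lemma eq_nr_small x y : (forall e, 0 < e -> nr (x - y) <= e) -> x = y.
Proof.
move=> xy; apply/subr0_eq/nr_eq0/eqP; rewrite eq_le nr_ge0 andbT.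
by apply/ler_addgt0Pr => e e0; rewrite add0r xy.
Qed.

Lemma nrZ_ge0 a x : 0 <= a -> nr (rsc a x) = a * nr x.
Proof. by move=> a0; rewrite nrZ ger0_norm. Qed.

Lemma nr_cvgP (T : Type) (F : set_system T) (FF : Filter F) (f : T -> H) y :
  (f x @[x --> F] --> y) <->
  forall e : R, 0 < e -> \forall x \near F, nr (f x - y) < e.
Proof.
split=> [/cvgrPdist_lt fy e e0|fy].
  have e0' : (0 : R[i]) < e%:C by rewrite ltcR.
  by apply: filterS (fy _ e0') => x; rewrite normE ltcR nrBC.
apply/cvgrPdist_lt => e e0.
(* A positive element of R[i] is real, so complex radii reduce to real ones. *)
have eE : e = (complex.Re e)%:C.
  by move: e0; case: e => a b; rewrite ltcE/= => /andP[/eqP-> _].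
have : 0 < complex.Re e by rewrite -ltcR -eE.
by move=> /fy; apply: filterS => x; rewrite eE normE ltcR nrBC.
Qed.

Definition cvgs u y := forall e, 0 < e -> exists N, forall n, (N <= n)%N -> nr (u n - y) < e.

Lemma cauchy_cvgs u :
  (forall e, 0 < e -> exists N, forall m n, (N <= m)%N -> (N <= n)%N -> nr (u m - u n) < e) ->
  exists y, cvgs u y.
Proof.
move=> cu.
have /cauchy_cvgP/cvg_ex[y uy] : cauchy (u @ \oo).
  apply/cauchyP => e e0.
  have eE : e = (complex.Re e)%:C.
    by move: e0; case: e => a b; rewrite ltcE/= => /andP[/eqP-> _].
  have /cu[N NP] : 0 < complex.Re e by rewrite -ltcR -eE.
  exists (u N); exists N => //= n Nn.
  by rewrite -ball_normE/= eE normE ltcR NP.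
exists y => e e0.
have [N _ NP] := (nr_cvgP _ u y).1 uy e e0.
by exists N => n Nn; apply: NP.
Qed.

Lemma cvgs_unique u y z : cvgs u y -> cvgs u z -> y = z.
Proof.
move=> uy uz; apply: eq_nr_small => e e0.
have e2 : 0 < e / 2 by rewrite divr_gt0.
have [N NP] := uy _ e2; have [M MP] := uz _ e2.
have := NP _ (leq_maxl N M); have := MP _ (leq_maxr N M).
set v := u _ => vz vy; have := nr_dist y v z.
by rewrite (nrBC y v) => h; lra.
Qed.

Lemma nr_cvgs_le u y M : cvgs u y -> (forall n, nr (u n) <= M) -> nr y <= M.
Proof.
move=> uy uM; apply/ler_addgt0Pr => e e0; have [N /(_ N (leqnn _))] := uy _ e0.
by have := nr_sub y (u N); rewrite nrBC; have := uM N; lra.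
Qed.

Lemma denseP (D : set H) : dense D <-> forall x e, 0 < e -> exists2 y, D y & nr (x - y) < e.
Proof.
split=> [dD x e e0|dD O [x Ox] oO].
  have e0' : (0 : R[i]) < e%:C by rewrite ltcR.
  have [||y [/= + Dy]] := dD (ball x e%:C).
  - by exists x; exact: ballxx.
  - exact: ball_open.
  - by rewrite -ball_normE/= normE ltcR => xy; exists y.
have := open_nbhs_nbhs (conj oO Ox); rewrite -nbhs_ballE => -[e/= e0 eO].
have eE : e = (complex.Re e)%:C.
  by move: e0; case: e {eO} => a b; rewrite ltcE/= => /andP[/eqP-> _].
have /(dD x)[y Dy xy] : 0 < complex.Re e by rewrite -ltcR -eE.
exists y; split => //; apply: eO; rewrite -ball_normE/= eE normE ltcR; exact: xy.
Qed.

(** Real linearity is what the estimates use; complex linearity comes in only when an operator, a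
    semigroup or a group is constructed. *)
Definition rlin (f : H -> H) := forall a x y, f (rsc a x + y) = rsc a (f x) + f y.

Lemma linear_rlin (f : H -> H) : linear f -> rlin f.
Proof. by move=> lf a x y; exact: lf. Qed.

Section rlin.
Variables (f : H -> H) (lf : rlin f).
Lemma rlinD x y : f (x + y) = f x + f y.
Proof. by have := lf 1 x y; rewrite !rsc1. Qed.
Lemma rlin0 : f 0 = 0.
Proof. by have := rlinD 0 0; rewrite addr0 -{1}[f 0]addr0 => /addrI. Qed.
Lemma rlinZ a x : f (rsc a x) = rsc a (f x).
Proof. by have := lf a x 0; rewrite rlin0 !addr0. Qed.
Lemma rlinN x : f (- x) = - f x.
Proof. by rewrite -rscN1 rlinZ rscN1. Qed.
Lemma rlinB x y : f (x - y) = f x - f y.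
Proof. by rewrite rlinD rlinN. Qed.
End rlin.

Lemma rlin_comp (f g : H -> H) : rlin f -> rlin g -> rlin (f \o g).
Proof. by move=> lf lg a x y; rewrite /= lg lf. Qed.

Section op.
Variable A : operator H.
Local Notation D := (op_dom A).
Lemma op_rdomP a x y : D x -> D y -> D (rsc a x + y). Proof. exact: op_domP. Qed.
Lemma op_rlinP a x y : D x -> D y -> A (rsc a x + y) = rsc a (A x) + A y.
Proof. exact: op_linP. Qed.
Lemma op_domD x y : D x -> D y -> D (x + y).
Proof. by move=> Dx Dy; rewrite -[x]rsc1; exact: op_rdomP. Qed.
Lemma opD x y : D x -> D y -> A (x + y) = A x + A y.
Proof. by move=> Dx Dy; rewrite -{1}[x]rsc1 op_rlinP// rsc1. Qed.
Lemma op0 : A 0 = 0.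
Proof.
by have := opD (op_dom0 A) (op_dom0 A); rewrite addr0 -{1}[A 0]addr0 => /addrI.
Qed.
Lemma op_domZ a x : D x -> D (rsc a x).
Proof. by move=> Dx; rewrite -[rsc a x]addr0; exact: op_rdomP (op_dom0 A). Qed.
Lemma opZ a x : D x -> A (rsc a x) = rsc a (A x).
Proof. by move=> Dx; rewrite -[rsc a x]addr0 op_rlinP ?op0 ?addr0//; exact: op_dom0. Qed.
Lemma op_domN x : D x -> D (- x).
Proof. by move=> Dx; rewrite -rscN1; exact: op_domZ. Qed.
Lemma opN x : D x -> A (- x) = - A x.
Proof. by move=> Dx; rewrite -rscN1 opZ// rscN1. Qed.
Lemma op_domB x y : D x -> D y -> D (x - y).
Proof. by move=> Dx Dy; apply: op_domD => //; exact: op_domN. Qed.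
Lemma opB x y : D x -> D y -> A (x - y) = A x - A y.
Proof. by move=> Dx Dy; rewrite opD ?opN//; exact: op_domN. Qed.
End op.

End RealNormTheory.

(** * Evolution inequalities *)

Section Evolution.
Context {R : realType} {H : completeNormedModType R[i]}.
Implicit Types (x y z : H) (a b t s e d h : R) (S : R -> H -> H) (A : operator H).

Lemma near_rightP (P : R -> Prop) :
  (\forall t \near 0^'+, P t) <-> exists2 d, 0 < d & forall t, 0 < t < d -> P t.
Proof.
split=> [|[d d0 dP]].
  rewrite near_withinE => /nbhs_ballP[d /= d0 dP]; exists d => // t /andP[t0 td].
  by apply: dP => //; rewrite -ball_normE/= sub0r normrN gtr0_norm.
rewrite near_withinE; apply/nbhs_ballP; exists d => //= t.
rewrite -ball_normE/= sub0r normrN => td t0; apply: dP; rewrite t0/=.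
by rewrite gtr0_norm in td.
Qed.

Lemma near_punctP (P : R -> Prop) :
  (\forall t \near 0^', P t) <-> exists2 d, 0 < d & forall t, t != 0 -> `|t| < d -> P t.
Proof.
split=> [|[d d0 dP]].
  rewrite near_withinE => /nbhs_ballP[d /= d0 dP]; exists d => // t t0 td.
  by apply: dP => //; rewrite -ball_normE/= sub0r normrN.
rewrite near_withinE; apply/nbhs_ballP; exists d => //= t.
by rewrite -ball_normE/= sub0r normrN => td t0; apply: dP.
Qed.

(** Landau's o(t) at 0+. *)
Definition osmall (f : R -> H) :=
  forall e, 0 < e -> exists2 d, 0 < d & forall t, 0 < t < d -> nr (f t) <= e * t.

Definition hcont (f : H -> H) :=
  forall x e, 0 < e -> exists2 d, 0 < d & forall y, nr (y - x) < d -> nr (f y - f x) < e.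

Lemma continuous_hcont (f : H -> H) : continuous f -> hcont f.
Proof.
move=> cf x e e0; have /nr_cvgP/(_ e e0) := cf x.
move=> /nbhs_normP[d /= d0 dP].
have dE : d = (complex.Re d)%:C.
  by move: d0; case: d {dP} => a b; rewrite ltcE/= => /andP[/eqP-> _].
exists (complex.Re d); first by rewrite -ltcR -dE.
by move=> y xy; apply: dP; rewrite /= dE normE ltcR nrBC.
Qed.

(** Mean value inequality from a right derivative and left continuity. The times at which |F s - F
    0| <= (M + e) s form a set that contains its supremum by left continuity, and the right-hand
    bound leads past any supremum below T. *)
Lemma dini (F : R -> H) (T M : R) : 0 <= T -> 0 <= M ->
  (forall s, 0 < s <= T -> forall e, 0 < e -> exists2 d, 0 < d &
    forall k, 0 < k < d -> k <= s -> nr (F (s - k) - F s) <= e) ->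
  (forall s, 0 <= s < T -> forall e, 0 < e -> exists2 d, 0 < d &
    forall k, 0 < k < d -> s + k <= T -> nr (F (s + k) - F s) <= (M + e) * k) ->
  nr (F T - F 0) <= M * T.
Proof.
move=> T0 M0 leftF rightF.
suff main e : 0 < e -> nr (F T - F 0) <= (M + e) * T.
  apply/ler_addgt0Pr => e e0.
  have T1 : 0 < T + 1 by lra.
  have eT : 0 < e / (T + 1) by rewrite divr_gt0.
  apply: le_trans (main _ eT) _; rewrite mulrDl lerD2l mulrAC ler_pdivrMr//; nra.
move=> e0; pose E := [set s | 0 <= s <= T /\ nr (F s - F 0) <= (M + e) * s].
have E0 : E 0 by rewrite /E/= lexx T0 subrr nr0 mulr0.
have supE : has_sup E by split; [exists 0|exists T => s [/andP[]]].
pose s := sup E.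
have s0 : 0 <= s by apply: sup_upper_bound.
have sT : s <= T by apply: ge_sup; [exists 0|move=> r [/andP[]]].
have Es : E s.
  split; first by rewrite s0 sT.
  have [->|sn0] := eqVneq s 0; first by rewrite subrr nr0 mulr0.
  have {}s0 : 0 < s by rewrite lt_neqAle eq_sym sn0.
  apply/ler_addgt0Pr => e' e'0.
  have sr : 0 < s <= T by rewrite s0.
  have [d d0 dP] := leftF s sr _ e'0.
  have [r Er sdr] := sup_adherent d0 supE.
  have rs : r <= s by apply: sup_upper_bound.
  have [->|rns] := eqVneq s r; first by have [_] := Er; lra.
  have {}rs : r < s by rewrite lt_neqAle eq_sym rns.
  have [/andP[r0 _] rP] := Er.
  have := dP (s - r); rewrite subKr nrBC => /(_ _ _)/wrap[||h].
    by rewrite subr_gt0 rs/= ltrBlDr -ltrBlDl.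
    by lra.
  have := nr_dist (F s) (F r) (F 0); nra.
have [<-|sn] := eqVneq s T; first by case: Es.
have {}sT : s < T by rewrite lt_neqAle sn.
have sr : 0 <= s < T by rewrite s0.
have [d d0 dP] := rightF s sr _ e0.
pose k := Num.min (d / 2) (T - s).
have k0 : 0 < k by rewrite lt_min divr_gt0//= subr_gt0.
have kd : k <= d / 2 by rewrite ge_min lexx.
have kT : k <= T - s by rewrite ge_min lexx orbT.
have : E (s + k).
  split; first by lra.
  have := dP k; have -> : 0 < k < d by rewrite k0/=; lra.
  have -> : s + k <= T by lra.
  move=> /(_ isT isT) h; have := nr_dist (F (s + k)) (F s) (F 0).
  by have [_] := Es; lra.
by move=> /(sup_upper_bound supE); rewrite -/s; lra.
Qed.

(** Banach-Steinhaus by nested balls: each ball lies in the previous one with at most half its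
    radius, and on ball k + 1 some T n has norm at least k, so the orbit of the common point would
    be unbounded. *)
Lemma uniform_boundedness (T : nat -> H -> H) :
  (forall n, rlin (T n)) -> (forall n, hcont (T n)) ->
  (forall x, exists M, forall n, nr (T n x) <= M) ->
  exists2 M, 0 <= M & forall n x, nr (T n x) <= M * nr x.
Proof.
move=> linT contT bT; apply: contrapT => nbT.
have {}nbT M : 0 <= M -> exists n v, M * nr v < nr (T n v).
  move=> M0; apply: contrapT => nM; apply: nbT; exists M => // n x.
  by rewrite leNgt; apply/negP => h; apply: nM; exists n, x.
have step (k : nat) (x : H) (r : R) : 0 < r -> exists p : H * R,
    [/\ 0 < p.2, p.2 <= r / 2, nr (p.1 - x) <= r / 2 &
      exists n, forall y, nr (y - p.1) <= p.2 -> k%:R <= nr (T n y)].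
  move=> r0; have r2 : 0 < r / 2 by rewrite divr_gt0.
  (* Chosen so that a vector w of norm r / 2 has |T n w| > k + 1; the surplus 1 pays for the
     variation of T n on the next ball. *)
  pose M := (k.+1)%:R / (r / 2).
  have M0 : 0 <= M by rewrite divr_ge0// ltW.
  have [n [v nv]] := nbT M M0.
  have v0 : 0 < nr v.
    rewrite lt_neqAle nr_ge0 andbT eq_sym; apply/eqP => v0.
    by move: nv; rewrite (nr_eq0 v0) rlin0// nr0 mulr0 ltxx.
  pose w := rsc (r / 2 / nr v) v.
  have wr : nr w = r / 2 by rewrite nrZ_ge0 ?divrK ?unitfE ?gt_eqF// divr_ge0// ltW.
  have Tw : k.+1%:R < nr (T n w).
    rewrite /w rlinZ// nrZ_ge0; last by rewrite divr_ge0// ltW.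
    have -> : k.+1%:R = r / 2 / nr v * (M * nr v).
      by rewrite /M; field; rewrite !gt_eqF.
    by rewrite ltr_pM2l// divr_gt0.
  (* As 2 |T w| <= |T (x + w)| + |T (x - w)|, one of x + w and x - w has a large image. *)
  have [x' x'x Tx'] : exists2 x', nr (x' - x) <= r / 2 & k.+1%:R < nr (T n x').
    have [h|h] := ltP (k.+1%:R) (nr (T n (x + w))).
      by exists (x + w) => //; rewrite addrC addKr wr.
    exists (x - w); first by rewrite addrAC subrr sub0r nrN wr.
    have : nr (T n w) *+ 2 <= nr (T n (x + w)) + nr (T n (x - w)).
      rewrite rlinD// rlinB//; set a := T n x; set b := T n w.
      have -> : nr b *+ 2 = nr (rsc 2 b) by rewrite nrZ_ge0// mulr_natl.
      have -> : rsc 2 b = (a + b) - (a - b) by lmod.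
      exact: nrB.
    by rewrite mulr2n; lra.
  have [d d0 dP] := contT n x' 1 ltr01.
  exists (x', Num.min (r / 2) (d / 2)); split => //=.
  - by rewrite lt_min r2 divr_gt0.
  - by rewrite ge_min lexx.
  exists n => y; rewrite le_min => /andP[_ yd].
  have /dP : nr (y - x') < d by lra.
  have := nr_sub (T n x') (T n y); rewrite nrBC.
  by move: Tx'; rewrite -natr1; lra.
pose next k (p : H * R) := if pselect (0 < p.2) is left p0 then projT1 (cid (step k p.1 p.2 p0)) else p.
pose st := fix st k := if k is j.+1 then next j (st j) else ((0 : H), (1 : R)).
have st0 k : 0 < (st k).2.
  elim: k => //= k IHk; rewrite /next; case: pselect => // p0.
  by case: (cid _) => p [].
have stP k : [/\ (st k.+1).2 <= (st k).2 / 2, nr ((st k.+1).1 - (st k).1) <= (st k).2 / 2 &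
      exists n, forall y, nr (y - (st k.+1).1) <= (st k.+1).2 -> k%:R <= nr (T n y)].
  rewrite /= /next; case: pselect => [p0|/(_ (st0 k))//].
  by case: (cid _) => p [].
have near k j : nr ((st (k + j)%N).1 - (st k).1) <= (st k).2 - (st (k + j)%N).2.
  elim: j => [|j IHj]; first by rewrite addn0 !subrr nr0.
  rewrite addnS; have [h1 h2 _] := stP (k + j)%N.
  have := nr_dist (st (k + j).+1).1 (st (k + j)%N).1 (st k).1.
  lra.
have rad k : (st k).2 <= 2^-1 ^+ k.
  elim: k => [|k IHk]; first by rewrite expr0.
  by have [h _ _] := stP k; rewrite exprS; lra.
have [x xP] : exists x, cvgs (fun k => (st k).1) x.
  apply: cauchy_cvgs => e e0.
  have e2 : 0 < e / 2 by rewrite divr_gt0.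
  have [N NP] : exists N, 2^-1 ^+ N < e / 2 :> R.
    have h2 : `|2^-1 : R| < 1 by rewrite ger0_norm ?invr_ge0 ?ler0n// invf_lt1 ?ltr1n.
    have /cvgrPdist_lt/(_ _ e2)[N _ NP] := cvg_expr h2.
    by exists N; have := NP N (leqnn _); rewrite /= sub0r normrN ger0_norm// exprn_ge0.
  exists N => m n Nm Nn.
  have := near N (m - N)%N; have := near N (n - N)%N.
  rewrite !subnKC// => hn hm.
  have := nr_dist (st m).1 (st N).1 (st n).1.
  rewrite (nrBC (st N).1).
  by have := rad N; have := st0 n; have := st0 m; lra.
have xin k : nr (x - (st k).1) <= (st k).2.
  apply/ler_addgt0Pr => e e0; have [N NP] := xP _ e0.
  have := NP (k + N)%N (leq_addl _ _); have := near k N.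
  have := nr_dist x (st (k + N)%N).1 (st k).1.
  by rewrite (nrBC x (st (k + N)%N).1); have := st0 (k + N)%N; lra.
have [M MP] := bT x.
have M0 : 0 <= M by apply: le_trans (MP 0%N); exact: nr_ge0.
have [_ _ [n /(_ x (xin _))]] := stP (Num.trunc M).+1.
have := MP n; have := truncnS_gt M; lra.
Qed.

End Evolution.

(** * Contraction semigroups *)

Section Semigroups.
Context {R : realType} {H : completeNormedModType R[i]}.
Implicit Types (x y z : H) (a b t s k e d h : R) (S G : R -> H -> H) (A B : operator H).

(** Working interface of a contraction semigroup in terms of [nr]: A is contained in the generator
    of S, and its domain is invariant. *)
Record csg A S : Prop := Csg {
  csg_lin : forall t, 0 <= t -> rlin (S t);
  csg_le : forall t x, 0 <= t -> nr (S t x) <= nr x;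
  csg0 : forall x, S 0 x = x;
  csgD : forall s t x, 0 <= s -> 0 <= t -> S (s + t) x = S s (S t x);
  csg_cont : forall x e, 0 < e ->
    exists2 d, 0 < d & forall t, 0 <= t < d -> nr (S t x - x) < e;
  csg_gen : forall x, op_dom A x -> osmall (fun t => S t x - x - rsc t (A x));
  csg_dom : forall t x, 0 <= t -> op_dom A x -> op_dom A (S t x);
  csg_comm : forall t x, 0 <= t -> op_dom A x -> A (S t x) = S t (A x) }.

Lemma csg_leB A S t x y : csg A S -> 0 <= t -> nr (S t x - S t y) <= nr (x - y).
Proof. by move=> cS t0; rewrite -rlinB; [exact: csg_le cS _ _ t0|exact: csg_lin cS _ t0]. Qed.

(** The curve s |-> S (h - s) (y s) runs from S h (y 0) to y h, and its right derivative S (h - s)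
    (w - A (y s)) has norm at most M because S contracts; [dini] concludes. *)
Lemma duhamel A S (y : R -> H) (h M : R) : csg A S -> 0 <= h -> 0 <= M ->
  (forall s, 0 <= s < h -> op_dom A (y s)) ->
  (forall s, 0 < s <= h -> forall e, 0 < e -> exists2 d, 0 < d &
    forall k, 0 < k < d -> k <= s -> nr (y (s - k) - y s) <= e) ->
  (forall s, 0 <= s < h -> exists w, osmall (fun k => y (s + k) - y s - rsc k w) /\
     nr (w - A (y s)) <= M) ->
  nr (y h - S h (y 0)) <= M * h.
Proof.
move=> cS h0 M0 ydom yleft yder.
have S0 := csg0 cS; have SD := csgD cS.
pose F s := S (h - s) (y s).
have -> : y h - S h (y 0) = F h - F 0 by rewrite /F subrr S0 subr0.
apply: dini => //.
- move=> s /andP[s0 sh] e e0; have e2 : 0 < e / 2 by rewrite divr_gt0.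
  have srh : 0 < s <= h by rewrite s0.
  have [d d0 dP] := yleft s srh _ e2.
  have [d' d'0 d'P] := csg_cont cS (y s) e2.
  exists (Num.min d d'); first by rewrite lt_min d0.
  move=> k /andP[k0]; rewrite lt_min => /andP[kd kd'] ks.
  rewrite /F; have -> : h - (s - k) = (h - s) + k by ring.
  rewrite SD ?subr_ge0 ?(ltW k0)//.
  have hs : 0 <= h - s by rewrite subr_ge0.
  apply: le_trans (csg_leB _ _ cS hs) _.
  have k0d : 0 < k < d by rewrite k0.
  have := dP _ k0d ks; have := d'P k; rewrite (ltW k0) kd' => /(_ isT).
  have := nr_dist (S k (y (s - k))) (S k (y s)) (y s).
  by have := csg_leB (y (s - k)) (y s) cS (ltW k0); lra.
- move=> s /andP[s0 sh] e e0; have e2 : 0 < e / 2 by rewrite divr_gt0.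
  have srh : 0 <= s < h by rewrite s0.
  have [w [/(_ _ e2)[d d0 dP] wM]] := yder s srh.
  have [d' d'0 d'P] := csg_gen cS (ydom _ srh) e2.
  exists (Num.min d d'); first by rewrite lt_min d0.
  move=> k /andP[k0]; rewrite lt_min => /andP[kd kd'] skh.
  rewrite /F; have -> : h - s = (h - (s + k)) + k by ring.
  have hsk : 0 <= h - (s + k) by lra.
  rewrite (SD _ k _ hsk (ltW k0)).
  apply: le_trans (csg_leB _ _ cS hsk) _.
  have -> : y (s + k) - S k (y s) = (y (s + k) - y s - rsc k w) +
    rsc k (w - A (y s)) - (S k (y s) - y s - rsc k (A (y s))) by lmod.
  apply: le_trans (nrB _ _) _; apply: le_trans (lerD (nrD _ _) (lexx _)) _.
  rewrite nrZ_ge0 ?(ltW k0)//.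
  have := dP k; rewrite k0 kd => /(_ isT).
  have := d'P k; rewrite k0 kd' => /(_ isT).
  by nra.
Qed.

(** [expop] is only known to be a C0-semigroup until uniqueness is proved, so a local bound is
    needed without contractivity. If none held, operators S t_n with t_n <= 1/(n+1) would have norms
    exceeding n + 1 and yet bounded orbits, by strong continuity at 0. *)
Lemma C0_bounded S : C0_semigroup S ->
  exists2 d, 0 < d & exists2 M, 1 <= M & forall t x, 0 <= t <= d -> nr (S t x) <= M * nr x.
Proof.
move=> [linS S0 SD contS]; apply: contrapT => nb.
have {}nb n : exists tx : R * H, 0 <= tx.1 <= n.+1%:R^-1 /\ n.+1%:R * nr tx.2 < nr (S tx.1 tx.2).
  apply: contrapT => nP; apply: nb; exists n.+1%:R^-1; first by rewrite invr_gt0.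
  exists n.+1%:R; first by rewrite ler1n.
  move=> t x tn; rewrite leNgt; apply/negP => h; apply: nP; by exists (t, x).
pose tx n := projT1 (cid (nb n)).
have txP n : 0 <= (tx n).1 <= n.+1%:R^-1 /\ n.+1%:R * nr (tx n).2 < nr (S (tx n).1 (tx n).2).
  exact: projT2 (cid (nb n)).
have [|||M M0 MP] := @uniform_boundedness R H (fun n => S (tx n).1).
- by move=> n; apply: linear_rlin; have [/andP[t0 _] _] := txP n; have [] := linS _ t0.
- move=> n; apply: continuous_hcont; have [/andP[t0 _] _] := txP n.
  by have [] := linS _ t0.
- move=> x.
  have /nr_cvgP/(_ _ ltr01)/near_rightP[d d0 dP] := contS x.
  have [N NP] : exists N, forall n, (N <= n)%N -> n.+1%:R^-1 < d.
    exists (Num.trunc d^-1) => n Nn; rewrite -[d]invrK ltf_pV2 ?posrE ?invr_gt0//.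
    by rewrite (lt_le_trans (truncnS_gt _))// ler_nat.
  (* The sum covers the finitely many n whose time is not yet known to be below d. *)
  exists (\sum_(n < N) nr (S (tx n).1 x) + (nr x + 1)) => n.
  have [nN|Nn] := ltnP n N.
    rewrite (bigD1 (Ordinal nN))//= -addrA lerDl addr_ge0//.
      by apply: sumr_ge0 => i _; exact: nr_ge0.
    by rewrite addr_ge0// nr_ge0.
  have : nr (S (tx n).1 x) <= nr x + 1.
    have [/andP[t0 tn] _] := txP n.
    have [->|tn0] := eqVneq (tx n).1 0; first by rewrite S0 lerDl.
    have := dP (tx n).1; rewrite lt_neqAle eq_sym tn0 t0/= (le_lt_trans tn (NP _ Nn)).
    by move=> /(_ isT); have := nr_sub (S (tx n).1 x) x; lra.
  have : 0 <= \sum_(n < N) nr (S (tx n).1 x) by apply: sumr_ge0 => i _; exact: nr_ge0.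
  lra.
have [_] := txP (Num.trunc M); have := MP (Num.trunc M) (tx (Num.trunc M)).2.
have := nr_ge0 (tx (Num.trunc M)).2; have := truncnS_gt M; nra.
Qed.

Lemma C0_bounded_on S T : C0_semigroup S ->
  exists2 M, 0 < M & forall t x, 0 <= t <= T -> nr (S t x) <= M * nr x.
Proof.
move=> cS; have [d d0 [M M1 MP]] := C0_bounded cS; have [linS S0 SD _] := cS.
have M0 : 0 <= M by lra.
suff main n t x : 0 <= t <= n%:R * d -> nr (S t x) <= M ^+ n * nr x.
  exists (M ^+ (Num.trunc (T / d)).+1); first by rewrite exprn_gt0//; lra.
  move=> t x /andP[t0 tT]; apply: main; rewrite t0 (le_trans tT)//.
  by rewrite -ler_pdivrMr// ltW// truncnS_gt.
elim: n t x => [|n IHn] t x /andP[t0 td].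
  have -> : t = 0 by lra.
  by rewrite S0 expr0 mul1r.
have [tn|nt] := leP t (n%:R * d).
  apply: le_trans (IHn _ _ _) _; first by rewrite t0.
  by rewrite exprS -mulrA ler_peMl// mulr_ge0 ?nr_ge0// exprn_ge0.
have nd : 0 <= n%:R * d by rewrite mulr_ge0// ltW.
have -> : t = (t - n%:R * d) + n%:R * d by ring.
rewrite SD ?subr_ge0 ?(ltW nt)// exprS -mulrA.
apply: le_trans (MP _ _ _) _; last by rewrite ler_wpM2l// IHn// nd lexx.
by rewrite subr_ge0 (ltW nt)/= lerBlDl -[X in _ + X]mul1r -mulrDl natr1.
Qed.

Lemma C0_right S x e : C0_semigroup S -> 0 < e ->
  exists2 d, 0 < d & forall t, 0 <= t < d -> nr (S t x - x) < e.
Proof.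
move=> [_ S0 _ contS] e0.
have /nr_cvgP/(_ _ e0)/near_rightP[d d0 dP] := contS x.
exists d => // t /andP[t0 td]; have [->|tn0] := eqVneq t 0; first by rewrite S0 subrr nr0.
by apply: dP; rewrite lt_neqAle eq_sym tn0 t0.
Qed.

Lemma C0_left S s x : C0_semigroup S -> forall e, 0 < e -> exists2 d, 0 < d &
  forall k, 0 < k < d -> k <= s -> nr (S (s - k) x - S s x) <= e.
Proof.
move=> cS e e0; have [M M0 MP] := C0_bounded_on s cS; have [linS S0 SD _] := cS.
have eM : 0 < e / M by rewrite divr_gt0.
have [d d0 dP] := C0_right x cS eM; exists d => // k /andP[k0 kd] ks.
have -> : S s x = S (s - k) (S k x) by rewrite -SD ?subrK ?subr_ge0// ltW.
have sk0 : 0 <= s - k by rewrite subr_ge0.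
rewrite -rlinB; last by apply: linear_rlin; have [] := linS _ sk0.
apply: le_trans (MP _ _ _) _; first by rewrite sk0 gerBl ltW.
by rewrite -ler_pdivlMl// mulrC nrBC ltW// dP// (ltW k0).
Qed.

Lemma gen_osmallP (f : R -> H) y :
  ((t^-1)%:C *: f t @[t --> 0^'+] --> y) <-> osmall (fun t => f t - rsc t y).
Proof.
have eqf t : 0 < t -> nr ((t^-1)%:C *: f t - y) = t^-1 * nr (f t - rsc t y).
  move=> t0; rewrite -nrZ_ge0 ?invr_ge0 ?ltW//; congr nr.
  by rewrite -[_ *: _]/(rsc _ _); lmod.
split=> [/nr_cvgP fy e e0|fy].
  have /near_rightP[d d0 dP] := fy e e0; exists d => // t td.
  have /andP[t0 _] := td.
  by have := dP t td; rewrite eqf// mulrC ltr_pdivrMr// => /ltW.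
apply/nr_cvgP => e e0; apply/near_rightP.
have e2 : 0 < e / 2 by rewrite divr_gt0.
have [d d0 dP] := fy _ e2; exists d => // t td; have /andP[t0 _] := td.
rewrite eqf// mulrC ltr_pdivrMr// (le_lt_trans (dP t td))// ltr_pM2r//; lra.
Qed.

Lemma gen_osmall A S x : generates_semigroup A S -> op_dom A x ->
  osmall (fun t => S t x - x - rsc t (A x)).
Proof. by move=> [_ gS] Dx; apply/gen_osmallP/gS. Qed.

Lemma osmall_comp (f : H -> H) (u : R -> H) M : (forall x, nr (f x) <= M * nr x) ->
  osmall u -> osmall (f \o u).
Proof.
move=> fM ou e e0.
have eM : 0 < e / (`|M| + 1) by rewrite divr_gt0// ltr_pwDr.
have [d d0 dP] := ou _ eM; exists d => // t td; have /andP[t0 _] := td.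
apply: le_trans (fM _) _; have := dP t td; rewrite mulrAC ler_pdivlMr ?ltr_pwDr//.
have := nr_ge0 (u t); have := ler_norm M; nra.
Qed.

Lemma eq_osmall (f g : R -> H) : (forall t, 0 < t -> f t = g t) -> osmall f -> osmall g.
Proof.
move=> fg of_ e e0; have [d d0 dP] := of_ _ e0; exists d => // t td.
by have /andP[t0 _] := td; rewrite -fg// dP.
Qed.

Lemma gen_comm A S t x : generates_semigroup A S -> 0 <= t -> op_dom A x ->
  op_dom A (S t x) /\ A (S t x) = S t (A x).
Proof.
move=> gS t0 Dx; have [cS gen] := gS; apply/gen/gen_osmallP.
have [linS _ SD _] := cS; have [M M0 MP] := C0_bounded_on t cS.
have lin : rlin (S t) by apply: linear_rlin; have [] := linS _ t0.
have Mt z : nr (S t z) <= M * nr z by apply: MP; rewrite t0 lexx.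
apply: eq_osmall (osmall_comp Mt (gen_osmall gS Dx)) => s s0 /=.
by rewrite !rlinB// rlinZ// -!SD ?(ltW s0)// [s + t]addrC.
Qed.

Lemma gen_csg A S : generates_semigroup A S -> contractive S -> csg A S.
Proof.
move=> gS contrS; have [cS _] := gS; have [linS S0 SD _] := cS.
split => //.
- by move=> t t0; apply: linear_rlin; have [] := linS t t0.
- by move=> t x t0; have := contrS t t0 x; rewrite !normE lecR.
- by move=> s t x s0 t0; exact: SD.
- by move=> x e e0; exact: C0_right.
- by move=> x Dx; exact: gen_osmall.
- by move=> t x t0 Dx; have [] := gen_comm gS t0 Dx.
- by move=> t x t0 Dx; have [] := gen_comm gS t0 Dx.
Qed.

Lemma orbit_der A S s x : csg A S -> 0 <= s -> op_dom A x ->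
  osmall (fun k => S (s + k) x - S s x - rsc k (A (S s x))).
Proof.
move=> cS s0 Dx.
apply: eq_osmall (csg_gen cS (csg_dom cS s0 Dx)) => k k0.
by rewrite [s + k]addrC (csgD cS)// ltW.
Qed.

Lemma csg_left A S x s e : csg A S -> 0 < e -> exists2 d, 0 < d &
  forall k, 0 < k < d -> k <= s -> nr (S (s - k) x - S s x) <= e.
Proof.
move=> cS e0; have [d d0 dP] := csg_cont cS x e0; exists d => // k /andP[k0 kd] ks.
have sk0 : 0 <= s - k by rewrite subr_ge0.
have -> : S s x = S (s - k) (S k x) by rewrite -(csgD cS) ?subrK// ltW.
apply: le_trans (csg_leB _ _ cS sk0) _.
by rewrite nrBC ltW// dP// kd ltW.
Qed.

Lemma dense_eq (f g : H -> H) (D : set H) : dense D -> hcont f -> hcont g ->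
  (forall x, D x -> f x = g x) -> forall x, f x = g x.
Proof.
move=> /denseP dD cf cg fg x; apply: eq_nr_small => e e0.
have e2 : 0 < e / 2 by rewrite divr_gt0.
have [d d0 dP] := cf x _ e2; have [d' d'0 d'P] := cg x _ e2.
have dd : 0 < Num.min d d' by rewrite lt_min d0.
have [y Dy] := dD x _ dd; rewrite nrBC lt_min => /andP[xd xd'].
have := dP y xd; have := d'P y xd'; rewrite (fg _ Dy).
have := nr_dist (f x) (g y) (g x); rewrite (nrBC (f x) (g y)); lra.
Qed.

Lemma bounded_hcont (f : H -> H) M : rlin f -> (forall x, nr (f x) <= M * nr x) -> hcont f.
Proof.
move=> lf fM x e e0; exists (e / (`|M| + 1)); first by rewrite divr_gt0// ltr_pwDr.
move=> y; rewrite ltr_pdivlMr ?ltr_pwDr// -rlinB// => yx; apply: le_lt_trans (fM _) _.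
by have := nr_ge0 (y - x); have := ler_norm M; nra.
Qed.

Lemma csg_hcont A S t : csg A S -> 0 <= t -> hcont (S t).
Proof.
move=> cS t0; apply: (@bounded_hcont _ 1); first exact: csg_lin cS _ t0.
by move=> x; rewrite mul1r; exact: csg_le cS _ _ t0.
Qed.

(** An orbit of S' starting in the domain solves y' = A y, so [duhamel] with M = 0 identifies it
    with the orbit of S; density gives the other orbits. *)
Lemma csg_unique A S S' : dense (op_dom A) -> csg A S -> generates_semigroup A S' ->
  forall t x, 0 <= t -> S' t x = S t x.
Proof.
move=> dA cS gS' t x t0; have [cS' _] := gS'; have [linS' S'0 S'D _] := cS'.
apply: (dense_eq dA) x => [||x Dx].
- by apply: continuous_hcont; have [] := linS' _ t0.
- exact: csg_hcont cS t0.
apply: eq_nr_small => e e0.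
suff : nr (S' t x - S t (S' 0 x)) <= 0 * t by rewrite S'0 mul0r; lra.
apply: (duhamel (y := fun s => S' s x) cS) => //.
- by move=> s /andP[s0 _]; have [] := gen_comm gS' s0 Dx.
- by move=> s _ e' e'0; exact: C0_left.
- move=> s /andP[s0 _]; have [Ds _] := gen_comm gS' s0 Dx.
  exists (A (S' s x)); split; last by rewrite subrr nr0.
  by apply: eq_osmall (gen_osmall gS' Ds) => k k0; rewrite [s + k]addrC S'D// ltW.
Qed.

Lemma expop_csg A S : dense (op_dom A) -> generates_semigroup A S -> contractive S ->
  generates_semigroup A (expop A) /\ csg A (expop A).
Proof.
move=> dA gS contrS.
have gE : generates_semigroup A (expop A) by apply: (@getPex _ (generates_semigroup A)); exists S.
split=> //; apply: gen_csg => // t t0 x.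
by rewrite (csg_unique dA (gen_csg gS contrS) gE)//; exact: contrS.
Qed.

End Semigroups.

(** * Generation by maximal dissipative operators *)

Section InnerProduct.
Context {R : realType} {H : completeNormedModType R[i]}.
Variable dot : {dot H for @Num.conj R[i]}.
Hypothesis dot_norm : forall x : H, dot x x = `|x| ^+ 2.
Implicit Types (x y z w : H) (a b t e d h : R) (u v : nat -> H).

Definition re_dot x y : R := complex.Re (dot x y).

Lemma complexReE (z : R[i]) : 'Re z = (complex.Re z)%:C.
Proof. by rewrite ReJ_add numfield.Num.Theory.ReE. Qed.

Lemma reD (p q : R[i]) : complex.Re (p + q) = complex.Re p + complex.Re q.
Proof. by case: p q => ? ? []. Qed.

Lemma reZ a (p : R[i]) : complex.Re (a%:C * p) = a * complex.Re p.
Proof. by case: p => c d /=; rewrite mul0r subr0. Qed.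

Lemma rdC x y : re_dot x y = re_dot y x.
Proof.
have re_conj (z : R[i]) : complex.Re (Num.conj z) = complex.Re z by case: z.
by rewrite /re_dot hermC expr0 mul1r; exact: re_conj.
Qed.
Lemma rdDl x y z : re_dot (x + y) z = re_dot x z + re_dot y z.
Proof. by rewrite /re_dot linearDl; exact: reD. Qed.
Lemma rdZl a x z : re_dot (rsc a x) z = a * re_dot x z.
Proof. by rewrite /re_dot linearZl_LR; exact: reZ. Qed.
Lemma rdDr x y z : re_dot z (x + y) = re_dot z x + re_dot z y.
Proof. by rewrite rdC rdDl !(rdC z). Qed.
Lemma rdZr a x z : re_dot z (rsc a x) = a * re_dot z x.
Proof. by rewrite rdC rdZl rdC. Qed.
Lemma rdNl x z : re_dot (- x) z = - re_dot x z.
Proof. by rewrite -rscN1 rdZl mulN1r. Qed.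
Lemma rdNr x z : re_dot z (- x) = - re_dot z x.
Proof. by rewrite rdC rdNl rdC. Qed.
Lemma rd0l z : re_dot 0 z = 0. Proof. by rewrite -(rsc0 z) rdZl mul0r. Qed.
Lemma rdE x : re_dot x x = nr x ^+ 2.
Proof. by rewrite /re_dot dot_norm normE -rmorphXn. Qed.

Lemma rdZc (c : R[i]) x y : re_dot (c *: x) (c *: y) = complex.Re `|c| ^+ 2 * re_dot x y.
Proof.
rewrite /re_dot linearZl_LR/= linearZr_LR/= mulrA -normCK.
have -> : `|c| = (complex.Re `|c|)%:C.
  by have := normr_ge0 c; case: `|c| => a b; rewrite lecE/= => /andP[/eqP-> _].
by rewrite -rmorphXn; exact: reZ.
Qed.

Lemma nrD2 x y : nr (x + y) ^+ 2 = nr x ^+ 2 + 2 * re_dot x y + nr y ^+ 2.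
Proof. rewrite -!rdE !rdDl !rdDr (rdC y x); ring. Qed.

Lemma cauchy_schwarz x y : re_dot x y <= nr x * nr y.
Proof.
have [x0|xn0] := eqVneq (nr x) 0; first by rewrite (nr_eq0 x0) rd0l nr0 mul0r.
have [y0|yn0] := eqVneq (nr y) 0; first by rewrite (nr_eq0 y0) rdC rd0l nr0 mulr0.
have x0 : 0 < nr x by rewrite lt_neqAle eq_sym xn0 nr_ge0.
have y0 : 0 < nr y by rewrite lt_neqAle eq_sym yn0 nr_ge0.
have := sqr_ge0 (nr (rsc (nr y) x + rsc (- nr x) y)).
rewrite nrD2 !nrZ rdZl rdZr normrN !ger0_norm ?nr_ge0// => h.
have : 0 <= (nr x * nr y) * (nr x * nr y - re_dot x y) by nra.
by rewrite pmulr_rge0 ?mulr_gt0// subr_ge0.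
Qed.

Lemma rd_cvgs_le u v x w : cvgs u x -> cvgs v w -> (forall n, re_dot (u n) (v n) <= 0) -> re_dot x w <= 0.
Proof.
move=> ux vw uv; apply/ler_addgt0Pr => e e0; rewrite add0r.
have M0 : 0 < nr x + nr w + 1 by have := nr_ge0 x; have := nr_ge0 w; lra.
pose d := Num.min 1 (e / (nr x + nr w + 1)).
have d0 : 0 < d by rewrite lt_min ltr01 divr_gt0.
have d1 : d <= 1 by rewrite ge_min lexx.
have de : d * (nr x + nr w + 1) <= e by rewrite -ler_pdivlMr// ge_min lexx orbT.
have [N NP] := ux _ d0; have [M MP] := vw _ d0.
have := NP _ (leq_maxl N M); have := MP _ (leq_maxr N M).
set n := maxn N M => vnw unx; have := uv n.
have -> : re_dot x w = re_dot (x - u n) w + re_dot (u n) (w - v n) + re_dot (u n) (v n).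
  by rewrite rdDl rdNl rdDr rdNr; ring.
have := cauchy_schwarz (x - u n) w; have := cauchy_schwarz (u n) (w - v n).
rewrite (nrBC x) (nrBC w); have := nr_sub (u n) x.
have := nr_ge0 w; have := nr_ge0 x; have := nr_ge0 (u n); have := nr_ge0 (v n - w).
have := nr_ge0 (u n - x).
move: unx vnw; set P := nr (u n - x); set Q := nr (v n - w); set U := nr (u n).
set X := nr x; set W := nr w; set A := re_dot (x - u n) w; set B := re_dot (u n) (w - v n).
set C := re_dot (u n) (v n); move=> Pd Qd P0 Q0 U0 X0 W0 UX BU AP C0.
have : A <= d * W by nra.
have : U <= X + 1 by lra.
have : B <= (X + 1) * d by nra.
nra.
Qed.

(** A sequence minimizing the distance to E is Cauchy by the parallelogram identity. At its limit r
    the polynomial t |-> |y - r - t x|^2 - |y - r|^2 is nonnegative, so its linear coefficient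
    vanishes. *)
Lemma projection (E : set H) : E 0 -> (forall a x y, E x -> E y -> E (rsc a x + y)) ->
  (forall u y, (forall n, E (u n)) -> cvgs u y -> E y) ->
  forall y, exists2 r, E r & forall x, E x -> re_dot (y - r) x = 0.
Proof.
move=> E0 Elin Ecl y.
pose D := [set nr (y - x) | x in E].
have infD : has_inf D.
  by split; [exists (nr (y - 0)), 0|exists 0 => _ [x _ <-]; exact: nr_ge0].
pose d := inf D.
have dle x : E x -> d <= nr (y - x) by move=> Ex; apply: ge_inf; [exact: infD.2|exists x].
have d0 : 0 <= d by apply: lb_le_inf; [exact: infD.1|move=> _ [x _ <-]; exact: nr_ge0].
have ex n : exists x, E x /\ nr (y - x) < d + n.+1%:R^-1.
  have [_ [x Ex <-] xd] := @inf_adherent _ D n.+1%:R^-1 ltac:(by rewrite invr_gt0) infD.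
  by exists x.
pose u n := projT1 (cid (ex n)).
have uP n : E (u n) /\ nr (y - u n) < d + n.+1%:R^-1 by exact: projT2 (cid (ex n)).
have small e : 0 < e -> exists N, forall n, (N <= n)%N -> n.+1%:R^-1 < e.
  move=> e0; exists (Num.trunc e^-1) => n Nn; rewrite -[e]invrK ltf_pV2 ?posrE ?invr_gt0//.
  by rewrite (lt_le_trans (truncnS_gt _))// ler_nat.
have [r ur] : exists r, cvgs u r.
  apply: cauchy_cvgs => e e0.
  (* The parallelogram identity bounds |u m - u n|^2 by 4 ((d + q)^2 - d^2) = 8 d q + 4 q^2, which
     is below 8 (d + 1) q since q <= 1. *)
  pose q := Num.min 1 (e ^+ 2 / (8 * (d + 1))).
  have q0 : 0 < q by rewrite lt_min ltr01 divr_gt0 ?exprn_gt0// mulr_gt0//; lra.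
  have q1 : q <= 1 by rewrite ge_min lexx.
  have qe : q * (8 * (d + 1)) <= e ^+ 2.
    by rewrite -ler_pdivlMr ?ge_min ?lexx ?orbT// mulr_gt0//; lra.
  have [N NP] := small _ q0.
  exists N => m n Nm Nn.
  have [Em um] := uP m; have [En un] := uP n.
  have := NP _ Nm; have := NP _ Nn => nq mq.
  have : nr (u m - u n) ^+ 2 = 2 * nr (y - u m) ^+ 2 + 2 * nr (y - u n) ^+ 2
      - 4 * nr (y - rsc (1/2) (u m + u n)) ^+ 2.
    have -> : u m - u n = (y - u n) + (- (y - u m)) by lmod.
    have -> : y - rsc (1/2) (u m + u n) = rsc (1/2) ((y - u n) + (y - u m)) by lmod.
    rewrite nrZ_ge0 ?divr_ge0// exprMn (nrD2 _ (- (y - u m))) (nrD2 _ (y - u m)) nrN rdNr.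
    by field.
  have : d <= nr (y - rsc (1/2) (u m + u n)).
    apply: dle; have -> : rsc (1 / 2) (u m + u n) = rsc (1/2) (rsc 1 (u m) + u n) + 0 by lmod.
    by apply: (Elin _ _ _ _ E0); exact: Elin.
  have := nr_ge0 (y - u m); have := nr_ge0 (y - u n); move: um un.
  set p := nr (y - rsc (1/2) (u m + u n)); set X := nr (y - u m); set Y := nr (y - u n).
  move=> um un Y0 X0 dp uE.
  have {}um : X <= d + q by rewrite (le_trans (ltW um))// lerD2l ltW.
  have {}un : Y <= d + q by rewrite (le_trans (ltW un))// lerD2l ltW.
  have X2 : X ^+ 2 <= (d + q) ^+ 2 by nra.
  have Y2 : Y ^+ 2 <= (d + q) ^+ 2 by nra.
  have p2 : d ^+ 2 <= p ^+ 2 by nra.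
  rewrite -ltr_sqr ?nnegrE ?nr_ge0 ?(ltW e0)// uE.
  nra.
have Er : E r by apply: Ecl ur => n; have [] := uP n.
have rmin : nr (y - r) <= d.
  apply/ler_addgt0Pr => e e0; have e2 : 0 < e / 2 by rewrite divr_gt0.
  have [N NP] := small _ e2; have [M MP] := ur _ e2.
  have := NP _ (leq_maxl N M); have := MP _ (leq_maxr N M).
  have [_] := uP (maxn N M); have := nr_dist y (u (maxn N M)) r.
  move=> h1 h2 h3; rewrite -(ltrD2l d) => /(lt_trans h2){}h2.
  by lra.
exists r => // x Ex.
have main t : 0 <= - 2 * t * re_dot (y - r) x + t ^+ 2 * nr x ^+ 2.
  have : nr (y - r) ^+ 2 <= nr (y - (rsc t x + r)) ^+ 2.
    by rewrite ler_sqr ?nnegrE ?nr_ge0// (le_trans rmin)// dle//; exact: Elin.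
  have -> : y - (rsc t x + r) = (y - r) + rsc (- t) x by lmod.
  by rewrite (nrD2 (y - r)) nrZ rdZr normrN exprMn real_normK ?num_real//; lra.
have [x0|xn0] := eqVneq (nr x) 0; first by rewrite (nr_eq0 x0) rdC rd0l.
have x0 : 0 < nr x ^+ 2 by rewrite exprn_gt0// lt_neqAle eq_sym xn0 nr_ge0.
(* The minimizer of the quadratic polynomial. *)
have := main (re_dot (y - r) x / nr x ^+ 2).
have -> : - 2 * (re_dot (y - r) x / nr x ^+ 2) * re_dot (y - r) x +
   (re_dot (y - r) x / nr x ^+ 2) ^+ 2 * nr x ^+ 2 = - (re_dot (y - r) x ^+ 2 / nr x ^+ 2).
  by field.
rewrite oppr_ge0 pmulr_lle0 ?invr_gt0// => h.
by apply/eqP; rewrite -sqrf_eq0 eq_le h sqr_ge0.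
Qed.

End InnerProduct.

(** * Resolvents of a maximal dissipative operator *)

Section Resolvent.
Context {R : realType} {H : completeNormedModType R[i]}.
Variable dot : {dot H for @Num.conj R[i]}.
Hypothesis dot_norm : forall x : H, dot x x = `|x| ^+ 2.
Implicit Types (x y z w : H) (a b t e d h : R) (u : nat -> H).
Variable A : operator H.
Hypothesis Amax : maximal_dissipative dot A.
Local Notation D := (op_dom A).
Local Notation rd := (re_dot dot).

Lemma Adense : dense D. Proof. by have [] := Amax. Qed.

Lemma diss_rd x : D x -> rd x (A x) <= 0.
Proof. by have [_ + _] := Amax => /[apply]; rewrite complexReE lecR. Qed.

(* The maximality criterion of monotone operators: a pair in monotone relation
   with the graph of A belongs to it. *)
Lemma maximal_dom z w : (forall x, D x -> rd (x + z) (A x + w) <= 0) -> D z.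
Proof.
move=> zw; apply: contrapT => nDz.
(* Candidate extension of A to the span of its domain and z, sending z to w; it is single-valued
   because z is outside the domain. *)
pose graph y (v : H) := exists (a : R[i]) x, [/\ D x, y = x + a *: z & v = A x + a *: w].
pose app y := xget 0 (graph y).
have uniq (a b : R[i]) x y : D x -> D y -> x + a *: z = y + b *: z -> a = b /\ x = y.
  move=> Dx Dy xy; have [ab|/eqP ab] := eqVneq a b.
    by split=> //; move: xy; rewrite ab => /addIr.
  exfalso; apply: nDz.
  have abn0 : a - b != 0 by rewrite subr_eq0; apply/eqP.
  have -> : z = (a - b)^-1 *: (y - x) + 0.
    rewrite addr0; apply: (scalerI abn0); rewrite scalerA mulfV// scale1r scalerBl.
    by apply/(addIr (b *: z))/(addrI x); rewrite subrK xy addrA [x + (y - x)]addrC subrK.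
  by apply: op_domP; [exact: op_domB|exact: op_dom0].
have appE (a : R[i]) x : D x -> app (x + a *: z) = A x + a *: w.
  move=> Dx; rewrite /app; have [|b [y [Dy yx ->]]] := @xgetPex _ 0 (graph (x + a *: z)).
    by exists (A x + a *: w), a, x.
  by have [-> ->] := uniq _ _ _ _ Dx Dy yx.
pose dom := [set y | exists (a : R[i]) x, D x /\ y = x + a *: z].
have dom0 : dom 0 by exists 0, 0; rewrite scale0r addr0; split => //; exact: op_dom0.
have comb (c a b : R[i]) x y : c *: (x + a *: z) + (y + b *: z) = (c *: x + y) + (c * a + b) *: z.
  by rewrite scalerDr scalerDl scalerA addrACA.
have domP (c : R[i]) x y : dom x -> dom y -> dom (c *: x + y).
  move=> [a [x' [Dx' ->]]] [b [y' [Dy' ->]]]; exists (c * a + b), (c *: x' + y').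
  by rewrite comb; split => //; exact: op_domP.
have linP (c : R[i]) x y : dom x -> dom y -> app (c *: x + y) = c *: app x + app y.
  move=> [a [x' [Dx' ->]]] [b [y' [Dy' ->]]].
  rewrite comb !appE//; last exact: op_domP.
  by rewrite op_linP// scalerDr scalerDl scalerA addrACA.
pose A' := Operator dom0 domP linP.
have DA' x : D x -> dom x by move=> Dx; exists 0, x; rewrite scale0r addr0.
have [_ _ Amx] := Amax; apply: nDz; apply: (Amx A').
- move=> _ /= [a [x [Dx ->]]]; rewrite appE// complexReE lecR.
  have [->|an0] := eqVneq a 0; first by rewrite !scale0r !addr0; exact: diss_rd.
  (* Writing x + a z = a (a^-1 x + z) reduces to a = 1, since the form scales by |a|^2. *)
  have xE : x = a *: (a^-1 *: x) by rewrite scalerA mulfV// scale1r.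
  have Dx' : D (a^-1 *: x) by rewrite -[_ *: _]addr0; apply: op_domP => //; exact: op_dom0.
  have -> : A x = a *: A (a^-1 *: x).
    rewrite {1}xE -[a *: _]addr0 op_linP//; last exact: op_dom0.
    by rewrite op0 addr0.
  rewrite {1}xE -!scalerDr; have := rdZc dot a (a^-1 *: x + z) (A (a^-1 *: x) + w).
  rewrite {1}/re_dot => ->; apply: mulr_ge0_le0; first exact: sqr_ge0.
  exact: zw.
- split; first exact: DA'.
  by move=> x Dx /=; rewrite -[x in app x]addr0 -(scale0r z) appE// scale0r addr0.
- by exists 1, 0; rewrite scale1r add0r; split => //; exact: op_dom0.
Qed.

(** With z in the domain, testing with d x - z gives Re <x, d A x + q> <= 0 for q = w - A z and d >
    0. As d tends to 0 this makes q orthogonal to the dense domain. *)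
Lemma maximal_graph z w : (forall x, D x -> rd (x + z) (A x + w) <= 0) -> D z /\ A z = w.
Proof.
move=> zw; have Dz := maximal_dom zw; split=> //.
pose q := w - A z.
have le0 x : D x -> rd x q <= 0.
  move=> Dx; apply/ler_addgt0Pr => e e0; rewrite add0r.
  pose d := e / (`|rd x (A x)| + 1).
  have d0 : 0 < d by rewrite divr_gt0// ltr_pwDr.
  have de : d * (`|rd x (A x)| + 1) = e by rewrite /d divfK// gt_eqF// ltr_pwDr.
  have := zw (rsc d x - z) (op_domB (op_domZ d Dx) Dz).
  rewrite opB ?opZ//; last exact: op_domZ.
  have -> : rsc d x - z + z = rsc d x by lmod.
  have -> : rsc d (A x) - A z + w = rsc d (A x) + q by rewrite /q; lmod.
  rewrite rdZl rdDr rdZr pmulr_rle0//.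
  have := ler_norm (- rd x (A x)); rewrite normrN.
  move: de; set M := `|_|; nra.
have eq0 x : D x -> rd x q = 0.
  move=> Dx; apply/eqP; rewrite eq_le le0//=.
  by have := le0 _ (op_domN Dx); rewrite rdNl oppr_le0.
suff : q = 0 by move=> /subr0_eq.
apply: nr_eq0; apply/eqP; rewrite eq_le nr_ge0 andbT; apply/ler_addgt0Pr => e e0; rewrite add0r.
have [x Dx qx] := (denseP D).1 Adense q e e0.
have : nr q ^+ 2 <= nr (q - x) * nr q.
  rewrite -(rdE dot_norm) -{1}(subrK x q) rdDl (eq0 _ Dx) addr0; exact: cauchy_schwarz.
have [->|qn0] := eqVneq (nr q) 0; first by move=> _; exact: ltW.
have q0 : 0 < nr q by rewrite lt_neqAle eq_sym qn0 nr_ge0.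
by rewrite expr2 ler_pM2r// => /le_trans; apply; exact: ltW.
Qed.

Lemma resolvent_le h x : 0 <= h -> D x -> nr x <= nr (x - rsc h (A x)).
Proof.
move=> h0 Dx; have := cauchy_schwarz dot_norm x (x - rsc h (A x)).
rewrite rdDr rdNr rdZr (rdE dot_norm) => cs.
have := diss_rd Dx; have := nr_ge0 x => x0 dis.
have {}cs : nr x ^+ 2 <= nr x * nr (x - rsc h (A x)) by nra.
have [x00|xn0] := eqVneq (nr x) 0; first by rewrite x00 nr_ge0.
by rewrite -(@ler_pM2l _ (nr x)) -?expr2// lt_neqAle eq_sym xn0.
Qed.

(** The range of 1 - h A is closed. If z is orthogonal to it, then <z, x> = h <z, A x> in real part,
    so (z, - z / h) is in monotone relation with the graph. Hence A z = - z / h, and z - h A z = 2 z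
    lies in the range, which forces z = 0. *)
Lemma resolvent_ex h y : 0 < h -> exists x, D x /\ x - rsc h (A x) = y.
Proof.
move=> h0; pose E := [set y | exists x, D x /\ x - rsc h (A x) = y].
have E0 : E 0 by exists 0; split; [exact: op_dom0|rewrite op0 rscr0 subr0].
have Elin a x z : E x -> E z -> E (rsc a x + z).
  move=> [x' [Dx <-]] [z' [Dz <-]]; exists (rsc a x' + z'); split; first exact: op_rdomP.
  by rewrite op_rlinP//; lmod.
have Ecl u z : (forall n, E (u n)) -> cvgs u z -> E z.
  move=> Eu uz; pose v n := projT1 (cid (Eu n)).
  have vP n : D (v n) /\ v n - rsc h (A (v n)) = u n by exact: projT2 (cid (Eu n)).
  have [x vx] : exists x, cvgs v x.
    apply: cauchy_cvgs => e e0; have e2 : 0 < e / 2 by rewrite divr_gt0.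
    have [N NP] := uz _ e2; exists N => m n Nm Nn.
    have [Dm um] := vP m; have [Dn un] := vP n.
    apply: le_lt_trans (resolvent_le (ltW h0) (op_domB Dm Dn)) _; rewrite opB//.
    have -> : v m - v n - rsc h (A (v m) - A (v n)) = u m - u n.
      by rewrite -um -un; lmod.
    have := NP m Nm; have := NP n Nn; have := nr_dist (u m) z (u n).
    rewrite (nrBC z); lra.
  have Avx : cvgs (fun n => A (v n)) (rsc h^-1 (x - z)).
    move=> e e0; have he : 0 < h * e / 2 by rewrite divr_gt0// mulr_gt0.
    have [N NP] := vx _ he; have [M MP] := uz _ he.
    exists (maxn N M) => n; rewrite geq_max => /andP[Nn Mn].
    have [_ un] := vP n.
    have -> : A (v n) - rsc h^-1 (x - z) = rsc h^-1 ((v n - x) - (u n - z)).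
      by rewrite -un; lmod.
    rewrite nrZ_ge0 ?invr_ge0 ?ltW// mulrC ltr_pdivrMr//.
    apply: le_lt_trans (nrB _ _) _.
    by have := NP n Nn; have := MP n Mn; lra.
  exists x.
  (* The limit of the pairs (v n, A (v n)) is still in monotone relation with the graph, so no
     separate closedness of A is required. *)
  have [|Dx ->] := @maximal_graph x (rsc h^-1 (x - z)).
    move=> y' Dy'; apply: (rd_cvgs_le dot_norm (u := fun n => y' + v n) (v := fun n => A y' + A (v n))).
    - move=> e e0; have [N NP] := vx _ e0; exists N => n /NP.
      by have -> : y' + v n - (y' + x) = v n - x by lmod.
    - move=> e e0; have [N NP] := Avx _ e0; exists N => n /NP.
      set w := rsc _ _.
      by have -> : A y' + A (v n) - (A y' + w) = A (v n) - w by lmod.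
    - by move=> n; rewrite -opD//; [apply: diss_rd; apply: op_domD|]; have [] := vP n.
  by split=> //; lmod.
have [r [x [Dx <-]] orth] := projection dot_norm E0 Elin Ecl y.
have {orth}[z zE orth] : exists2 z, z = y - (x - rsc h (A x)) & forall x, E x -> rd z x = 0.
  by exists (y - (x - rsc h (A x))).
have [|Dz Az] := @maximal_graph z (rsc (- h^-1) z).
  move=> x' Dx'.
  have : rd z (x' - rsc h (A x')) = 0 by apply: orth; exists x'.
  rewrite rdDr rdNr rdZr => /eqP; rewrite subr_eq0 => /eqP zx'.
  have -> : rd (x' + z) (A x' + rsc (- h^-1) z) = rd x' (A x') - h^-1 * rd z z.
    by rewrite rdDl !rdDr !rdZr (rdC dot x' z) zx'; field; rewrite gt_eqF.
  have := diss_rd Dx'; rewrite (rdE dot_norm).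
  have : 0 <= h^-1 * nr z ^+ 2 by rewrite mulr_ge0 ?invr_ge0 ?sqr_ge0 ?ltW.
  by lra.
have z0 : z = 0.
  apply: nr_eq0; apply/eqP; rewrite -sqrf_eq0 -(rdE dot_norm).
  have : rd z (z - rsc h (A z)) = 0 by apply: orth; exists z.
  rewrite Az; have -> : z - rsc h (rsc (- h^-1) z) = rsc 2 z by lmod.
  rewrite rdZr => h2.
  by apply/eqP; lra.
by exists x; split => //; apply/esym/subr0_eq; rewrite -zE.
Qed.

(* [res h] is [(1 - h A)^{-1}] for h > 0, and the identity for h <= 0. *)
Definition res h y := if h > 0 then xget 0 [set x | D x /\ x - rsc h (A x) = y] else y.

Lemma resP h y : 0 < h -> D (res h y) /\ res h y - rsc h (A (res h y)) = y.
Proof.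
move=> h0; rewrite /res h0.
by apply: (@xgetPex _ 0 [set x | D x /\ x - rsc h (A x) = y]); exact: resolvent_ex.
Qed.

Lemma resE h x y : 0 <= h -> D x -> x - rsc h (A x) = y -> res h y = x.
Proof.
rewrite le_eqVlt => /predU1P[<-|h0] Dx xy; first by rewrite /res ltxx -xy rsc0 subr0.
have [Dr rE] := resP y h0; apply/subr0_eq/nr_eq0/eqP; rewrite eq_le nr_ge0 andbT.
apply: le_trans (resolvent_le (ltW h0) (op_domB Dr Dx)) _; rewrite opB//.
have -> : res h y - x - rsc h (A (res h y) - A x) =
   (res h y - rsc h (A (res h y))) - (x - rsc h (A x)) by lmod.
by rewrite rE xy subrr nr0.
Qed.

Lemma res_clin h : linear (res h).
Proof.
have [h0|h0] := ltP 0 h; last by move=> a x y; rewrite /res ltNge h0.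
move=> a x y; have [Dx xE] := resP x h0; have [Dy yE] := resP y h0.
apply: resE; [exact: ltW|exact: op_domP|].
rewrite op_linP// -{3}xE -{3}yE /rsc scalerDr !scalerBr !scalerA [a * _]mulrC.
by rewrite opprD addrACA.
Qed.

Lemma res_lin h : rlin (res h). Proof. exact: linear_rlin (res_clin h). Qed.

Lemma res_le h x : nr (res h x) <= nr x.
Proof.
have [h0|h0] := ltP 0 h; last by rewrite /res ltNge h0.
have [Dx xE] := resP x h0.
by apply: le_trans (resolvent_le (ltW h0) Dx) _; rewrite xE.
Qed.

Lemma res_dom h x : 0 <= h -> D x -> D (res h x).
Proof.
rewrite le_eqVlt => /predU1P[<-|h0] Dx; first by rewrite /res ltxx.
by have [] := resP x h0.
Qed.

Lemma res_comm h x : 0 <= h -> D x -> A (res h x) = res h (A x).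
Proof.
rewrite le_eqVlt => /predU1P[<-|h0] Dx; first by rewrite /res ltxx.
have [Dr rE] := resP x h0.
have AE : A (res h x) = rsc h^-1 (res h x - x) by rewrite -{3}rE; lmod.
apply/esym/resE; first exact: ltW.
  by rewrite AE; apply: op_domZ; exact: op_domB.
by rewrite {2}AE opZ ?opB//; [lmod|exact: op_domB].
Qed.

Lemma res_id h x : 0 <= h -> D x -> res h x - x = rsc h (res h (A x)).
Proof.
move=> h0 Dx; rewrite -res_comm//; move: h0.
rewrite le_eqVlt => /predU1P[<-|h0]; first by rewrite rsc0 /res ltxx subrr.
by have [_ {2}<-] := resP x h0; lmod.
Qed.

End Resolvent.

(** * Limits of sequences and iterates of contractions *)

Section Iterates.
Context {R : realType} {H : completeNormedModType R[i]}.
Implicit Types (x y z w : H) (a b t e d h : R) (u v : nat -> H).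

Lemma cvgs_lin (a : R[i]) u v x y : cvgs u x -> cvgs v y ->
  cvgs (fun n => a *: u n + v n) (a *: x + y).
Proof.
move=> ux vy e e0; pose M := complex.Re `|a|.
have aE : `|a| = M%:C.
  by rewrite /M; have := normr_ge0 a; case: `|a| => p q; rewrite lecE/= => /andP[/eqP-> _].
have M0 : 0 <= M by rewrite -ler0c -aE.
have nrZc z : nr (a *: z) = M * nr z.
  by apply: complexI; rewrite rmorphM/= -!normE normrZ aE.
have eM : 0 < e / (2 * (M + 1)) by rewrite divr_gt0// mulr_gt0//; lra.
have e2 : 0 < e / 2 by rewrite divr_gt0.
have [N NP] := ux _ eM; have [N' N'P] := vy _ e2.
exists (maxn N N') => n; rewrite geq_max => /andP[/NP + /N'P].
have -> : a *: u n + v n - (a *: x + y) = a *: (u n - x) + (v n - y).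
  by rewrite scalerBr opprD addrACA.
rewrite ltr_pdivlMr; last by rewrite mulr_gt0//; lra.
have := nrD (a *: (u n - x)) (v n - y); rewrite nrZc.
by have := nr_ge0 (u n - x); nra.
Qed.

Lemma cvgs_cst x : cvgs (fun=> x) x.
Proof. by move=> e e0; exists 0%N => n _; rewrite subrr nr0. Qed.

Lemma cvgsB u v x y : cvgs u x -> cvgs v y -> cvgs (fun n => u n - v n) (x - y).
Proof.
move=> ux vy; have := cvgs_lin (-1) vy ux.
rewrite scaleN1r addrC => uv e /uv[N NP]; exists N => n /NP.
by rewrite scaleN1r [- _ + _]addrC.
Qed.

Lemma cvgs_sub0 u v x : cvgs u x -> (forall e, 0 < e -> exists N, forall n, (N <= n)%N -> nr (u n - v n) < e) ->
  cvgs v x.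
Proof.
move=> ux uv e e0; have e2 : 0 < e / 2 by rewrite divr_gt0.
have [N NP] := ux _ e2; have [M MP] := uv _ e2.
exists (maxn N M) => n; rewrite geq_max => /andP[/NP + /MP].
by have := nr_dist (v n) (u n) x; rewrite (nrBC (v n) (u n)); lra.
Qed.

Section contraction.
Variables (f : H -> H) (f_lin : rlin f) (f_le : forall x, nr (f x) <= nr x).

Lemma iter_le n x : nr (iter n f x) <= nr x.
Proof. by elim: n => //= n; exact: le_trans. Qed.

Lemma iter_lin n : rlin (iter n f).
Proof. by elim: n => // n IHn a x y; rewrite !iterS IHn f_lin. Qed.

(** f^(n+1) - g^(n+1) = f^n (f - g) + g (f^n - g^n) for commuting maps, and the outer maps
    contract. *)
Lemma iter_telescope (g : H -> H) n x : rlin g -> (forall x, nr (g x) <= nr x) ->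
  (forall x, f (g x) = g (f x)) -> nr (iter n f x - iter n g x) <= n%:R * nr (f x - g x).
Proof.
move=> lg gle fg; elim: n => [|n IHn]; first by rewrite subrr nr0 mul0r.
have fgn m y : iter m f (g y) = g (iter m f y) by elim: m => //= m ->.
rewrite iterSr [iter n.+1 g x]iterS.
have -> : iter n f (f x) - g (iter n g x) =
   iter n f (f x - g x) + g (iter n f x - iter n g x).
  by rewrite rlinB ?fgn; [rewrite rlinB//; lmod|exact: iter_lin].
apply: le_trans (nrD _ _) _; rewrite -natr1 mulrDl mul1r addrC lerD//.
  exact: le_trans IHn.
exact: iter_le.
Qed.

Lemma iter_sub n x : nr (iter n f x - x) <= n%:R * nr (f x - x).
Proof.
have -> : iter n f x - x = iter n f x - iter n idfun x by congr (_ - _); elim: n.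
exact: iter_telescope.
Qed.

(** f^m x - x is the sum of the h f^j z for 1 <= j <= m. In the application f is a resolvent and z =
    A x. *)
Lemma iter_expand h d n x z : 0 <= h -> f x - x = rsc h (f z) ->
  (forall j, (j <= n)%N -> nr (iter j f z - z) <= d) ->
  forall m, (m <= n)%N -> nr (iter m f x - x - rsc (m%:R * h) z) <= m%:R * h * d.
Proof.
move=> h0 fx zd; elim=> [|m IHm] mn.
  have -> : iter 0 f x - x - rsc (0%:R * h) z = 0 by rewrite /= mul0r; lmod.
  by rewrite nr0 !mul0r.
have -> : iter m.+1 f x - x - rsc (m.+1%:R * h) z =
   (iter m f x - x - rsc (m%:R * h) z) + rsc h (iter m.+1 f z - z).
  rewrite !iterSr; have -> : iter m f (f x) = rsc h (iter m f (f z)) + iter m f x.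
    by rewrite -iter_lin -fx subrK.
  by rewrite -natr1; lmod.
apply: le_trans (nrD _ _) _; rewrite -natr1 !mulrDl mul1r lerD//; first exact/IHm/ltnW.
by rewrite nrZ_ge0// ler_wpM2l// zd.
Qed.
End contraction.
End Iterates.

(** * The exponential formula for e^{tA} *)

Section Generation.
Context {R : realType} {H : completeNormedModType R[i]}.
Variable dot : {dot H for @Num.conj R[i]}.
Hypothesis dot_norm : forall x : H, dot x x = `|x| ^+ 2.
Implicit Types (x y z w : H) (a b t e d h : R) (u v : nat -> H).
Variable A : operator H.
Hypothesis Amax : maximal_dissipative dot A.
Local Notation D := (op_dom A).
Local Notation J := (res A).
Let Jlin h : rlin (J h) := res_lin dot_norm Amax h.
Let Jle h x : nr (J h x) <= nr x := res_le dot_norm Amax h x.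

Lemma resK h x : 0 <= h -> J h x - rsc h (A (J h x)) = x.
Proof.
rewrite le_eqVlt => /predU1P[<-|h0]; first by rewrite /res ltxx rsc0 subr0.
by have [] := resP dot_norm Amax x h0.
Qed.

(** From (1 - a A)(1 - b A) = 1 - (a + b) A + a b A^2, the difference of the two resolvents is a b J
    (a + b) applied to A^2 J a (J b x). *)
Lemma res_split a b x : 0 <= a -> 0 <= b -> D x -> D (A x) ->
  nr (J (a + b) x - J a (J b x)) <= a * b * nr (A (A x)).
Proof.
move=> a0 b0 Dx DAx; have [w wdef] : exists w, w = J a (J b x) by eexists.
have Dbx : D (J b x) by apply: (res_dom dot_norm Amax).
have Dw : D w by rewrite wdef; apply: (res_dom dot_norm Amax).
have AwE : A w = J a (J b (A x)) by rewrite wdef !(res_comm dot_norm Amax).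
have DAw : D (A w) by rewrite AwE; do 2![apply: (res_dom dot_norm Amax) => //].
have AAwE : A (A w) = J a (J b (A (A x))).
  by rewrite AwE !(res_comm dot_norm Amax)//; exact: (res_dom dot_norm Amax).
have wE : w - rsc (a + b) (A w) = x - rsc (a * b) (A (A w)).
  have := resK x b0; have := resK (J b x) a0; rewrite -wdef => <-.
  rewrite opB ?opZ//; last exact: op_domZ.
  by move=> <-; lmod.
have := resE dot_norm Amax (addr_ge0 a0 b0) Dw wE; rewrite rlinB// rlinZ// => eqw.
have -> : J (a + b) x - J a (J b x) = rsc (a * b) (J (a + b) (A (A w))).
  by rewrite -wdef -[in LHS]eqw; lmod.
rewrite nrZ_ge0 ?mulr_ge0// ler_wpM2l ?mulr_ge0//.
by apply: le_trans (Jle _ _) _; rewrite AAwE; do 2!apply: le_trans (Jle _ _) _.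
Qed.

Lemma res_swap a b x : 0 <= a -> 0 <= b -> J a (J b x) = J b (J a x).
Proof.
move=> a0 b0; move: (a0); rewrite le_eqVlt => /predU1P[<-|apos].
  by rewrite /res ltxx.
have [Dy yE] := resP dot_norm Amax x apos.
apply: (resE dot_norm Amax) => //; first exact: (res_dom dot_norm Amax).
by rewrite (res_comm dot_norm Amax)// -rlinZ// -rlinB// yE.
Qed.

(** Hille's approximation (1 - (t/n) A)^{-n} of e^{tA}. *)
Definition euler n t x := iter n (J (t / n%:R)) x.

Lemma euler_le n t x : nr (euler n t x) <= nr x. Proof. exact: iter_le. Qed.
Lemma euler_lin n t : rlin (euler n t). Proof. exact: iter_lin. Qed.
Lemma euler_leB n t x y : nr (euler n t x - euler n t y) <= nr (x - y).
Proof. by rewrite -rlinB; [exact: euler_le|exact: euler_lin]. Qed.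

Lemma iter_comp (f g : H -> H) n x : (forall x, f (g x) = g (f x)) ->
  iter n (f \o g) x = iter n f (iter n g x).
Proof.
move=> fg; elim: n => //= n ->.
have fgn m y : iter m f (g y) = g (iter m f y) by elim: m => //= m ->.
by rewrite fgn.
Qed.

(** n splittings of a resolvent, each with error (s/n)(t/n) |A^2 x|. *)
Lemma euler_add n s t x : (0 < n)%N -> 0 <= s -> 0 <= t -> D x -> D (A x) ->
  nr (euler n (s + t) x - euler n s (euler n t x)) <= s * t * nr (A (A x)) / n%:R.
Proof.
move=> n0 s0 t0 Dx DAx; have n0' : 0 < n%:R :> R by rewrite ltr0n.
have sn : 0 <= s / n%:R by rewrite divr_ge0.
have tn : 0 <= t / n%:R by rewrite divr_ge0.
rewrite /euler -iter_comp; last by move=> y; exact: res_swap.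
apply: le_trans (iter_telescope _ _ _ _ _ _ _) _ => //.
- exact: rlin_comp.
- by move=> y; exact: le_trans (Jle _ _) (Jle _ _).
- move=> y /=; rewrite mulrDl; have st : 0 <= s / n%:R + t / n%:R by rewrite addr_ge0.
  by rewrite (res_swap _ st)// (res_swap _ st tn).
have := res_split sn tn Dx DAx; rewrite -mulrDl.
move=> /(ler_wpM2l (ltW n0'))/le_trans; apply.
by rewrite le_eqVlt; apply/orP; left; apply/eqP; field; rewrite gt_eqF.
Qed.

Lemma euler_double n t x : euler (2 * n) t x = euler n (t / 2) (euler n (t / 2) x).
Proof.
rewrite /euler mul2n -addnn iterD natrD.
suff -> : t / (n%:R + n%:R) = t / 2 / n%:R by [].
by rewrite -mulr2n -[n%:R *+ 2]mulr_natr invfM mulrA mulrAC.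
Qed.

(** For y in the domain, A (J h y) = (J h y - y) / h is again in the domain, and |y - J h y| <= h |A
    y|. *)
Lemma D2_dense x e : 0 < e -> exists y, [/\ D y, D (A y) & nr (x - y) < e].
Proof.
move=> e0; have e2 : 0 < e / 2 by rewrite divr_gt0.
have [y Dy xy] := (denseP D).1 (Adense Amax) x _ e2.
have M0 : 0 < 2 * (nr (A y) + 1) by rewrite mulr_gt0//; have := nr_ge0 (A y); lra.
have [h h0 he] : exists2 h, 0 < h & h * (2 * (nr (A y) + 1)) = e.
  by exists (e / (2 * (nr (A y) + 1))); [rewrite divr_gt0|rewrite divfK// gt_eqF].
have [Dz zE] := resP dot_norm Amax y h0.
exists (J h y); split => //.
  have -> : A (J h y) = rsc h^-1 (J h y - y). by rewrite -{3}zE; lmod.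
  by apply: op_domZ; exact: op_domB.
have := res_id dot_norm Amax (ltW h0) Dy => yE.
have : nr (y - J h y) <= h * nr (A y).
  by rewrite nrBC yE nrZ_ge0 ?(ltW h0)// ler_wpM2l ?(ltW h0).
by have := nr_dist x y (J h y); lra.
Qed.

Lemma euler_cvg t x : 0 <= t -> exists y, cvgs (fun k => euler (2 ^ k) t x) y.
Proof.
move=> t0; apply: cauchy_cvgs => e e0.
have e3 : 0 < e / 3 by rewrite divr_gt0.
have [y [Dy DAy xy]] := D2_dense x e3.
pose C := t ^+ 2 * nr (A (A y)).
have C0 : 0 <= C by rewrite mulr_ge0 ?sqr_ge0 ?nr_ge0.
have step k : nr (euler (2 ^ k.+1) t y - euler (2 ^ k) t y) <= C * 2^-1 ^+ k.
  rewrite expnS euler_double nrBC {1}(splitr t).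
  have t2 : 0 <= t / 2 by rewrite divr_ge0.
  apply: le_trans (euler_add _ t2 t2 Dy DAy) _; first by rewrite expn_gt0.
  rewrite natrX -exprVn ler_wpM2r ?exprn_ge0//.
  by rewrite /C; have := nr_ge0 (A (A y)); nra.
have tele k j : nr (euler (2 ^ (k + j)) t y - euler (2 ^ k) t y) <= C * (2 * 2^-1 ^+ k - 2 * 2^-1 ^+ (k + j)).
  elim: j => [|j IHj]; first by rewrite addn0 !subrr nr0 mulr0.
  rewrite addnS; apply: le_trans (nr_dist _ (euler (2 ^ (k + j)) t y) _) _.
  have := step (k + j)%N; rewrite exprS; lra.
have [N NP] : exists N, C * (2 * 2^-1 ^+ N) < e / 6 :> R.
  have h2 : `|2^-1 : R| < 1 by rewrite ger0_norm ?invr_ge0 ?ler0n// invf_lt1 ?ltr1n.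
  have eC : 0 < e / (12 * (C + 1)) by rewrite divr_gt0// mulr_gt0//; lra.
  have /cvgrPdist_lt/(_ _ eC)[N _ NP] := cvg_expr h2.
  exists N; have := NP N (leqnn _); rewrite /= sub0r normrN ger0_norm ?exprn_ge0//.
  have : 0 <= 2^-1 ^+ N :> R by rewrite exprn_ge0.
  by rewrite ltr_pdivlMr ?mulr_gt0//; [nra|lra].
have close m : (N <= m)%N -> nr (euler (2 ^ m) t y - euler (2 ^ N) t y) < e / 6.
  move=> Nm; have := tele N (m - N)%N; rewrite subnKC//.
  have : 0 <= C * (2 * 2^-1 ^+ m) by rewrite mulr_ge0// mulr_ge0 ?exprn_ge0.
  by lra.
exists N => m n /close mN /close nN.
have := euler_leB (2 ^ m) t x y; have := euler_leB (2 ^ n) t x y.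
have := nr_dist (euler (2 ^ m) t x) (euler (2 ^ m) t y) (euler (2 ^ n) t x).
have := nr_dist (euler (2 ^ m) t y) (euler (2 ^ n) t y) (euler (2 ^ n) t x).
have := nr_dist (euler (2 ^ m) t y) (euler (2 ^ N) t y) (euler (2 ^ n) t y).
rewrite (nrBC (euler (2 ^ N) t y)) (nrBC (euler (2 ^ n) t y) (euler (2 ^ n) t x)).
lra.
Qed.

(* Only the numbers of steps [2 ^ k] are used: there the successive Euler
   approximations differ by a summable amount on the domain of A^2. *)
Definition expmd t x := xget 0 (cvgs (fun k => euler (2 ^ k) t x)).

Lemma expmdP t x : 0 <= t -> cvgs (fun k => euler (2 ^ k) t x) (expmd t x).
Proof. by move=> /(euler_cvg x); exact: xgetPex. Qed.

Lemma expmd_le t x : 0 <= t -> nr (expmd t x) <= nr x.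
Proof. by move=> t0; apply: nr_cvgs_le (expmdP x t0) _ => k; exact: euler_le. Qed.

Lemma expmd_clin t : 0 <= t -> linear (expmd t).
Proof.
move=> t0 a x y; apply: (cvgs_unique (expmdP _ t0)).
have := cvgs_lin a (expmdP x t0) (expmdP y t0); congr cvgs; apply/funext => k.
rewrite /euler; elim: {1 3 5}(2 ^ k)%N => //= n <-; exact/esym/(res_clin dot_norm Amax).
Qed.

Lemma expmd0 x : expmd 0 x = x.
Proof.
apply: (cvgs_unique (expmdP _ (lexx _))) => e e0; exists 0%N => k _.
have -> : euler (2 ^ k) 0 x = x; last by rewrite subrr nr0.
by rewrite /euler mul0r; elim: (2 ^ k)%N => //= n ->; rewrite /res ltxx.
Qed.

Lemma pow2_large e : 0 < e -> exists N, forall n, (N <= n)%N -> (2 ^ n)%:R^-1 < e.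
Proof.
move=> e0.
have h2 : `|2^-1 : R| < 1 by rewrite ger0_norm ?invr_ge0 ?ler0n// invf_lt1 ?ltr1n.
have /cvgrPdist_lt/(_ _ e0)[N _ NP] := cvg_expr h2.
exists N => n Nn; have := NP n Nn.
by rewrite /= sub0r normrN ger0_norm ?exprn_ge0// natrX -exprVn.
Qed.

Lemma expmd_hcont t : 0 <= t -> hcont (expmd t).
Proof.
move=> t0; apply: (@bounded_hcont _ _ _ 1); first exact/linear_rlin/expmd_clin.
by move=> x; rewrite mul1r; exact: expmd_le.
Qed.

Lemma hcont_comp (f g : H -> H) : hcont f -> hcont g -> hcont (f \o g).
Proof.
move=> cf cg x e e0; have [d d0 dP] := cf (g x) e e0.
by have [d' d'0 d'P] := cg x d d0; exists d' => // y /d'P/dP.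
Qed.

Lemma expmdD s t x : 0 <= s -> 0 <= t -> expmd (s + t) x = expmd s (expmd t x).
Proof.
move=> s0 t0; have st0 : 0 <= s + t by rewrite addr_ge0.
have D2 : dense [set y | D y /\ D (A y)].
  apply/denseP => y e e0; have [z [Dz DAz yz]] := D2_dense y e0.
  by exists z.
apply: (dense_eq (g := expmd s \o expmd t) D2) x => [||x [Dx DAx]] /=.
- exact: expmd_hcont.
- by apply: hcont_comp; exact: expmd_hcont.
have lim : cvgs (fun k => euler (2 ^ k) s (euler (2 ^ k) t x)) (expmd s (expmd t x)).
  apply: (cvgs_sub0 (expmdP (expmd t x) s0)) => e e0.
  have [N NP] := expmdP x t0 e0; exists N => k /NP; rewrite nrBC => h.
  by apply: le_lt_trans (euler_leB _ _ _ _) _; rewrite nrBC in h; rewrite nrBC.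
apply: (cvgs_unique _ lim); apply: (cvgs_sub0 (expmdP x st0)) => e e0.
pose C := s * t * nr (A (A x)) + 1.
have C0 : 0 < C by rewrite ltr_wpDl// mulr_ge0 ?nr_ge0// mulr_ge0.
have [N NP] : exists N, forall n, (N <= n)%N -> (2 ^ n)%:R^-1 < e / C.
  by apply: pow2_large; rewrite divr_gt0.
exists N => k /NP; rewrite ltr_pdivlMr// => h.
apply: le_lt_trans (euler_add _ s0 t0 Dx DAx) _; first by rewrite expn_gt0.
apply: le_lt_trans h; rewrite mulrC ler_wpM2l ?invr_ge0 ?ler0n// /C.
by rewrite lerDl.
Qed.

Lemma euler_sub n t x j : (0 < n)%N -> (j <= n)%N -> 0 <= t -> D x ->
  nr (iter j (J (t / n%:R)) x - x) <= t * nr (A x).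
Proof.
move=> n0 jn t0 Dx; have n0' : 0 < n%:R :> R by rewrite ltr0n.
have tn : 0 <= t / n%:R by rewrite divr_ge0.
apply: le_trans (iter_sub (Jlin _) (Jle _) j x) _.
rewrite (res_id dot_norm Amax)// nrZ_ge0// mulrA.
apply: ler_pM; rewrite ?nr_ge0 ?mulr_ge0//.
by rewrite mulrCA ler_piMr// ler_pdivrMr// mul1r ler_nat.
Qed.

Lemma expmd_cont x e : 0 < e ->
  exists2 d, 0 < d & forall t, 0 <= t < d -> nr (expmd t x - x) < e.
Proof.
move=> e0; have e4 : 0 < e / 4 by rewrite divr_gt0.
have [y Dy xy] := (denseP D).1 (Adense Amax) x _ e4.
have M0 : 0 < nr (A y) + 1 by have := nr_ge0 (A y); lra.
exists (e / 4 / (nr (A y) + 1)); first by rewrite divr_gt0.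
move=> t /andP[t0]; rewrite ltr_pdivlMr// => te.
have : nr (expmd t y - y) <= t * nr (A y).
  apply: (nr_cvgs_le (cvgsB (expmdP y t0) (cvgs_cst y))) => k.
  by apply: euler_sub => //; rewrite expn_gt0.
have := expmd_le (x - y) t0; rewrite (rlinB (linear_rlin (expmd_clin t0))).
have := nr_dist (expmd t x) (expmd t y) x; have := nr_dist (expmd t y) y x.
by rewrite (nrBC y x); have := nr_ge0 (A y); lra.
Qed.

(** [iter_expand] requires the resolvent iterates of A x to stay near A x. As A x may lie outside
    the domain, it is replaced by a nearby y of the domain, which moves by at most t |A y| whatever
    the number of steps; the estimate thus passes to the limit. *)
Lemma expmd_gen x : D x -> osmall (fun t => expmd t x - x - rsc t (A x)).
Proof.
move=> Dx e e0; have e4 : 0 < e / 4 by rewrite divr_gt0.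
have [y Dy xy] := (denseP D).1 (Adense Amax) (A x) _ e4.
have M0 : 0 < nr (A y) + 1 by have := nr_ge0 (A y); lra.
exists (e / 4 / (nr (A y) + 1)); first by rewrite divr_gt0.
move=> t /andP[t0]; rewrite ltr_pdivlMr// => te.
have lim := cvgsB (cvgsB (expmdP x (ltW t0)) (cvgs_cst x)) (cvgs_cst (rsc t (A x))).
apply: (nr_cvgs_le lim) => k; rewrite /euler; set n := (2 ^ k)%N.
have n0 : (0 < n)%N by rewrite expn_gt0.
have n0' : 0 < n%:R :> R by rewrite ltr0n.
have tn : 0 <= t / n%:R by rewrite divr_ge0 ?ltW.
have tE : t = n%:R * (t / n%:R) by rewrite mulrCA divff ?mulr1// gt_eqF.
rewrite {2}tE {3}tE [e * _]mulrC.
apply: (@iter_expand _ _ (J (t / n%:R)) (Jlin _) _ _ n) => //.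
  by rewrite (res_id dot_norm Amax).
move=> j jn; have jle := euler_sub n0 jn (ltW t0) Dy.
have := nr_dist (iter j (J (t / n%:R)) (A x)) (iter j (J (t / n%:R)) y) (A x).
have := nr_dist (iter j (J (t / n%:R)) y) y (A x).
have := iter_le (Jle (t / n%:R)) j (A x - y).
by rewrite (rlinB (iter_lin (Jlin _) _)) (nrBC y); have := nr_ge0 (A y); lra.
Qed.

Lemma hcont_continuous (f : H -> H) : hcont f -> continuous f.
Proof.
move=> cf x; apply/nr_cvgP => e e0; have [d d0 dP] := cf x e e0.
apply/nbhs_normP; exists d%:C; first by rewrite /= ltcR.
by move=> y; rewrite /= normE ltcR (nrBC x) => /dP.
Qed.

Lemma expmd_C0 : C0_semigroup expmd.
Proof.
split.
- by move=> t t0; split; [exact: expmd_clin|exact/hcont_continuous/expmd_hcont].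
- exact: expmd0.
- by move=> s t s0 t0 x; exact: expmdD.
- move=> x; apply/nr_cvgP => e e0; have [d d0 dP] := expmd_cont x e0.
  by apply/near_rightP; exists d => // t /andP[t0 td]; apply: dP; rewrite (ltW t0).
Qed.

Lemma expmd_generates : generates_semigroup A expmd.
Proof.
split=> [|x y]; first exact: expmd_C0.
split=> [[Dx <-]|/gen_osmallP gy]; first exact/gen_osmallP/expmd_gen.
(* The generator is not larger than A: with w - A w = x - y, the orbit of x - w has initial
   derivative x - w, so e^{tA} would expand this vector by 1 + t + o(t), and contraction forces x =
   w. *)
have [Dw wE] := resP dot_norm Amax (x - y) ltr01.
set w := J 1 (x - y) in Dw wE *.
have Aw : A w = w - (x - y) by rewrite -wE; lmod.
have q0 : x - w = 0.
  apply/subr0_eq/eq_nr_small => e e0; rewrite !subr0.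
  have e2 : 0 < e / 2 by rewrite divr_gt0.
  have [d d0 dP] := gy _ e2; have [d' d'0 d'P] := expmd_gen Dw e2.
  pose t := Num.min (d / 2) (d' / 2).
  have t0 : 0 < t by rewrite lt_min !divr_gt0.
  have td : t < d by rewrite gt_min; apply/orP; left; lra.
  have td' : t < d' by rewrite gt_min; apply/orP; right; lra.
  have := dP t; rewrite t0 td => /(_ isT) h1.
  have := d'P t; rewrite t0 td' => /(_ isT) h2.
  have qE : rsc (1 + t) (x - w) = expmd t (x - w) - (expmd t x - x - rsc t y)
     + (expmd t w - w - rsc t (A w)).
    by rewrite (rlinB (linear_rlin (expmd_clin (ltW t0)))) Aw; lmod.
  have := nrD (expmd t (x - w) - (expmd t x - x - rsc t y)) (expmd t w - w - rsc t (A w)).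
  rewrite -qE nrZ_ge0; last by lra.
  have := nrB (expmd t (x - w)) (expmd t x - x - rsc t y).
  have := expmd_le (x - w) (ltW t0).
  by move=> h3 h4 h5; rewrite -(ler_pM2l t0); lra.
have -> : x = w by apply: subr0_eq.
by split=> //; rewrite Aw -[x](subrK w) q0 add0r; lmod.
Qed.

Lemma expop_max : generates_semigroup A (expop A) /\ csg A (expop A).
Proof.
apply: expop_csg (Adense Amax) expmd_generates _ => t t0 x.
by rewrite !normE lecR; exact: expmd_le.
Qed.

End Generation.

(** * The group generated by B *)

Section ExponentialShift.
Context {R : realType} {H : completeNormedModType R[i]}.
Implicit Types (x y z w : H) (a b t s e d h k : R) (S G : R -> H -> H) (C E B : operator H).

Lemma expR_small (x : R) : `|x| <= 1 / 2 -> `|expR x - 1 - x| <= 2 * x ^+ 2 :> R.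
Proof.
move=> /[dup] /(le_trans (ler_norm _)) x2; rewrite -normrN => /(le_trans (ler_norm _)) x2'.
have h1 := expR_ge1Dx x; have := expR_ge1Dx (- x); rewrite expRN => h2.
rewrite ger0_norm; last by lra.
have e0 := expR_gt0 x.
have : (1 - x) * expR x <= 1 by rewrite -ler_pdivlMr// mul1r.
nra.
Qed.

Lemma expR_sub1 (x : R) : `|x| <= 1 / 2 -> `|expR x - 1| <= 2 * `|x| :> R.
Proof.
move=> x2; have := expR_small x2; have eE : expR x - 1 = (expR x - 1 - x) + x by ring.
rewrite [in X in _ -> X]eE.
have := ler_normD (expR x - 1 - x) x; have : x ^+ 2 = `|x| ^+ 2 by rewrite real_normK ?num_real.
move=> xE tri small; have : `|x| ^+ 2 <= 1 / 2 * `|x| by rewrite expr2 ler_wpM2r.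
by rewrite xE in small; lra.
Qed.

Lemma osmall_exp (f : R -> H) (k : R) x w : osmall (fun t => f t - x - rsc t w) ->
  osmall (fun t => rsc (expR (k * t)) (f t) - x - rsc t (w + rsc k x)).
Proof.
move=> fo e e0; have e4 : 0 < e / 4 by rewrite divr_gt0.
have [d d0 dP] := fo _ e4.
(* Dominates the two second-order terms, 2 |k| |w| and 2 |k|^2 |x|. *)
pose M := 4 * (`|k| + 1) ^+ 2 * (nr w + nr x + 1).
have k0 := normr_ge0 k; have w0 := nr_ge0 w; have x0 := nr_ge0 x.
have M0 : 0 < M.
  by apply: mulr_gt0; [apply: mulr_gt0; [|apply: exprn_gt0]|]; lra.
have k1 : 0 < 2 * (`|k| + 1) by lra.
have M2 : 0 < 2 * M by rewrite pmulr_rgt0.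
exists (Num.min d (Num.min (1 / (2 * (`|k| + 1))) (e / (2 * M)))).
  by rewrite !lt_min d0 !divr_gt0.
move=> t /andP[t0]; rewrite !lt_min !ltr_pdivlMr// => /and3P[td tk te].
have ktE : `|k * t| = `|k| * t by rewrite normrM (gtr0_norm t0).
have kt : `|k * t| <= 1 / 2 by rewrite ktE; nra.
have -> : rsc (expR (k * t)) (f t) - x - rsc t (w + rsc k x) =
  rsc (expR (k * t)) (f t - x - rsc t w) + (rsc ((expR (k * t) - 1) * t) w
   + rsc (expR (k * t) - 1 - k * t) x) by lmod.
apply: le_trans (nrD _ _) _; apply: le_trans (lerD (lexx _) (nrD _ _)) _.
rewrite !nrZ normrM (gtr0_norm t0) (gtr0_norm (expR_gt0 _)).
have h1 := expR_small kt; have h2 := expR_sub1 kt.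
have ktE2 : (k * t) ^+ 2 = `|k| ^+ 2 * t ^+ 2 by rewrite exprMn real_normK ?num_real.
rewrite ktE2 in h1; rewrite ktE in h2.
have e2 : expR (k * t) <= 2.
  have : expR (k * t) - 1 <= `|expR (k * t) - 1| by exact: ler_norm.
  by rewrite ktE in kt; lra.
have := dP t; rewrite t0 td => /(_ isT) h3.
have a1 : expR (k * t) * nr (f t - x - rsc t w) <= 2 * (e / 4 * t).
  by apply: ler_pM => //; rewrite ?nr_ge0 ?expR_ge0.
have a2 : `|expR (k * t) - 1| * t * nr w <= 2 * (`|k| * t) * t * nr w.
  by rewrite ler_wpM2r// ler_wpM2r// ltW.
have a3 : `|expR (k * t) - 1 - k * t| * nr x <= 2 * (`|k| ^+ 2 * t ^+ 2) * nr x.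
  by rewrite ler_wpM2r.
have a4 : 2 * (`|k| * t) * t * nr w + 2 * (`|k| ^+ 2 * t ^+ 2) * nr x <= M * t * t.
  rewrite /M; set K := `|k| in k0 *; set W := nr w in w0 *; set X := nr x in x0 *.
  have -> : 4 * (K + 1) ^+ 2 * (W + X + 1) * t * t =
     2 * (K * t) * t * W + 2 * (K ^+ 2 * t ^+ 2) * X +
     (2 * (K ^+ 2 + K ^+ 2 + 3 * K + 2) * W + 2 * (K ^+ 2 + 4 * K + 2) * X + 4 * (K + 1) ^+ 2) * t ^+ 2.
    by ring.
  rewrite lerDl mulr_ge0 ?sqr_ge0// !addr_ge0// !mulr_ge0// ?addr_ge0// ?mulr_ge0 ?sqr_ge0//; lra.
have a5 : M * t * t <= e / 2 * t by rewrite ler_wpM2r ?(ltW t0)//; lra.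
lra.
Qed.

Lemma expR_cont k e : 0 < e -> exists2 d, 0 < d & forall t, `|t| < d -> `|expR (k * t) - 1| < e :> R.
Proof.
move=> e0; have k1 : 0 < 2 * (`|k| + 1) by have := normr_ge0 k; lra.
exists (Num.min (1 / (2 * (`|k| + 1))) (e / (2 * (`|k| + 1)))).
  by rewrite lt_min !divr_gt0.
move=> t; rewrite lt_min !ltr_pdivlMr// => /andP[t1 te].
have k0 := normr_ge0 k; have t0 := normr_ge0 t.
have kt : `|k * t| <= 1 / 2 by rewrite normrM; nra.
by apply: le_lt_trans (expR_sub1 kt) _; rewrite normrM; nra.
Qed.

(* A one-parameter family with generator [E], where the contraction semigroup S
   is generated by [C = E - k]. *)
Lemma shift_unique C E S (k : R) G : csg C S -> dense (op_dom E) ->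
  (forall x, op_dom C x <-> op_dom E x) -> (forall x, C x = E x - rsc k x) ->
  (forall t, hcont (G t)) -> (forall x, G 0 x = x) ->
  (forall s x e, 0 < e -> exists2 d, 0 < d & forall h, `|h| < d -> nr (G (s + h) x - G s x) < e) ->
  (forall s x, 0 <= s -> op_dom E x -> op_dom E (G s x) /\
     osmall (fun h => G (s + h) x - G s x - rsc h (E (G s x)))) ->
  forall t x, 0 <= t -> G t x = rsc (expR (k * t)) (S t x).
Proof.
move=> cS dE domCE CE contG G0 leftG derG t x t0; move: x.
apply: (dense_eq (f := G t) (g := fun x => rsc (expR (k * t)) (S t x)) dE) => //.
  apply: (@bounded_hcont _ _ _ (expR (k * t))).
    move=> a x y; rewrite (csg_lin cS t0); lmod.
  by move=> x; rewrite nrZ gtr0_norm ?expR_gt0// ler_wpM2l ?expR_ge0// (csg_le cS).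
(* The rescaled orbit solves y' = C y, so [duhamel] applies with M = 0. *)
move=> x Dx; pose y s := rsc (expR (- k * s)) (G s x).
suff : nr (y t - S t (y 0)) <= 0 * t.
  rewrite mul0r => h; have yt : y t = S t (y 0).
    by apply/subr0_eq/nr_eq0/eqP; rewrite eq_le h nr_ge0.
  move: yt; rewrite {2}/y mulr0 expR0 rsc1 G0 => <-.
  by rewrite /y rscA -expRD mulNr subrr expR0 rsc1.
apply: (duhamel cS) => //.
- move=> s /andP[s0 _]; apply/domCE/op_domZ; exact: (derG s x s0 Dx).1.
- move=> s /andP[s0 _] e e0.
  pose M := expR (- k * s) * 2 * (nr (G s x) + 1).
  have M0 : 0 < M.
    apply: mulr_gt0; first by rewrite mulr_gt0 ?expR_gt0.
    by have := nr_ge0 (G s x); lra.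
  have eM : 0 < e / M by rewrite divr_gt0.
  have m1 : 0 < Num.min 1 (e / M) by rewrite lt_min ltr01.
  have [d d0 dP] := leftG s x _ m1.
  have [d' d'0 d'P] := expR_cont (- k) m1.
  exists (Num.min d d'); first by rewrite lt_min d0.
  move=> h /andP[h0]; rewrite lt_min => /andP[hd hd'] hs.
  have := dP (- h); rewrite normrN gtr0_norm// => /(_ hd).
  have := d'P (- h); rewrite normrN gtr0_norm// => /(_ hd').
  rewrite !lt_min => /andP[p1 pe] /andP[q1 qe].
  have -> : y (s - h) - y s = rsc (expR (- k * s)) (rsc (expR (- k * - h)) (G (s - h) x - G s x) + rsc (expR (- k * - h) - 1) (G s x)).
    by rewrite /y mulrDr expRD; lmod.
  rewrite nrZ gtr0_norm ?expR_gt0//.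
  have := nrD (rsc (expR (- k * - h)) (G (s - h) x - G s x)) (rsc (expR (- k * - h) - 1) (G s x)).
  rewrite !nrZ (gtr0_norm (expR_gt0 _)) => tri.
  have e2 : expR (- k * - h) <= 2 by have := ler_norm (expR (- k * - h) - 1); lra.
  have g0 := nr_ge0 (G s x).
  have b1 : expR (- k * - h) * nr (G (s - h) x - G s x) <= 2 * (e / M).
    by apply: ler_pM; rewrite ?expR_ge0 ?nr_ge0// ltW.
  have b2 : `|expR (- k * - h) - 1| * nr (G s x) <= e / M * nr (G s x).
    by rewrite ler_wpM2r// ltW.
  have eME : e = expR (- k * s) * (2 * (e / M) * (nr (G s x) + 1)).
    by rewrite /M; field; rewrite !gt_eqF ?expR_gt0//; lra.
  rewrite [leRHS]eME ler_wpM2l ?expR_ge0//.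
  by have := ltW eM; nra.
- move=> s /andP[s0 _]; have [Ds der] := derG s x s0 Dx.
  exists (C (y s)); split; last by rewrite subrr nr0.
  have -> : C (y s) = rsc (expR (- k * s)) (E (G s x) + rsc (- k) (G s x)).
    by rewrite /y CE opZ//; lmod.
  have bnd (u : H) : nr (rsc (expR (- k * s)) u) <= expR (- k * s) * nr u.
    by rewrite nrZ gtr0_norm ?expR_gt0.
  have := osmall_comp (f := rsc (expR (- k * s))) bnd (osmall_exp (- k) der).
  apply: eq_osmall => h h0 /=.
  by rewrite /y mulrDr expRD; lmod.
Qed.

End ExponentialShift.

Section Group.
Context {R : realType} {H : completeNormedModType R[i]}.
Implicit Types (x y z w : H) (a b t s e d h k : R) (S G : R -> H -> H).
Variables (B : operator H) (c c' : R).
Local Notation Bp := (op_add B (op_scale (- c%:C) op_id)).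
Local Notation Bm := (op_add (op_scale (-1) B) (op_scale (- c'%:C) op_id)).
Local Notation NB := (op_scale (-1) B).
Hypothesis dB : dense (op_dom B).
Variables Sp Sm : R -> H -> H.
Hypotheses (gSp : generates_semigroup Bp Sp) (gSm : generates_semigroup Bm Sm).
Hypotheses (cSp : csg Bp Sp) (cSm : csg Bm Sm).

Lemma Bp_dom x : op_dom Bp x <-> op_dom B x. Proof. by split=> [[]|]. Qed.
Lemma Bm_dom x : op_dom Bm x <-> op_dom NB x. Proof. by split=> [[]|]. Qed.
Lemma BpE x : Bp x = B x - rsc c x. Proof. by rewrite /= scaleNr. Qed.
Lemma NBE x : NB x = - B x. Proof. by rewrite /= scaleN1r. Qed.
Lemma BmE x : Bm x = NB x - rsc c' x. Proof. by rewrite /= [X in _ + X]scaleNr. Qed.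

(** With the shifts undone, P t and Q t play the roles of e^{tB} and e^{-tB} for t >= 0. *)
Let P t x := rsc (expR (c * t)) (Sp t x).
Let Q t x := rsc (expR (c' * t)) (Sm t x).

Lemma shift_lin k S C t : csg C S -> 0 <= t -> rlin (fun x => rsc (expR (k * t)) (S t x)).
Proof. by move=> cS t0 a x y; rewrite (csg_lin cS t0); lmod. Qed.

Lemma shift_D k S C s t x : csg C S -> 0 <= s -> 0 <= t ->
  rsc (expR (k * (s + t))) (S (s + t) x) = rsc (expR (k * s)) (S s (rsc (expR (k * t)) (S t x))).
Proof.
by move=> cS s0 t0; rewrite (csgD cS)// mulrDr expRD (rlinZ (csg_lin cS s0)); lmod.
Qed.

Lemma shift_le k S C t x : csg C S -> 0 <= t -> nr (rsc (expR (k * t)) (S t x)) <= expR (k * t) * nr x.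
Proof.
by move=> cS t0; rewrite nrZ gtr0_norm ?expR_gt0// ler_wpM2l ?expR_ge0// (csg_le cS).
Qed.

Lemma shift_cont k S C x e : csg C S -> 0 < e ->
  exists2 d, 0 < d & forall t, 0 <= t < d -> nr (rsc (expR (k * t)) (S t x) - x) < e.
Proof.
move=> cS e0; pose M := 2 * (nr x + 2).
have x0 := nr_ge0 x; have M0 : 0 < M by rewrite /M; lra.
have m1 : 0 < Num.min 1 (e / M) by rewrite lt_min ltr01 divr_gt0.
have [d d0 dP] := csg_cont cS x m1; have [d' d'0 d'P] := expR_cont k m1.
exists (Num.min d d'); first by rewrite lt_min d0.
move=> t /andP[t0]; rewrite lt_min => /andP[td td'].
have := dP t; rewrite t0 td => /(_ isT); have := d'P t; rewrite ger0_norm// => /(_ td').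
rewrite !lt_min !ltr_pdivlMr// => /andP[p1 pe] /andP[q1 qe].
have -> : rsc (expR (k * t)) (S t x) - x = rsc (expR (k * t)) (S t x - x) + rsc (expR (k * t) - 1) x.
  by lmod.
have := nrD (rsc (expR (k * t)) (S t x - x)) (rsc (expR (k * t) - 1) x).
rewrite !nrZ (gtr0_norm (expR_gt0 _)).
have e2 : expR (k * t) <= 2 by have := ler_norm (expR (k * t) - 1); lra.
have := nr_ge0 (S t x - x); have := normr_ge0 (expR (k * t) - 1); have := expR_gt0 (k * t).
move: e2 p1 pe q1 qe; rewrite /M.
set X := nr x in x0 *; set E := expR _; set U := nr (S t x - x); set V := `|E - 1|.
move=> e2 p1 pe q1 qe E0 V0 U0 tri.
have : E * U <= 2 * U by rewrite ler_wpM2r.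
nra.
Qed.

Lemma P_gen x : op_dom B x -> osmall (fun t => P t x - x - rsc t (B x)).
Proof.
move=> Dx; have := osmall_exp c (csg_gen cSp ((Bp_dom x).2 Dx)).
by apply: eq_osmall => t t0; rewrite BpE subrK.
Qed.

Lemma Q_gen x : op_dom B x -> osmall (fun t => Q t x - x + rsc t (B x)).
Proof.
move=> Dx; have := osmall_exp c' (csg_gen cSm ((Bm_dom x).2 Dx)).
by apply: eq_osmall => t t0; rewrite BmE subrK NBE /Q; lmod.
Qed.

Lemma P_comm t x : 0 <= t -> op_dom B x -> op_dom B (P t x) /\ B (P t x) = P t (B x).
Proof.
move=> t0 Dx; have Dpx := (Bp_dom x).2 Dx.
have Dt := (Bp_dom _).1 (csg_dom cSp t0 Dpx); split; first exact: op_domZ.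
rewrite /P opZ//; congr rsc; have := csg_comm cSp t0 Dpx; rewrite !BpE.
by rewrite (rlinB (csg_lin cSp t0)) (rlinZ (csg_lin cSp t0)) => /addIr.
Qed.

Lemma Q_comm t x : 0 <= t -> op_dom B x -> op_dom B (Q t x) /\ B (Q t x) = Q t (B x).
Proof.
move=> t0 Dx; have Dpx := (Bm_dom x).2 Dx.
have Dt := (Bm_dom _).1 (csg_dom cSm t0 Dpx); split; first exact: op_domZ.
rewrite /Q opZ//; congr rsc; have := csg_comm cSm t0 Dpx; rewrite !BmE !NBE.
rewrite (rlinB (csg_lin cSm t0)) (rlinN (csg_lin cSm t0)) (rlinZ (csg_lin cSm t0)).
by move=> /addIr/oppr_inj.
Qed.
End Group.

Section Inverse.
Context {R : realType} {H : completeNormedModType R[i]}.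
Implicit Types (x y z w : H) (a b t s e d h : R) (P Q : R -> H -> H).

(* Two semigroups with opposite generators are inverse to each other, because
   [s |-> P s (Q s x)] has vanishing right derivative. *)
Lemma opposite_inverse (B : operator H) (k l : R) P Q : 0 <= k -> 0 <= l ->
  dense (op_dom B) ->
  (forall t, 0 <= t -> rlin (P t)) -> (forall t, 0 <= t -> rlin (Q t)) ->
  (forall x, P 0 x = x) -> (forall x, Q 0 x = x) ->
  (forall s t x, 0 <= s -> 0 <= t -> P (s + t) x = P s (P t x)) ->
  (forall s t x, 0 <= s -> 0 <= t -> Q (s + t) x = Q s (Q t x)) ->
  (forall t x, 0 <= t -> nr (P t x) <= expR (k * t) * nr x) ->
  (forall t x, 0 <= t -> nr (Q t x) <= expR (l * t) * nr x) ->
  (forall x e, 0 < e -> exists2 d, 0 < d & forall t, 0 <= t < d -> nr (P t x - x) < e) ->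
  (forall x e, 0 < e -> exists2 d, 0 < d & forall t, 0 <= t < d -> nr (Q t x - x) < e) ->
  (forall x, op_dom B x -> osmall (fun t => P t x - x - rsc t (B x))) ->
  (forall x, op_dom B x -> osmall (fun t => Q t x - x + rsc t (B x))) ->
  (forall t x, 0 <= t -> op_dom B x -> op_dom B (Q t x)) ->
  forall t x, 0 <= t -> P t (Q t x) = x.
Proof.
move=> k0 l0 dB linP linQ P0 Q0 PD QD leP leQ contP contQ genP genQ domQ t x t0; move: x.
have bP s : 0 <= s <= t -> forall x, nr (P s x) <= expR (k * t) * nr x.
  move=> /andP[s0 st] x; apply: le_trans (leP _ _ s0) _.
  by rewrite ler_wpM2r ?nr_ge0// ler_expR ler_wpM2l.
have bQ s : 0 <= s <= t -> forall x, nr (Q s x) <= expR (l * t) * nr x.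
  move=> /andP[s0 st] x; apply: le_trans (leQ _ _ s0) _.
  by rewrite ler_wpM2r ?nr_ge0// ler_expR ler_wpM2l.
have p0 := expR_gt0 (k * t); have q0 := expR_gt0 (l * t).
set p := expR (k * t) in bP p0 *; set q := expR (l * t) in bQ q0 *.
have tt : 0 <= t <= t by rewrite t0 lexx.
apply: (dense_eq (f := P t \o Q t) (g := id) dB) => [||x Dx /=].
- by apply: hcont_comp; [exact: bounded_hcont (linP _ t0) (bP _ tt)|exact: bounded_hcont (linQ _ t0) (bQ _ tt)].
- by move=> x e e0; exists e.
suff h : nr (P t (Q t x) - P 0 (Q 0 x)) <= 0 * t.
  rewrite P0 Q0 mul0r in h; apply/subr0_eq/nr_eq0/eqP; by rewrite eq_le h nr_ge0.
apply: (@dini _ _ (fun s => P s (Q s x))) => //.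
- move=> s /andP[s0 st] e e0; pose u := Q s x.
  have e1 : 0 < e / 2 / p by rewrite !divr_gt0.
  have e2 : 0 < e / 2 / p / q by rewrite !divr_gt0.
  have [d d0 dP] := contP u _ e1; have [d' d'0 d'P] := contQ x _ e2.
  exists (Num.min d d'); first by rewrite lt_min d0.
  move=> h /andP[h0]; rewrite lt_min => /andP[hd hd'] hs.
  have sh : 0 <= s - h <= t by rewrite subr_ge0 hs; lra.
  have /andP[sh0 _] := sh; have h0' := ltW h0.
  have := dP h; rewrite h0' hd => /(_ isT); rewrite !ltr_pdivlMr// => a1.
  have := d'P h; rewrite h0' hd' => /(_ isT); rewrite !ltr_pdivlMr// => a2.
  have -> : P s (Q s x) = P (s - h) (P h u) by rewrite -PD// subrK.
  rewrite -(rlinB (linP _ sh0)); apply: le_trans (bP _ sh _) _.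
  have b1 : nr (Q (s - h) x - u) <= q * nr (Q h x - x).
    have -> : u = Q (s - h) (Q h x) by rewrite /u -QD// subrK.
    by rewrite -(rlinB (linQ _ sh0)) (nrBC (Q h x)); exact: bQ.
  by have := nr_dist (Q (s - h) x) u (P h u); rewrite (nrBC u); nra.
- move=> s /andP[s0 st] e e0; pose u := Q s x.
  have Du : op_dom B u by exact: domQ.
  have e1 : 0 < e / (3 * p * p) by rewrite !divr_gt0// !mulr_gt0.
  have e2 : 0 < e / (3 * p) by rewrite !divr_gt0// !mulr_gt0.
  have [d1 d10 d1P] := genQ u Du _ e1.
  have [d2 d20 d2P] := genP u Du _ e2.
  have [d3 d30 d3P] := contP (B u) _ e2.
  exists (Num.min d1 (Num.min d2 d3)); first by rewrite !lt_min d10 d20.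
  move=> h /andP[h0]; rewrite !lt_min => /and3P[hd1 hd2 hd3] sht; have h0' := ltW h0.
  have := d1P h; rewrite h0 hd1 => /(_ isT) a1.
  have := d2P h; rewrite h0 hd2 => /(_ isT) a2.
  have := d3P h; rewrite h0' hd3 => /(_ isT) a3.
  have st' : 0 <= s <= t by rewrite s0; lra.
  have ht : 0 <= h <= t by rewrite h0'; lra.
  have -> : P (s + h) (Q (s + h) x) = P s (P h (Q h u)) by rewrite PD// [s + h]addrC QD.
  rewrite -(rlinB (linP _ s0)); apply: le_trans (bP _ st' _) _.
  (* The first-order terms + h B u and - h B u cancel up to h (P h (B u) - B u), which is o(h). *)
  have -> : P h (Q h u) - Q s x = P h (Q h u - u + rsc h (B u)) + (P h u - u - rsc h (B u))
     - rsc h (P h (B u) - B u).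
    by rewrite (rlinD (linP _ h0')) (rlinB (linP _ h0')) (rlinZ (linP _ h0')) -/u; lmod.
  have a4 := bP _ ht (Q h u - u + rsc h (B u)).
  have := nrB (P h (Q h u - u + rsc h (B u)) + (P h u - u - rsc h (B u))) (rsc h (P h (B u) - B u)).
  have := nrD (P h (Q h u - u + rsc h (B u))) (P h u - u - rsc h (B u)).
  rewrite (nrZ_ge0 _ h0') add0r => tri1 tri2.
  have a5 : h * nr (P h (B u) - B u) <= h * (e / (3 * p)) by rewrite ler_wpM2l// ltW.
  have a6 : p * nr (Q h u - u + rsc h (B u)) <= e / (3 * p) * h.
    have -> : e / (3 * p) * h = p * (e / (3 * p * p) * h) by field; rewrite gt_eqF.
    by rewrite ler_wpM2l// ltW.
  have -> : e * h = p * (e / (3 * p) * h + e / (3 * p) * h + h * (e / (3 * p))).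
    by field; rewrite gt_eqF.
  by rewrite ler_wpM2l ?(ltW p0)//; lra.
Qed.
End Inverse.

Section GroupFacts.
Context {R : realType} {H : completeNormedModType R[i]}.
Implicit Types (x y z w : H) (a b t s e d h : R) (G : R -> H -> H).

Record grp (B : operator H) (K : R) G : Prop := Grp {
  grp_lin : forall t, rlin (G t);
  grp0 : forall x, G 0 x = x;
  grpD : forall s t x, G (s + t) x = G s (G t x);
  grp_le : forall t x, nr (G t x) <= expR (K * `|t|) * nr x;
  grp_cont : forall x e, 0 < e -> exists2 d, 0 < d & forall t, `|t| < d -> nr (G t x - x) < e;
  grp_gen : forall x, op_dom B x -> forall e, 0 < e -> exists2 d, 0 < d & forall t, t != 0 -> `|t| < d ->
    nr (G t x - x - rsc t (B x)) <= e * `|t| }.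

Lemma punct_genP (f : R -> H) y :
  ((t^-1)%:C *: f t @[t --> 0^'] --> y) <->
  forall e, 0 < e -> exists2 d, 0 < d & forall t, t != 0 -> `|t| < d -> nr (f t - rsc t y) <= e * `|t|.
Proof.
have eqf t : t != 0 -> nr ((t^-1)%:C *: f t - y) = `|t|^-1 * nr (f t - rsc t y).
  move=> t0; rewrite -normfV -nrZ; congr nr.
  by rewrite -[_ *: _]/(rsc _ _); lmod.
have tpos t : t != 0 -> 0 < `|t| by rewrite normr_gt0.
split=> [/nr_cvgP fy e e0|fy].
  have /near_punctP[d d0 dP] := fy e e0; exists d => // t tn0 td.
  by have := dP t tn0 td; rewrite eqf// mulrC ltr_pdivrMr ?tpos// => /ltW.
apply/nr_cvgP => e e0; apply/near_punctP.
have e2 : 0 < e / 2 by rewrite divr_gt0.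
have [d d0 dP] := fy _ e2; exists d => // t tn0 td.
rewrite eqf// mulrC ltr_pdivrMr ?tpos// (le_lt_trans (dP t tn0 td))// ltr_pM2r ?tpos//; lra.
Qed.

Lemma C0_group_cont G x e : C0_group G -> 0 < e ->
  exists2 d, 0 < d & forall t, `|t| < d -> nr (G t x - x) < e.
Proof.
move=> [_ G0 _ contG] e0; have /nr_cvgP/(_ e e0)/nbhs_ballP[d /= d0 dP] := contG x.
by exists d => // t td; apply: dP; rewrite -ball_normE/= sub0r normrN.
Qed.

Section gen.
Variables (B : operator H) (G : R -> H -> H).
Hypothesis gG : generates_group B G.
Let cG : C0_group G := gG.1.

Lemma ggrp_hcont t : hcont (G t).
Proof. by apply: continuous_hcont; have [h _ _ _] := cG; have [] := h t. Qed.
Lemma ggrp_lin t : rlin (G t).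
Proof. by apply: linear_rlin; have [h _ _ _] := cG; have [] := h t. Qed.
Lemma ggrpD s t x : G (s + t) x = G s (G t x).
Proof. by have [_ _ h _] := cG. Qed.
Lemma ggrp0 x : G 0 x = x. Proof. by have [_ h _ _] := cG. Qed.

Lemma ggrp_gen x : op_dom B x -> forall e, 0 < e -> exists2 d, 0 < d & forall t, t != 0 -> `|t| < d ->
    nr (G t x - x - rsc t (B x)) <= e * `|t|.
Proof. by move=> Dx; apply/punct_genP; apply: (gG.2 _ _).1. Qed.

Lemma ggrp_comm t x : op_dom B x -> op_dom B (G t x) /\ B (G t x) = G t (B x).
Proof.
move=> Dx; apply/(gG.2 _ _)/nr_cvgP => e e0.
have [d d0 dP] := ggrp_hcont t (B x) e0.
have := (gG.2 x (B x)).1 (conj Dx erefl) => /nr_cvgP/(_ d d0); apply: filterS => s /dP.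
rewrite -!/(rsc _ _) (rlinZ (ggrp_lin t)) (rlinB (ggrp_lin t)) -!ggrpD [s + t]addrC.
by [].
Qed.

Lemma ggrp_cont_at s x e : 0 < e ->
  exists2 d, 0 < d & forall h, `|h| < d -> nr (G (s + h) x - G s x) < e.
Proof.
move=> e0; have [d d0 dP] := ggrp_hcont s x e0.
have [d' d'0 d'P] := C0_group_cont x cG d0.
by exists d' => // h /d'P/dP; rewrite ggrpD.
Qed.
End gen.

Section expgrp.
Variables (B : operator H) (c c' : R).
Local Notation Bp := (op_add B (op_scale (- c%:C) op_id)).
Local Notation Bm := (op_add (op_scale (-1) B) (op_scale (- c'%:C) op_id)).
Local Notation NB := (op_scale (-1) B).
Hypotheses (c0 : 0 <= c) (c'0 : 0 <= c').
Hypothesis dB : dense (op_dom B).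
Variables Sp Sm : R -> H -> H.
Hypotheses (gSp : generates_semigroup Bp Sp) (gSm : generates_semigroup Bm Sm).
Hypotheses (cSp : csg Bp Sp) (cSm : csg Bm Sm).

Let P t x := rsc (expR (c * t)) (Sp t x).
Let Q t x := rsc (expR (c' * t)) (Sm t x).

(** Ties an arbitrary group generated by B, in particular the chosen [expgrp B], to the two given
    semigroups; growth bounds and invariant sets are read off from them. *)
Lemma group_unique G : generates_group B G -> forall t x, 0 <= t -> G t x = P t x /\ G (- t) x = Q t x.
Proof.
move=> gG t x t0; split.
  apply: (shift_unique (G := G) cSp dB) => //.
  - by move=> y; exact: Bp_dom.
  - by move=> y; exact: BpE.
  - by move=> s; exact: ggrp_hcont gG s.
  - exact: ggrp0 gG.
  - by move=> s y e; exact: ggrp_cont_at gG s y e.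
  - move=> s y s0 Dy; have [Ds _] := ggrp_comm gG s Dy; split => // e e0.
    have [d d0 dP] := ggrp_gen gG Ds e0; exists d => // h /andP[h0 hd].
    have := dP h; rewrite gt_eqF// gtr0_norm// => /(_ isT hd).
    by rewrite -(ggrpD gG) [h + s]addrC.
apply: (shift_unique (E := NB) (G := fun t => G (- t)) cSm) => //.
- by move=> y; exact: Bm_dom.
- by move=> y; exact: BmE.
- by move=> s; exact: ggrp_hcont gG _.
- by move=> y; rewrite oppr0; exact: ggrp0 gG _.
- move=> s y e e0; have [d d0 dP] := ggrp_cont_at gG (- s) y e0.
  by exists d => // h hd; rewrite opprD; apply: dP; rewrite normrN.
- move=> s y s0 Dy; have [Ds _] := ggrp_comm gG (- s) Dy; split => // e e0.
  have [d d0 dP] := ggrp_gen gG Ds e0; exists d => // h /andP[h0 hd].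
  have := dP (- h); rewrite oppr_eq0 gt_eqF// normrN gtr0_norm// => /(_ isT hd).
  rewrite -(ggrpD gG) [- h + _]addrC -opprD NBE.
  by congr (nr _ <= _); lmod.
Qed.

Let linP t : 0 <= t -> rlin (P t). Proof. exact: shift_lin cSp. Qed.
Let linQ t : 0 <= t -> rlin (Q t). Proof. exact: shift_lin cSm. Qed.
Let PD (s t : R) (x : H) : 0 <= s -> 0 <= t -> P (s + t) x = P s (P t x).
Proof. exact: (shift_D _ _ cSp). Qed.
Let QD s t x : 0 <= s -> 0 <= t -> Q (s + t) x = Q s (Q t x).
Proof. exact: (shift_D _ _ cSm). Qed.
Let P0 x : P 0 x = x. Proof. by rewrite /P mulr0 expR0 rsc1 (csg0 cSp). Qed.
Let Q0 x : Q 0 x = x. Proof. by rewrite /Q mulr0 expR0 rsc1 (csg0 cSm). Qed.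
Let genP x (Dx : op_dom B x) := P_gen cSp Dx : osmall (fun t => P t x - x - rsc t (B x)).
Let genQ x (Dx : op_dom B x) := Q_gen cSm Dx : osmall (fun t => Q t x - x + rsc t (B x)).

Let PQ t x : 0 <= t -> P t (Q t x) = x.
Proof.
apply: (opposite_inverse (B := B) c0 c'0) => //.
- by move=> s y; exact: (shift_le _ _ cSp).
- by move=> s y; exact: (shift_le _ _ cSm).
- by move=> y e; exact: (shift_cont _ _ cSp).
- by move=> y e; exact: (shift_cont _ _ cSm).
- by move=> s y s0 Dy; exact: (Q_comm cSm s0 Dy).1.
Qed.

Let QP t x : 0 <= t -> Q t (P t x) = x.
Proof.
have NNE y : op_scale (-1) B y = - B y by exact: NBE.
apply: (opposite_inverse (B := op_scale (-1) B) c'0 c0) => //.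
- by move=> s y; exact: (shift_le _ _ cSm).
- by move=> s y; exact: (shift_le _ _ cSp).
- by move=> y e; exact: (shift_cont _ _ cSm).
- by move=> y e; exact: (shift_cont _ _ cSp).
- by move=> y Dy; apply: eq_osmall (genQ Dy) => t' t0; rewrite NNE; lmod.
- by move=> y Dy; apply: eq_osmall (genP Dy) => t' t0; rewrite NNE; lmod.
- by move=> s y s0 Dy; exact: (P_comm cSp s0 Dy).1.
Qed.

Definition two_sided t x := if 0 <= t then P t x else Q (- t) x.
Let G := two_sided.
Let GP t x : 0 <= t -> G t x = P t x. Proof. by rewrite /G /two_sided => ->. Qed.
Let GQ t x : t <= 0 -> G t x = Q (- t) x.
Proof.
rewrite /G /two_sided => t0; case: ifPn => // t0'.
have -> : t = 0 by apply/eqP; rewrite eq_le t0.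
by rewrite oppr0 P0 Q0.
Qed.

(** For opposite signs the longer time is split so that the shorter one cancels by [PQ] or [QP]. *)
Lemma two_sidedD s t x : G (s + t) x = G s (G t x).
Proof.
have [s0|s0] := leP 0 s; have [t0|t0] := leP 0 t.
- by rewrite !GP ?addr_ge0// PD.
- have t0' : 0 <= - t by lra.
  rewrite (GP _ s0) (GQ _ (ltW t0)); have [st|st] := leP 0 (s + t).
    have sE : P s = P (s + t + - t) by congr P; ring.
    by rewrite GP// sE (PD (t := - t))// PQ.
  have st' : 0 <= - (s + t) by lra.
  have tE : Q (- t) = Q (s + - (s + t)) by congr Q; ring.
  by rewrite (GQ _ (ltW st)) tE QD// PQ.
- have s0' : 0 <= - s by lra.
  rewrite (GP _ t0) (GQ _ (ltW s0)); have [st|st] := leP 0 (s + t).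
    have tE : P t = P (- s + (s + t)) by congr P; ring.
    by rewrite GP// tE (PD (s := - s))// QP.
  have st' : 0 <= - (s + t) by lra.
  have sE : Q (- s) = Q (- (s + t) + t) by congr Q; ring.
  by rewrite (GQ _ (ltW st)) sE QD// QP.
- have s0' : 0 <= - s by lra. have t0' : 0 <= - t by lra.
  rewrite (GQ _ (ltW s0)) (GQ _ (ltW t0)) GQ; last by lra.
  by rewrite opprD QD.
Qed.

Lemma two_sided_generates : generates_group B G.
Proof.
have bndP t x : 0 <= t -> nr (P t x) <= expR (c * t) * nr x by exact: (shift_le _ _ cSp).
have bndQ t x : 0 <= t -> nr (Q t x) <= expR (c' * t) * nr x by exact: (shift_le _ _ cSm).
split; last first.
  move=> x y; split=> [[Dx <-]|/punct_genP gy].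
    apply/punct_genP => e e0.
    have [d d0 dP] := genP Dx e0; have [d' d'0 d'P] := genQ Dx e0.
    exists (Num.min d d'); first by rewrite lt_min d0.
    move=> t tn0; rewrite lt_min => /andP[td td'].
    have [t0|t0] := ltP 0 t.
      by rewrite (GP _ (ltW t0)) gtr0_norm//; apply: dP; rewrite t0; rewrite gtr0_norm in td.
    have {}t0 : 0 < - t by rewrite oppr_gt0 lt_neqAle tn0.
    have tE : `|t| = - t by rewrite -normrN gtr0_norm.
    rewrite GQ; last by lra.
    rewrite tE in td' *; have := d'P (- t); rewrite t0 td' => /(_ isT).
    by congr (nr _ <= _); lmod.
  (* A two-sided derivative at 0 is a right derivative of the semigroup of B - c, after removing the
     shift; this puts x in the domain of B. *)
  have Pgen : osmall (fun t => P t x - x - rsc t y).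
    move=> e e0; have [d d0 dP] := gy e e0; exists d => // t /andP[t0 td].
    have := dP t; rewrite gt_eqF// gtr0_norm// => /(_ isT td).
    by rewrite (GP _ (ltW t0)).
  have /gen_osmallP : osmall (fun t => Sp t x - x - rsc t (y - rsc c x)).
    have := osmall_exp (- c) Pgen; apply: eq_osmall => t t0.
    by rewrite /P rscA -expRD mulNr addNr expR0; lmod.
  by move=> /(gSp.2 x _)[[Dx _]]; rewrite BpE => /addIr.
have linS t : 0 <= t -> linear (Sp t) /\ continuous (Sp t) by have [[h _ _ _] _] := gSp; exact: h.
have linS' t : 0 <= t -> linear (Sm t) /\ continuous (Sm t) by have [[h _ _ _] _] := gSm; exact: h.
have rscC a (b : R[i]) x : rsc a (b *: x) = b *: rsc a x by rewrite /rsc !scalerA mulrC.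
split.
- move=> t; split.
    move=> a x y; have [t0|t0] := leP 0 t.
      by rewrite !GP// /P (linS _ t0).1 rscDr rscC.
    have t0' : 0 <= - t by lra.
    by rewrite !(GQ _ (ltW t0)) /Q (linS' _ t0').1 rscDr rscC.
  apply: hcont_continuous; have [t0|t0] := leP 0 t.
    have -> : G t = P t by apply/funext => x; rewrite GP.
    by apply: bounded_hcont (linP t0) _ => x; exact: bndP.
  have t0' : 0 <= - t by lra.
  have -> : G t = Q (- t) by apply/funext => x; rewrite GQ ?ltW.
  by apply: bounded_hcont (linQ t0') _ => x; exact: bndQ.
- by move=> x; rewrite GP.
- exact: two_sidedD.
- move=> x; apply/nr_cvgP => e e0.
  have [d d0 dP] := shift_cont c x cSp e0; have [d' d'0 d'P] := shift_cont c' x cSm e0.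
  apply/nbhs_normP; exists (Num.min d d'); first by rewrite /= lt_min d0.
  move=> t; rewrite /= sub0r normrN lt_min => /andP[td td'].
  have [t0|t0] := leP 0 t.
    by rewrite GP//; apply: dP; rewrite t0; rewrite ger0_norm in td.
  rewrite (GQ _ (ltW t0)); apply: d'P.
  by rewrite -normrN ger0_norm in td'; lra.
Qed.

Lemma expgrp_generates : generates_group B (expgrp B).
Proof. by apply: (@getPex _ (generates_group B)); exists G; exact: two_sided_generates. Qed.

Lemma expgrp_grp : grp B (c + c') (expgrp B).
Proof.
have gG := expgrp_generates; split.
- exact: ggrp_lin gG.
- exact: ggrp0 gG.
- exact: ggrpD gG.
- move=> t x; have [t0|t0] := leP 0 t.
    rewrite (group_unique gG x t0).1 ger0_norm//; apply: le_trans (shift_le _ _ cSp t0) _.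
    by rewrite ler_wpM2r ?nr_ge0// ler_expR ler_wpM2r// lerDl.
  have t0' : 0 <= - t by lra.
  have {1}-> : t = - - t by rewrite opprK.
  rewrite (group_unique gG x t0').2 -normrN ger0_norm//; apply: le_trans (shift_le _ _ cSm t0') _.
  by rewrite ler_wpM2r ?nr_ge0// ler_expR ler_wpM2r// lerDr.
- by move=> x e e0; exact: C0_group_cont gG.1 e0.
- by move=> x Dx; exact: ggrp_gen gG _ Dx.
Qed.

Lemma expgrp_inv (D : set H) : (forall a x, D x -> D (rsc a x)) ->
  (forall t x, 0 <= t -> D x -> D (Sp t x)) -> (forall t x, 0 <= t -> D x -> D (Sm t x)) ->
  forall t x, D x -> D (expgrp B t x).
Proof.
move=> DZ Dp Dm t x Dx; have gG := expgrp_generates; have [t0|t0] := leP 0 t.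
  by rewrite (group_unique gG x t0).1; apply: DZ; exact: Dp.
have t0' : 0 <= - t by lra.
have -> : t = - - t by rewrite opprK.
by rewrite (group_unique gG x t0').2; apply: DZ; exact: Dm.
Qed.
End expgrp.
End GroupFacts.

(** * Stability in the graph norm *)

Section Estimates.
Context {R : realType} {H : completeNormedModType R[i]}.
Implicit Types (x y z w : H) (a b t s e d h r u v : R).
Variables (A B : operator H) (S G : R -> H -> H) (E : R -> R -> H -> H) (K L d0 : R).
Local Notation D := (op_dom A).
Hypothesis cS : csg A S.
Hypothesis cE : forall u, csg (op_ctrl A B u) (E u).
Hypothesis domE : forall u, op_dom (op_ctrl A B u) = D.
Hypothesis gG : grp B K G.
Hypothesis GA : forall t x, D x -> D (G t x).
Hypotheses (K0 : 0 <= K) (L0 : 0 <= L) (d0_gt0 : 0 < d0).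
Definition graph_norm x := nr x + nr (A x).
Local Notation N := graph_norm.
Hypothesis lip : forall t x, `|t| < d0 -> D x -> nr (G (- t) (A (G t x)) - A x) <= L * `|t| * N x.
(** u = 0 bounds B by A; a general u bounds A by A + uB, which commutes with E u. *)
Hypothesis Bbd : forall u, exists2 M, 0 <= M & forall x, D x -> nr (B x) <= M * (nr x + nr (A x + rsc u (B x))).

Let Glin t := grp_lin gG t.
Let GD s t x : G (s + t) x = G s (G t x) := grpD gG s t x.
Let Gle t x : nr (G t x) <= expR (K * `|t|) * nr x := grp_le gG t x.

Lemma domB x : D x -> op_dom B x.
Proof. by rewrite -(domE 0) => -[]. Qed.

Lemma N_ge0 x : 0 <= N x. Proof. by rewrite addr_ge0 ?nr_ge0. Qed.

Lemma GK t x : G t (G (- t) x) = x.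
Proof. by rewrite -GD subrr (grp0 gG). Qed.
Lemma GNK t x : G (- t) (G t x) = x.
Proof. by rewrite -GD addNr (grp0 gG). Qed.

Local Notation k := (K + L).
Let k0 : 0 <= k. Proof. exact: addr_ge0. Qed.

(** A e^{aB} x is e^{aB} applied to e^{-aB} A e^{aB} x, which is A x up to L |a| N x. The inequality
    1 + L |a| <= e^{L |a|} keeps the front factor equal to 1. *)
Lemma N_G_small a x : `|a| < d0 -> D x -> N (G a x) <= expR (k * `|a|) * N x.
Proof.
move=> ad Dx; have := lip ad Dx => h.
have h1 : nr (A (G a x)) <= expR (K * `|a|) * (nr (A x) + L * `|a| * N x).
  rewrite -{1}(GK a (A (G a x))); apply: le_trans (Gle _ _) _; rewrite ler_wpM2l ?expR_ge0//.
  by have := nr_sub (G (- a) (A (G a x))) (A x); lra.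
have h2 := Gle a x; rewrite mulrDl expRD -mulrA.
have h3 : (1 + L * `|a|) * N x <= expR (L * `|a|) * N x.
  by rewrite ler_wpM2r ?N_ge0// expR_ge1Dx.
have e0 := expR_ge0 (K * `|a|).
have := ler_wpM2l e0 h3; rewrite /N in h h1 h3 *; lra.
Qed.

(** Carries estimates from short times to all times along the multiples m b of a short b. All have
    the same sign, so |b + m b| = |b| + |m b| and exponential rates add without loss. *)
Lemma subdivide (P : R -> H -> Prop) a x :
  P 0 x -> (forall b m y, `|b| < d0 -> P (m%:R * b) y -> P (m.+1%:R * b) y) -> P a x.
Proof.
move=> P0 PS; pose n := (Num.trunc (`|a| / d0)).+1.
have n0 : 0 < n%:R :> R by rewrite ltr0n.
have -> : a = n%:R * (a / n%:R) by rewrite mulrCA divff ?mulr1// gt_eqF.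
have ad : `|a / n%:R| < d0.
  rewrite normrM normfV (gtr0_norm n0) ltr_pdivrMr// mulrC -ltr_pdivrMr//.
  exact: truncnS_gt.
by elim: n {n0} (a / n%:R) ad => [|m IHm] b bd; [rewrite mul0r|apply: PS => //; exact: IHm].
Qed.

Lemma N_G a x : D x -> N (G a x) <= expR (k * `|a|) * N x.
Proof.
move=> Dx; apply: (subdivide (P := fun a x => D x -> N (G a x) <= expR (k * `|a|) * N x)) => //.
  by move=> _; rewrite (grp0 gG) normr0 mulr0 expR0 mul1r.
move=> b m y bd IH Dy; rewrite -natr1 mulrDl mul1r addrC GD.
apply: le_trans (N_G_small bd (GA _ Dy)) _.
have -> : `|b + m%:R * b| = `|b| + `|m%:R * b|.
  rewrite !normrM ger0_norm// -[X in `|X + _|]mul1r -mulrDl normrM.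
  by rewrite ger0_norm ?addr_ge0// mulrDl mul1r.
by rewrite (mulrDr k `|b|) expRD -mulrA ler_wpM2l ?expR_ge0// IH.
Qed.

(* [e^{-aB} A e^{aB}] is translated along the group, so its modulus of continuity
   at 0 controls it at every a. *)
Lemma conj_bound a x : D x ->
  nr (G (- a) (A (G a x)) - A x) <= L * expR ((K + k) * `|a|) * `|a| * N x.
Proof.
move=> Dx; apply: (subdivide (P := fun a x => D x ->
  nr (G (- a) (A (G a x)) - A x) <= L * expR ((K + k) * `|a|) * `|a| * N x)) => //.
  move=> _; rewrite oppr0 !(grp0 gG) subrr nr0 !mulr_ge0// ?expR_ge0//; exact: N_ge0.
move=> b m y bd IH Dy; set q := m%:R * b in IH *.
have qE : m.+1%:R * b = b + q by rewrite -natr1 mulrDl mul1r addrC.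
have bqE : `|b + q| = `|b| + `|q|.
  rewrite /q !normrM ger0_norm// -[X in `|X + _|]mul1r -mulrDl normrM.
  by rewrite ger0_norm ?addr_ge0// mulrDl mul1r.
rewrite qE bqE.
have -> : G (- (b + q)) (A (G (b + q) y)) - A y =
  G (- q) (G (- b) (A (G b (G q y))) - A (G q y)) + (G (- q) (A (G q y)) - A y).
  by rewrite (rlinB (Glin _)) -!GD opprD [- b - q]addrC; lmod.
apply: le_trans (nrD _ _) _.
have h1 : nr (G (- q) (G (- b) (A (G b (G q y))) - A (G q y))) <=
   L * expR ((K + k) * `|q|) * `|b| * N y.
  apply: le_trans (Gle _ _) _; rewrite normrN mulrDl expRD.
  have := le_trans (lip bd (GA q Dy)) (ler_wpM2l _ (N_G q Dy)).
  rewrite mulr_ge0// => /(_ isT) h.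
  apply: le_trans (ler_wpM2l (expR_ge0 _) h) _.
  by rewrite le_eqVlt; apply/orP; left; apply/eqP; ring.
have h2 := IH Dy.
have h3 : expR ((K + k) * `|q|) <= expR ((K + k) * (`|b| + `|q|)).
  by rewrite ler_expR ler_wpM2l ?addr_ge0// lerDr.
have h4 : L * expR ((K + k) * `|q|) <= L * expR ((K + k) * (`|b| + `|q|)) by rewrite ler_wpM2l.
have h5 : L * expR ((K + k) * `|q|) * ((`|b| + `|q|) * N y) <= L * expR ((K + k) * (`|b| + `|q|)) * ((`|b| + `|q|) * N y).
  by rewrite ler_wpM2r// mulr_ge0 ?N_ge0// addr_ge0.
by lra.
Qed.

Lemma G_bound r : exists2 C, 1 <= C & forall a, `|a| <= r ->
  (forall x, nr (G a x) <= C * nr x) /\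
  (forall x, D x -> N (G a x) <= C * N x) /\
  (forall x, D x -> nr (G (- a) (A (G a x)) - A x) <= C * `|a| * N x) /\
  (forall x, D x -> nr (G a (A x) - A (G a x)) <= C * `|a| * N x).
Proof.
(* [c] bounds every exponential occurring for |a| <= r; the second [c] pays for the outer G a in the
   last of the four bounds. *)
pose c := expR ((K + k) * `|r|); exists ((1 + L) * c * c).
  have c1 : 1 <= c.
    by rewrite -expR0 ler_expR mulr_ge0// addr_ge0.
  by rewrite -[X in X <= _]mulr1 ler_pM// -[X in X <= _]mulr1 ler_pM// lerDl.
move=> a ar; have {}ar : `|a| <= `|r| := le_trans ar (ler_norm _).
have c1 : 1 <= c by rewrite -expR0 ler_expR mulr_ge0// addr_ge0.
have e1 : expR (K * `|a|) <= c.
  by rewrite ler_expR ler_pM// lerDl.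
have e2 : expR (k * `|a|) <= c by rewrite ler_expR ler_pM// lerDr.
have e3 : expR ((K + k) * `|a|) <= c by rewrite ler_expR ler_wpM2l// addr_ge0.
have c0 : 0 <= c by lra.
have cc : c <= c * c by rewrite ler_peMr.
have Lc0 : 0 <= L * c by rewrite mulr_ge0.
have Lcc : L * c <= L * c * c by rewrite ler_peMr.
have CE : (1 + L) * c * c = c * c + L * c * c by ring.
have cC : c <= (1 + L) * c * c by rewrite CE; lra.
have LC : L * c <= (1 + L) * c * c by rewrite CE; lra.
have LC2 : L * c * c <= (1 + L) * c * c by rewrite CE; lra.
have conj x : D x -> nr (G (- a) (A (G a x)) - A x) <= L * c * `|a| * N x.
  move=> Dx; apply: le_trans (conj_bound a Dx) _.
  by rewrite ler_wpM2r ?N_ge0// ler_wpM2r// ler_wpM2l.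
split=> [x|]; first by apply: le_trans (Gle _ _) _; rewrite ler_wpM2r ?nr_ge0//; lra.
split=> [x Dx|]; first by apply: le_trans (N_G _ Dx) _; rewrite ler_wpM2r ?N_ge0//; lra.
split=> x Dx; first by apply: le_trans (conj x Dx) _; rewrite ler_wpM2r ?N_ge0// ler_wpM2r.
have -> : G a (A x) - A (G a x) = - G a (G (- a) (A (G a x)) - A x).
  by rewrite (rlinB (Glin _)) GK opprB.
rewrite nrN; apply: le_trans (Gle _ _) _.
have h := conj x Dx.
apply: (@le_trans _ _ (c * (L * c * `|a| * N x))); first by rewrite ler_pM ?expR_ge0 ?nr_ge0.
have -> : c * (L * c * `|a| * N x) = (L * c * c) * `|a| * N x by ring.
by rewrite ler_wpM2r ?N_ge0// ler_wpM2r.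
Qed.

Lemma N_S h x : 0 <= h -> D x -> N (S h x) <= N x.
Proof. by move=> h0 Dx; rewrite /N (csg_comm cS)// lerD// (csg_le cS). Qed.

Lemma S_left x s e : 0 < e -> exists2 d, 0 < d &
  forall h, 0 < h < d -> h <= s -> nr (S (s - h) x - S s x) <= e.
Proof. exact: (csg_left x s cS). Qed.

(** [duhamel] compares S with its conjugate s |-> G (- v) (S s (G v y)), whose generator e^{-vB} A
    e^{vB} is within O(|v|) of A in graph norm. The cube collects one C from this difference, one
    from the graph norm of G v y and one from the outer G v. *)
Lemma commutator r : exists2 C, 1 <= C & forall v h y, `|v| <= r -> 0 <= h -> D y ->
  nr (S h (G v y) - G v (S h y)) <= C * h * `|v| * N y.
Proof.
have [C C1 CP] := G_bound r; exists (C ^+ 3); first by rewrite exprn_ege1.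
move=> v h y vr h0 Dy; have vr' : `|- v| <= r by rewrite normrN.
have [Cv1 [Cv2 _]] := CP v vr; have [Cw1 [_ [_ Cw4]]] := CP (- v) vr'.
have C0 : 0 <= C by lra.
pose f s := G (- v) (S s (G v y)).
have M0 : 0 <= C * `|v| * (C * N y) by rewrite !mulr_ge0// N_ge0.
have : nr (f h - S h (f 0)) <= C * `|v| * (C * N y) * h.
  apply: (duhamel cS) => //.
  - by move=> s /andP[s0 _]; apply/GA/(csg_dom cS)/GA.
  - move=> s _ e e0; have eC : 0 < e / C by rewrite divr_gt0//; lra.
    have [d d_gt0 dP] := S_left (G v y) s eC; exists d => // q qd qs.
    rewrite /f -(rlinB (Glin _)); apply: le_trans (Cw1 _) _.
    by rewrite mulrC -ler_pdivlMr ?dP//; lra.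
  - move=> s /andP[s0 sh]; pose z := S s (G v y).
    have Dz : D z by apply/(csg_dom cS)/GA.
    exists (G (- v) (A z)); split.
      have := osmall_comp (f := G (- v)) Cw1 (orbit_der cS s0 (GA v Dy)).
      by apply: eq_osmall => q q0 /=; rewrite !(rlinB (Glin _)) (rlinZ (Glin _)).
    apply: le_trans (Cw4 z Dz) _; rewrite normrN ler_wpM2l ?mulr_ge0//.
    by apply: le_trans (N_S s0 (GA v Dy)) _; exact: Cv2.
rewrite /f (csg0 cS) GNK => h1.
have -> : S h (G v y) - G v (S h y) = G v (G (- v) (S h (G v y)) - S h y).
  by rewrite (rlinB (Glin _)) GK.
apply: le_trans (Cv1 _) _; have := ler_wpM2l C0 h1.
by rewrite !exprS expr0 mulr1; congr (_ <= _); ring.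
Qed.

Lemma ctrlE u x : op_ctrl A B u x = A x + rsc u (B x). Proof. by []. Qed.

Lemma E_dom u s x : 0 <= s -> D x -> D (E u s x).
Proof. by move=> s0; rewrite -(domE u); exact: csg_dom (cE u) _ _ s0. Qed.

(** The graph norms of A and A + uB are equivalent, and E u contracts the second one. The constant
    does not approach 1 for short times, so this bound cannot be composed over many steps. *)
Lemma E_rough u : exists2 C, 0 <= C & forall s x, 0 <= s -> D x -> N (E u s x) <= C * N x.
Proof.
have [M M0 MP] := Bbd u; have [M' M'0 M'P] := Bbd 0.
exists (1 + (1 + `|u| * M) * (1 + (1 + `|u| * M'))).
  by rewrite !addr_ge0// mulr_ge0// !addr_ge0// mulr_ge0.
move=> s x s0 Dx; pose z := E u s x; have Dz : D z by exact: E_dom.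
have z1 : nr z <= nr x by exact: csg_le (cE u) _ _ s0.
have z2 : nr (A z + rsc u (B z)) <= nr (A x + rsc u (B x)).
  by rewrite -!ctrlE (csg_comm (cE u))// ?domE//; exact: csg_le (cE u) _ _ s0.
have u0 := normr_ge0 u.
have z3 : nr (A x + rsc u (B x)) <= (1 + `|u| * M') * N x.
  have := nrD (A x) (rsc u (B x)); rewrite nrZ; have := M'P x Dx.
  have -> : A x + rsc 0 (B x) = A x by lmod.
  move=> /(ler_wpM2l u0); rewrite -/(N x) mulrDl mul1r mulrA.
  by rewrite {2}/N; have := nr_ge0 x; lra.
have z4 : nr (A z) <= nr (A z + rsc u (B z)) + `|u| * (M * (nr z + nr (A z + rsc u (B z)))).
  have {1}-> : A z = (A z + rsc u (B z)) - rsc u (B z) by lmod.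
  apply: le_trans (nrB _ _) _; rewrite lerD2l nrZ ler_wpM2l//; exact: MP.
rewrite -/z; have xN : nr x <= N x by rewrite lerDl nr_ge0.
have N0 := N_ge0 x.
have uM0 : 0 <= `|u| * M by rewrite mulr_ge0.
rewrite mulrA in z4.
have w1 : nr z <= N x by lra.
have w2 : nr (A z + rsc u (B z)) <= (1 + `|u| * M') * N x by lra.
have w3 : `|u| * M * (nr z + nr (A z + rsc u (B z))) <= `|u| * M * (N x + (1 + `|u| * M') * N x).
  by rewrite ler_wpM2l// lerD.
by rewrite {1}/N; lra.
Qed.

Lemma E_left u x s e : 0 < e -> exists2 d, 0 < d &
  forall h, 0 < h < d -> h <= s -> nr (E u (s - h) x - E u s x) <= e.
Proof. exact: (csg_left x s (cE u)). Qed.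

(** Interaction picture: E u contributes A + uB to the derivative and e^{-suB} contributes - uB. *)
Lemma G_conj_der u s x r C : 0 <= s -> D x -> (forall a, `|a| <= r -> forall x, nr (G a x) <= C * nr x) ->
  0 < r ->
  osmall (fun q => G (- ((s + q) * u)) (E u (s + q) x) - G (- (s * u)) (E u s x)
     - rsc q (G (- (s * u)) (A (E u s x)))).
Proof.
move=> s0 Dx GC r0; pose z := E u s x; have Dz : D z by exact: E_dom.
have o1 : osmall (fun q => E u (s + q) x - z - rsc q (A z + rsc u (B z))).
  by apply: orbit_der (cE u) s0 _; rewrite domE.
suff o : osmall (fun q => G (- (q * u)) (E u (s + q) x) - z - rsc q (A z)).
  apply: eq_osmall (osmall_comp (Gle (- (s * u))) o) => q q0 /=.
  by rewrite !(rlinB (Glin _)) (rlinZ (Glin _)) -GD -opprD -mulrDl.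
pose w := A z + rsc u (B z).
move=> e e0.
have C0 : 0 < `|C| + 1 by have := normr_ge0 C; lra.
have u0 : 0 < `|u| + 1 by have := normr_ge0 u; lra.
have e1 : 0 < e / (3 * (`|C| + 1)) by rewrite divr_gt0// mulr_gt0.
have e2 : 0 < e / (3 * (`|u| + 1)) by rewrite divr_gt0// mulr_gt0.
have e3 : 0 < e / 3 by rewrite divr_gt0.
have [d1 d1_gt0 d1P] := o1 _ e1.
have [d2 d2_gt0 d2P] := grp_gen gG (domB Dz) e2.
have [d3 d3_gt0 d3P] := grp_cont gG w e3.
exists (Num.min d1 (Num.min (d2 / (`|u| + 1)) (Num.min (d3 / (`|u| + 1)) (r / (`|u| + 1))))).
  by rewrite !lt_min d1_gt0 !divr_gt0.
move=> q /andP[q0]; rewrite !lt_min !ltr_pdivlMr// => /and4P[qd1 qd2 qd3 qr].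
have quE : `|- (q * u)| = q * `|u| by rewrite normrN normrM gtr0_norm.
have qu1 : `|- (q * u)| <= q * (`|u| + 1) by rewrite quE; nra.
have -> : G (- (q * u)) (E u (s + q) x) - z - rsc q (A z) =
  G (- (q * u)) (E u (s + q) x - z - rsc q w) + (G (- (q * u)) z - z - rsc (- (q * u)) (B z))
  + rsc q (G (- (q * u)) w - w).
  by rewrite !(rlinB (Glin _)) (rlinZ (Glin _)) /w; lmod.
apply: le_trans (nrD _ _) _; apply: le_trans (lerD (nrD _ _) (lexx _)) _.
rewrite nrZ_ge0 ?(ltW q0)//.
have h1 : nr (G (- (q * u)) (E u (s + q) x - z - rsc q w)) <= e / 3 * q.
  have qr' : `|- (q * u)| <= r by lra.
  apply: le_trans (GC _ qr' _) _.
  have := d1P q; rewrite q0 qd1 => /(_ isT) h.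
  have : C * nr (E u (s + q) x - z - rsc q w) <= (`|C| + 1) * nr (E u (s + q) x - z - rsc q w).
    by rewrite ler_wpM2r ?nr_ge0//; have := ler_norm C; lra.
  move=> /le_trans; apply; apply: le_trans (ler_wpM2l (ltW C0) h) _.
  by rewrite le_eqVlt; apply/orP; left; apply/eqP; field; rewrite gt_eqF.
have h2 : nr (G (- (q * u)) z - z - rsc (- (q * u)) (B z)) <= e / 3 * q.
  have [->|un0] := eqVneq u 0.
    rewrite mulr0 oppr0 (grp0 gG); have -> : z - z - rsc 0 (B z) = 0 by lmod.
    by rewrite nr0 mulr_ge0// ltW.
  have := d2P (- (q * u)); rewrite oppr_eq0 mulf_neq0// ?gt_eqF// => /(_ isT).
  have -> : `|- (q * u)| < d2 by lra.
  move=> /(_ isT) /le_trans; apply; rewrite quE.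
  have -> : e / 3 * q = e / (3 * (`|u| + 1)) * (q * (`|u| + 1)) by field; rewrite gt_eqF.
  by rewrite ler_wpM2l ?(ltW e2)// ler_wpM2l ?(ltW q0)// lerDl.
have h3 : q * nr (G (- (q * u)) w - w) <= q * (e / 3).
  by rewrite ler_wpM2l ?(ltW q0)// ltW// d3P//; lra.
lra.
Qed.

(** The curve f s = e^{-suB} E u s x has derivative within C h |u| M of A (f s), so [duhamel]
    applies. The graph-norm bound M along the step is a parameter because the estimate is used
    twice: with the rough bound for Trotter's formula, then with the sharp one. *)
Lemma local_step r : exists2 C, 1 <= C & forall u h x M, 0 <= h -> h * `|u| <= r -> D x ->
  0 <= M -> (forall s, 0 <= s <= h -> N (E u s x) <= M) ->
  nr (E u h x - G (h * u) (S h x)) <= C * h * (h * `|u|) * M.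
Proof.
have [C C1 CP] := G_bound (`|r| + 1); exists (C ^+ 2); first by rewrite exprn_ege1.
move=> u h x M h0 hur Dx M0 MP; have C0 : 0 <= C by lra.
have sur s : 0 <= s <= h -> `|- (s * u)| <= `|r| + 1 /\ `|- (s * u)| <= h * `|u|.
  move=> /andP[s0 sh]; rewrite normrN normrM ger0_norm//.
  have : s * `|u| <= h * `|u| by rewrite ler_wpM2r.
  by have := ler_norm r; lra.
pose f s := G (- (s * u)) (E u s x).
have M'0 : 0 <= C * (h * `|u|) * M by rewrite !mulr_ge0.
have : nr (f h - S h (f 0)) <= C * (h * `|u|) * M * h.
  apply: (duhamel cS) => //.
  - by move=> s /andP[s0 _]; apply/GA/E_dom.
  - move=> s /andP[s0 sh] e e0.
    have e1 : 0 < e / (2 * C) by rewrite divr_gt0//; lra.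
    have [d1 d1_gt0 d1P] := E_left u x s e1.
    have [d2 d2_gt0 d2P] := grp_cont gG (E u s x) e1.
    have u0 : 0 < `|u| + 1 by have := normr_ge0 u; lra.
    exists (Num.min d1 (d2 / (`|u| + 1))); first by rewrite lt_min d1_gt0 divr_gt0.
    move=> q /andP[q0]; rewrite lt_min ltr_pdivlMr// => /andP[qd1 qd2] qs.
    have sqh : 0 <= s - q <= h by rewrite subr_ge0 qs; lra.
    have sh' : 0 <= s <= h by rewrite (ltW s0).
    have -> : f (s - q) - f s = G (- ((s - q) * u)) (E u (s - q) x - E u s x)
       - G (- (s * u)) (E u s x - G (q * u) (E u s x)).
      rewrite /f !(rlinB (Glin _)) -GD.
      have -> : - (s * u) + q * u = - ((s - q) * u) by ring.
      by lmod.
    have := d1P q; rewrite q0 qd1 => /(_ isT qs) a1.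
    have a2 : nr (E u s x - G (q * u) (E u s x)) < e / (2 * C).
      by rewrite nrBC; apply: d2P; rewrite normrM gtr0_norm//; move: qd2; rewrite mulrDr mulr1; lra.
    apply: le_trans (nrB _ _) _.
    have [_ Ch] := sur _ sqh.
    have b1 := (CP _ (sur _ sqh).1).1 (E u (s - q) x - E u s x).
    have b2 := (CP _ (sur _ sh').1).1 (E u s x - G (q * u) (E u s x)).
    have c1 := ler_wpM2l C0 a1; have c2 := ler_wpM2l C0 (ltW a2).
    have eE : e = C * (e / (2 * C)) + C * (e / (2 * C)) by field; rewrite gt_eqF//; lra.
    by lra.
  - move=> s /andP[s0 sh]; have sh' : 0 <= s <= h by rewrite s0 ltW.
    exists (G (- (s * u)) (A (E u s x))); split.
      have r1 : 0 < `|r| + 1 by rewrite ltr_wpDl.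
      by apply: (G_conj_der u s0 Dx _ r1) => a ar; exact: (CP a ar).1.
    have [su1 su2] := sur _ sh'.
    have [_ [_ [_ h4]]] := CP _ su1.
    apply: le_trans (h4 _ (E_dom u s0 Dx)) _.
    apply: ler_pM; rewrite ?N_ge0 ?mulr_ge0//; last exact: MP.
    by rewrite ler_wpM2l.
rewrite /f mul0r oppr0 (grp0 gG) (csg0 (cE u)) => h1.
have -> : E u h x - G (h * u) (S h x) = G (h * u) (G (- (h * u)) (E u h x) - S h x).
  by rewrite (rlinB (Glin _)) GK.
have hh : 0 <= h <= h by rewrite h0 lexx.
have hur' : `|h * u| <= `|r| + 1 by rewrite -normrN; exact: (sur _ hh).1.
apply: le_trans ((CP _ hur').1 _) _; have := ler_wpM2l C0 h1.
by rewrite !exprS expr0 mulr1; congr (_ <= _); ring.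
Qed.

(** The constant curve x has derivative 0, at distance |A x| from A x. *)
Lemma S_sub h x : 0 <= h -> D x -> nr (S h x - x) <= h * nr (A x).
Proof.
move=> h0 Dx; rewrite nrBC mulrC; apply: (duhamel (y := fun=> x) cS) => //.
- exact: nr_ge0.
- by move=> s _ e e0; exists 1 => // q _ _; rewrite subrr nr0 ltW.
- move=> s _; exists 0; split; last by rewrite sub0r nrN.
  move=> e e0; exists 1 => // t /andP[t0 _].
  by rewrite subrr sub0r rscr0 oppr0 nr0 mulr_ge0// ltW.
Qed.

Lemma N_trotter u h m x : 0 <= h -> D x ->
  D (iter m (G (h * u) \o S h) x) /\
  N (iter m (G (h * u) \o S h) x) <= expR (k * (m%:R * h * `|u|)) * N x.
Proof.
move=> h0 Dx; elim: m => [|m [Dm Nm]]; first by rewrite /= !mul0r mulr0 expR0 mul1r.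
split; first by rewrite iterS /=; apply/GA/(csg_dom cS).
rewrite iterS /=; apply: le_trans (N_G _ (csg_dom cS h0 Dm)) _.
have -> : m.+1%:R * h * `|u| = h * `|u| + m%:R * h * `|u| by rewrite -natr1; ring.
rewrite (mulrDr k (h * `|u|)) expRD -mulrA normrM ger0_norm//.
by rewrite ler_wpM2l ?expR_ge0//; apply: le_trans (N_S h0 Dm) _.
Qed.

(** There are n local errors of order h^2, carried along by factors e^{K |u| h} with product at most
    e^{K |u| t}. The rough bound M enters twice: at the starting point E u (m h) x of a step, and
    along that step. *)
Lemma trotter_err u t x : 0 <= t -> D x -> exists2 C, 0 <= C & forall n, (0 < n)%N ->
  nr (E u t x - iter n (G (t / n%:R * u) \o S (t / n%:R)) x) <= C / n%:R.
Proof.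
move=> t0 Dx; have [M M0 MP] := E_rough u; have [C C1 CP] := local_step (t * `|u|).
have C0 : 0 <= C by lra.
pose c := expR (K * (t * `|u|)).
exists (t * (c * C * t * `|u| * (M * (M * N x)))).
  by rewrite !mulr_ge0 ?expR_ge0 ?N_ge0.
move=> n n0; have n0' : 0 < n%:R :> R by rewrite ltr0n.
set h := t / n%:R; have h0 : 0 <= h by rewrite divr_ge0// ltW.
have hn : n%:R * h = t by rewrite mulrCA divff ?mulr1// gt_eqF.
have ht : h <= t by rewrite -{1}hn ler_peMl// ler1n.
have u0 := normr_ge0 u.
have loc y : D y -> nr (E u h y - G (h * u) (S h y)) <= C * h * (h * `|u|) * (M * N y).
  move=> Dy; apply: CP => //; first by rewrite ler_wpM2r.
    by rewrite mulr_ge0// N_ge0.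
  by move=> s /andP[s0 _]; exact: MP.
set F := G (h * u) \o S h.
have Flin : rlin F := rlin_comp (Glin _) (csg_lin cS h0).
have main m : (m <= n)%N -> nr (E u (m%:R * h) x - iter m F x) <=
   m%:R * (expR (K * (m%:R * (h * `|u|))) * (C * h * (h * `|u|) * (M * (M * N x)))).
  elim: m => [_|m IHm mn].
    by rewrite /= mul0r (csg0 (cE u)) subrr nr0 mul0r.
  have mh0 : 0 <= m%:R * h by rewrite mulr_ge0.
  pose z := E u (m%:R * h) x; have Dz : D z by exact: E_dom.
  have -> : E u (m.+1%:R * h) x - iter m.+1 F x =
     (E u h z - F z) + F (z - iter m F x).
    have -> : m.+1%:R * h = h + m%:R * h by rewrite -natr1; ring.
    by rewrite (csgD (cE u))// -/z iterS (rlinB Flin); lmod.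
  apply: le_trans (nrD _ _) _.
  set W := C * h * (h * `|u|) * (M * (M * N x)).
  have W0 : 0 <= W by rewrite !mulr_ge0 ?N_ge0.
  have a1 : nr (E u h z - F z) <= W.
    apply: le_trans (loc z Dz) _; rewrite ler_wpM2l ?mulr_ge0// ler_wpM2l//.
    exact: MP.
  have a2 : nr (F (z - iter m F x)) <= expR (K * (h * `|u|)) *
      (m%:R * (expR (K * (m%:R * (h * `|u|))) * W)).
    apply: le_trans (Gle _ _) _; rewrite normrM ger0_norm// ler_wpM2l ?expR_ge0//.
    by apply: le_trans (csg_le cS _ h0) _; exact/IHm/ltnW.
  have e1 : 1 <= expR (K * (m.+1%:R * (h * `|u|))).
    by rewrite -expR0 ler_expR !mulr_ge0.
  have eE : expR (K * (m.+1%:R * (h * `|u|))) = expR (K * (h * `|u|)) * expR (K * (m%:R * (h * `|u|))).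
    by rewrite -expRD -mulrDr -natr1 [in LHS]mulrDl mul1r addrC.
  set Y := expR (K * (m.+1%:R * (h * `|u|))) in e1 eE *.
  have -> : m.+1%:R * (Y * W) = Y * W + m%:R * (Y * W) by rewrite -natr1; ring.
  rewrite lerD//; first by apply: le_trans a1 _; rewrite ler_peMl.
  by apply: le_trans a2 _; rewrite eE le_eqVlt; apply/orP; left; apply/eqP; ring.
have := main n (leqnn _); rewrite hn.
have -> : n%:R * (h * `|u|) = t * `|u| by rewrite mulrA hn.
rewrite -/c => /le_trans; apply.
have -> : h = t / n%:R by [].
by rewrite le_eqVlt; apply/orP; left; apply/eqP; field; rewrite gt_eqF.
Qed.

(* The Trotter products satisfy the bound; it passes to their limit because
   [nr (A z)] is the limit of the difference quotients [nr (S h z - z) / h],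
   which are continuous in z. *)
Lemma N_E u t x : 0 <= t -> D x -> N (E u t x) <= expR (k * (t * `|u|)) * N x.
Proof.
move=> t0 Dx; have [C C0 CP] := trotter_err u t0 Dx.
set W := expR _ * N x; set z := E u t x; have Dz : D z by exact: E_dom.
have approx e : 0 < e -> exists f, [/\ D f, N f <= W & nr (z - f) <= e].
  move=> e0; pose n := (Num.trunc (C / e)).+1.
  have n0 : 0 < n%:R :> R by rewrite ltr0n.
  have h0 : 0 <= t / n%:R by rewrite divr_ge0// ltW.
  have [Df Nf] := N_trotter u n h0 Dx.
  exists (iter n (G (t / n%:R * u) \o S (t / n%:R)) x); split => //.
    by rewrite [n%:R * _]mulrCA divff ?gt_eqF// mulr1 in Nf.
  apply: le_trans (CP n _) _ => //.
  by rewrite ler_pdivrMr// mulrC -ler_pdivrMr// ltW// truncnS_gt.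
have quot h : 0 < h -> nr (S h z - z) <= h * (W - nr z).
  move=> h0; apply/ler_addgt0Pr => e e0.
  have eh : 0 < e / (2 + h) by rewrite divr_gt0//; lra.
  have [f [Df Nf zf]] := approx _ eh.
  have := csg_leB z f cS (ltW h0); have := S_sub (ltW h0) Df.
  have := nr_dist (S h z) (S h f) z; have := nr_dist (S h f) f z.
  rewrite (nrBC f z); have := nr_sub z f.
  have eE : e = 2 * (e / (2 + h)) + h * (e / (2 + h)) by field; rewrite gt_eqF//; lra.
  move=> a1 a2 a3 a4 a5.
  have a6 : nr (A f) <= W - nr z + e / (2 + h) by rewrite /N in Nf; lra.
  have a7 := ler_wpM2l (ltW h0) a6.
  by lra.
rewrite /N addrC -lerBrDr; apply/ler_addgt0Pr => e e0.
have Dz' := csg_gen cS Dz e0; have [d d_gt0 dP] := Dz'.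
have h0 : 0 < d / 2 by rewrite divr_gt0.
have := dP (d / 2); rewrite h0 /= ltr_pdivrMr// ltr_pMr// ltr1n => /(_ isT) a1.
have a2 := quot _ h0.
have := nr_sub (rsc (d / 2) (A z)) (S (d / 2) z - z); rewrite nrZ_ge0 ?(ltW h0)// (nrBC (rsc _ _)).
by move=> a3; rewrite -(ler_pM2l h0); lra.
Qed.

Lemma E_diff : exists2 C, 0 <= C & forall u v h x, 0 <= h -> D x ->
  nr (E u h x - E v h x) <= C * (h * `|u - v|) * (expR (k * (h * `|u|)) * N x).
Proof.
have [C C0 CP] := Bbd 0; exists C => // u v h x h0 Dx.
have -> : C * (h * `|u - v|) * (expR (k * (h * `|u|)) * N x) =
  `|u - v| * (C * (expR (k * (h * `|u|)) * N x)) * h by ring.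
rewrite -{2}(csg0 (cE u) x); apply: (duhamel (y := fun s => E u s x) (cE v)) => //.
- by rewrite !mulr_ge0 ?expR_ge0 ?N_ge0.
- by move=> s /andP[s0 _]; rewrite domE; exact: E_dom.
- by move=> s _ e e0; exact: E_left.
- move=> s /andP[s0 sh]; exists (op_ctrl A B u (E u s x)); split.
    by apply: orbit_der (cE u) s0 _; rewrite domE.
  rewrite !ctrlE; set z := E u s x.
  have -> : A z + rsc u (B z) - (A z + rsc v (B z)) = rsc (u - v) (B z) by lmod.
  rewrite nrZ ler_wpM2l//; have Dz : D z by exact: E_dom.
  have := CP z Dz; have -> : A z + rsc 0 (B z) = A z by lmod.
  move=> /le_trans; apply; rewrite ler_wpM2l//; apply: le_trans (N_E u s0 Dx) _.
  rewrite ler_wpM2r ?N_ge0// ler_expR ler_wpM2l// ler_wpM2r//; exact: ltW.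
Qed.

End Estimates.

(** * Step controls *)

Section TimeLists.
Context {R : realType} {H : completeNormedModType R[i]}.
Implicit Types (x y z : H) (a b s t : R) (u w f : R -> R) (l : seq R).
Variable E : R -> R -> H -> H.

(* Only the values of u at the elements of [a :: l] matter: this is the propagator
   of u when u is adapted, that is, constant between consecutive elements. *)
Fixpoint prop u a l x := if l is b :: l' then prop u b l' (E (u a) (b - a) x) else x.

(** The integral of a function adapted to the grid; for s |-> |u s| it is the L^1 norm of u. *)
Fixpoint cost f a l := if l is b :: l' then (b - a) * f a + cost f b l' else 0.

Fixpoint adapted u a l :=
  if l is b :: l' then (forall s, a <= s < b -> u s = u a) /\ adapted u b l' else True.

Lemma path_last a l : path <%R a l -> a <= last a l.
Proof.
by elim: l a => //= b l IHl a /andP[/ltW ab /IHl]; exact: le_trans.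
Qed.

Lemma adapted2 (g : R -> R -> R) u w a l : adapted u a l -> adapted w a l ->
  adapted (fun s => g (u s) (w s)) a l.
Proof.
elim: l a => //= b l IHl a [ua ul] [wa wl]; split=> [s sab|]; last exact: IHl.
by rewrite ua ?wa.
Qed.

Lemma cost_ge0 f a l : (forall s, 0 <= f s) -> path <%R a l -> 0 <= cost f a l.
Proof.
move=> f0; elim: l a => //= b l IHl a /andP[ab pl].
by rewrite addr_ge0 ?IHl// mulr_ge0// subr_ge0 ltW.
Qed.

Lemma cost_norm f a l : path <%R a l -> `|cost f a l| <= cost (fun s => `|f s|) a l.
Proof.
elim: l a => [a _|b l IHl a /= /andP[ab pl]]; first by rewrite normr0.
apply: le_trans (ler_normD _ _) _; rewrite lerD ?IHl// normrM ger0_norm// subr_ge0; exact: ltW.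
Qed.

Lemma prop_rcons u a l b x :
  prop u a (rcons l b) x = E (u (last a l)) (b - last a l) (prop u a l x).
Proof. by elim: l a x => //= c l IHl a x; rewrite IHl. Qed.

Hypothesis ED : forall v s t x, 0 <= s -> 0 <= t -> E v (s + t) x = E v s (E v t x).

Lemma prop_refine u a l l' : path <%R a l -> path <%R a l' -> {subset l <= l'} ->
  last a l = last a l' -> adapted u a l ->
  adapted u a l' /\ forall x, prop u a l x = prop u a l' x.
Proof.
elim: l' a l => [|b' l' IHl'] a l.
  by case: l => [//|b l] _ _ /(_ b); rewrite inE eqxx => /(_ isT).
case: l => [_ /= /andP[ab' pl'] _ al _|b l /=].
  by have := path_last pl'; rewrite -al leNgt ab'.
move=> /andP[ab pl] /andP[ab' pl'] sub lastE [ua ul].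
have bin : b \in b' :: l' by apply: sub; rewrite inE eqxx.
have b'l' : forall c, c \in l' -> b' < c.
  by move=> c; apply: (allP (order_path_min lt_trans pl')).
have bl : forall c, c \in l -> b < c.
  by move=> c; apply: (allP (order_path_min lt_trans pl)).
have [bb'|bb'] := eqVneq b b'.
  rewrite -bb' in b'l' ab' pl' lastE *.
  have [|al' pE] := IHl' b l pl pl' _ lastE ul.
    move=> c cl; have : c \in b' :: l' by apply: sub; rewrite inE cl orbT.
    by rewrite -bb' inE => /predU1P[cb|//]; have := bl c cl; rewrite cb ltxx.
  by split=> // x; rewrite pE.
(* The new point b' cuts the first step [a, b): the coarse grid restarts at b', where u keeps its
   value at a, and [ED] merges the two pieces. *)
have {}bb' : b' < b by apply: b'l'; move: bin; rewrite inE (negbTE bb').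
have ub' : u b' = u a by apply: ua; rewrite (ltW ab').
have [|||al' pE] := IHl' b' (b :: l) _ pl' _ lastE _.
- by rewrite /= bb'.
- move=> c cl; have : c \in b' :: l' by exact: sub.
  rewrite inE => /predU1P[cb'|//]; move: cl; rewrite inE cb' => /predU1P[b'b|/bl].
    by rewrite b'b ltxx in bb'.
  by move=> /(lt_trans bb'); rewrite ltxx.
- by split=> // s /andP[b's sb]; rewrite ub' ua// sb andbT (le_trans (ltW ab') b's).
split; first by split=> // s /andP[as_ sb1]; rewrite ua// as_ (lt_trans sb1).
move=> x; rewrite -pE /= ub' -ED ?subr_ge0 ?ltW//.
by congr (prop _ _ _ (E _ _ _)); ring.
Qed.

Lemma prop_split u a l p : path <%R a l -> a <= p <= last a l -> adapted u a l ->
  exists l1 l2, [/\ path <%R a l1 /\ last a l1 = p, path <%R p l2 /\ last p l2 = last a l,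
    adapted u a l1 /\ adapted u p l2,
    forall x, prop u a l x = prop u p l2 (prop u a l1 x) &
    cost (fun s => `|u s|) a l = cost (fun s => `|u s|) a l1 + cost (fun s => `|u s|) p l2].
Proof.
elim: l a => [a _ /= ap _|b l IHl a /= /andP[ab pl] /andP[ap pl'] [ua ul]].
  have -> : p = a by apply/eqP; rewrite eq_le andbC.
  by exists [::], [::]; split => //=; rewrite addr0.
have [bp|pb] := leP b p.
  have [|l1 [l2 [[p1 last1] p2 [a1 a2] pE cE]]] := IHl b pl _ ul; first by rewrite bp.
  exists (b :: l1), l2; split => //=; first by rewrite ab.
  by rewrite cE addrA.
have [->|pa] := eqVneq p a.
  exists [::], (b :: l); split => //=; last by rewrite add0r.
  by rewrite ab pl.
have {}pa : a < p by rewrite lt_neqAle eq_sym pa.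
have up : u p = u a by apply: ua; rewrite ap.
exists [:: p], (b :: l); split => //=.
- by rewrite pa.
- by rewrite pb pl.
- split; split=> //.
    by move=> s /andP[as_ sp]; rewrite ua// as_ (lt_trans sp).
  by move=> s /andP[ps sb]; rewrite up ua// sb (le_trans ap).
- move=> x; rewrite up -ED ?subr_ge0 ?ltW//.
  by congr (prop _ _ _ (E _ _ _)); ring.
- by rewrite up addr0; ring.
Qed.

End TimeLists.

(** * Propagators of step controls: stability and approximation by words *)

Section ControlEstimates.
Context {R : realType} {H : completeNormedModType R[i]}.
Implicit Types (x y z : H) (a b s t r h v : R) (u w : R -> R) (l : seq R) (X : set H).

(** Interface to the control problem: B is seen only through G and E, and the graph-norm bounds
    compose with the single rate k. *)
Record estimates (A : operator H) (S G : R -> H -> H) (E : R -> R -> H -> H) (k : R) : Prop := Estimates {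
  est_k : 0 <= k;
  est_dense : dense (op_dom A);
  est_S : csg A S;
  est_E : forall v, exists C, csg C (E v);
  est_Edom : forall v t x, 0 <= t -> op_dom A x -> op_dom A (E v t x);
  est_Gdom : forall v x, op_dom A x -> op_dom A (G v x);
  est_Glin : forall v, rlin (G v);
  est_GD : forall v v' x, G (v + v') x = G v (G v' x);
  est_G0 : forall x, G 0 x = x;
  est_Gcont : forall x e, 0 < e -> exists2 d, 0 < d & forall v, `|v| < d -> nr (G v x - x) < e;
  est_Gle : forall r, exists2 C, 1 <= C & forall v x, `|v| <= r -> nr (G v x) <= C * nr x;
  est_NG : forall v x, op_dom A x -> graph_norm A (G v x) <= expR (k * `|v|) * graph_norm A x;
  est_NS : forall t x, 0 <= t -> op_dom A x -> graph_norm A (S t x) <= graph_norm A x;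
  est_NE : forall v t x, 0 <= t -> op_dom A x -> graph_norm A (E v t x) <= expR (k * (t * `|v|)) * graph_norm A x;
  est_diff : exists2 C, 0 <= C & forall v v' t x, 0 <= t -> op_dom A x ->
    nr (E v t x - E v' t x) <= C * (t * `|v - v'|) * (expR (k * (t * `|v|)) * graph_norm A x);
  est_local : forall r, exists2 C, 1 <= C & forall v h x, 0 <= h -> h * `|v| <= r -> op_dom A x ->
    nr (E v h x - G (h * v) (S h x)) <= C * h * (h * `|v|) * (expR (k * (h * `|v|)) * graph_norm A x);
  est_comm : forall r, exists2 C, 1 <= C & forall v h y, `|v| <= r -> 0 <= h -> op_dom A y ->
    nr (S h (G v y) - G v (S h y)) <= C * h * `|v| * graph_norm A y }.

Lemma control_estimates (A B : operator H) S G E (K L d0 : R) : dense (op_dom A) -> csg A S ->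
  (forall v, csg (op_ctrl A B v) (E v)) -> (forall v, op_dom (op_ctrl A B v) = op_dom A) ->
  grp B K G -> (forall t x, op_dom A x -> op_dom A (G t x)) ->
  0 <= K -> 0 <= L -> 0 < d0 ->
  (forall t x, `|t| < d0 -> op_dom A x -> nr (G (- t) (A (G t x)) - A x) <= L * `|t| * graph_norm A x) ->
  (forall v, exists2 M, 0 <= M & forall x, op_dom A x -> nr (B x) <= M * (nr x + nr (A x + rsc v (B x)))) ->
  estimates A S G E (K + L).
Proof.
move=> dA cS cE domE gG GA K0 L0 d00 lip Bbd; split.
- exact: addr_ge0.
- by [].
- by [].
- by move=> v; exists (op_ctrl A B v).
- by move=> v t x; exact: (E_dom cE domE).
- exact: GA.
- exact: grp_lin gG.
- exact: grpD gG.
- exact: grp0 gG.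
- exact: grp_cont gG.
- move=> r; have [C C1 CP] := G_bound gG GA K0 L0 d00 lip r.
  by exists C => // v x vr; exact: (CP v vr).1.
- by move=> v x; exact: (N_G gG GA d00 lip).
- by move=> t x; exact: (N_S cS).
- by move=> v t x; exact: (N_E cS cE domE gG GA K0 L0 d00 lip Bbd).
- exact: (E_diff cS cE domE gG GA K0 L0 d00 lip Bbd).
- move=> r; have [C C1 CP] := local_step cS cE domE gG GA K0 L0 d00 lip r.
  exists C => // v h x h0 hv Dx; apply: CP => //.
    by rewrite mulr_ge0 ?expR_ge0// addr_ge0 ?nr_ge0.
  move=> s /andP[s0 sh]; apply: le_trans (N_E cS cE domE gG GA K0 L0 d00 lip Bbd v s0 Dx) _.
  rewrite ler_wpM2r ?addr_ge0 ?nr_ge0// ler_expR ler_wpM2l ?addr_ge0// ler_wpM2r//.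
- exact: (commutator cS gG GA K0 L0 d00 lip).
Qed.

Lemma expR_split_le (k p q m n : R) : m <= expR (k * p) * n ->
  expR (k * q) * m <= expR (k * (p + q)) * n.
Proof.
move=> mn; rewrite mulrDr expRD -mulrA mulrCA.
by apply: ler_wpM2l => //; exact: expR_ge0.
Qed.

Section prop.
Variables (A : operator H) (S G : R -> H -> H) (E : R -> R -> H -> H) (k : R).
Hypothesis est : estimates A S G E k.
Local Notation D := (op_dom A).
Local Notation N := (graph_norm A).
Local Notation prop := (prop E).
Local Notation tvar u := (cost (fun s => `|u s|)).
Let k0 : 0 <= k := est_k est.
Let cS : csg A S := est_S est.
Let Glin v : rlin (G v) := est_Glin est v.

Lemma Elin v t : 0 <= t -> rlin (E v t).
Proof. by have [C cC] := est_E est v; exact: csg_lin cC t. Qed.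
Lemma Ele v t x : 0 <= t -> nr (E v t x) <= nr x.
Proof. by have [C cC] := est_E est v; exact: csg_le cC t x. Qed.
Lemma ED v s t x : 0 <= s -> 0 <= t -> E v (s + t) x = E v s (E v t x).
Proof. by have [C cC] := est_E est v; exact: csgD cC s t x. Qed.

Lemma tvar_ge0 u a l : path <%R a l -> 0 <= tvar u a l.
Proof. exact: cost_ge0. Qed.

Lemma prop_leB u a l x y : path <%R a l -> nr (prop u a l x - prop u a l y) <= nr (x - y).
Proof.
elim: l a x y => //= b l IHl a x y /andP[ab pl].
have ab' : 0 <= b - a by rewrite subr_ge0 ltW.
apply: le_trans (IHl _ _ _ pl) _; rewrite -(rlinB (Elin _ ab')); exact: Ele.
Qed.

(** The first segment is exchanged at the cost [est_diff], and the later steps of w contract that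
    error. Only graph norms along u enter, so the variation of w is unrestricted. *)
Lemma prop_diff : exists2 C, 0 <= C & forall u w a l x, path <%R a l -> D x ->
  nr (prop u a l x - prop w a l x) <=
    C * cost (fun s => `|u s - w s|) a l * (expR (k * tvar u a l) * N x).
Proof.
have [C C0 CP] := est_diff est; exists C => // u w a l.
elim: l a => [|b l IHl] a x /=; first by rewrite subrr nr0 mulr0 mul0r.
move=> /andP[ab pl] Dx; have ab' : 0 <= b - a by rewrite subr_ge0 ltW.
have DE := est_Edom est (u a) ab' Dx.
apply: le_trans (nr_dist _ (prop w b l (E (u a) (b - a) x)) _) _.
have h1 := IHl b _ pl DE; have h2 := prop_leB w (E (u a) (b - a) x) (E (w a) (b - a) x) pl.
have h3 := CP (u a) (w a) _ _ ab' Dx; have h4 := est_NE est (u a) ab' Dx.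
set h := b - a in h1 h2 h3 h4 ab' *; set W := expR (k * _) * N x.
have W1 : expR (k * (h * `|u a|)) * N x <= W.
  rewrite ler_wpM2r ?N_ge0// ler_expR ler_wpM2l// lerDl; exact: tvar_ge0.
have W2 : expR (k * tvar u b l) * N (E (u a) h x) <= W.
  by rewrite /W; exact: expR_split_le.
have c0 : 0 <= cost (fun s => `|u s - w s|) b l by apply: cost_ge0.
have h5 := ler_wpM2l (mulr_ge0 C0 c0) W2.
have h6 : C * (h * `|u a - w a|) * (expR (k * (h * `|u a|)) * N x) <= C * (h * `|u a - w a|) * W.
  by rewrite ler_wpM2l// !mulr_ge0.
by rewrite mulrDr mulrDl; lra.
Qed.

Lemma prop_uc x r e : 0 < e -> exists2 d, 0 < d & forall u w a l, path <%R a l ->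
  tvar u a l <= r -> cost (fun s => `|u s - w s|) a l < d ->
  nr (prop u a l x - prop w a l x) < e.
Proof.
move=> e0; have [C C0 CP] := prop_diff; have e4 : 0 < e / 4 by rewrite divr_gt0.
have [y Dy xy] := (denseP D).1 (est_dense est) x _ e4.
pose M := C * (expR (k * `|r|) * N y) + 1.
have M0 : 0 < M by rewrite ltr_wpDl// !mulr_ge0 ?expR_ge0 ?N_ge0.
exists (e / 4 / M); first by rewrite divr_gt0.
move=> u w a l pl ur; rewrite ltr_pdivlMr// => cd.
have := CP u w a l y pl Dy; set c := cost _ a l in cd *.
have c0 : 0 <= c by apply: cost_ge0.
have : C * c * (expR (k * tvar u a l) * N y) <= c * M.
  rewrite [C * c]mulrC -mulrA ler_wpM2l// ler_wpDr// ler_wpM2l// ler_wpM2r ?N_ge0//.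
  by rewrite ler_expR ler_wpM2l// (le_trans ur) ?ler_norm.
have := prop_leB u x y pl; have := prop_leB w x y pl.
have := nr_dist (prop u a l x) (prop u a l y) (prop w a l x).
have := nr_dist (prop u a l y) (prop w a l y) (prop w a l x).
rewrite (nrBC (prop w a l y) (prop w a l x)); lra.
Qed.

(* On a short segment the control acts through its integral only, up to an error
   of order (duration) x (variation). *)
Lemma segment r : exists2 Q, 0 <= Q & forall u a l x, path <%R a l -> tvar u a l <= r -> D x ->
  nr (prop u a l x - G (cost u a l) (S (last a l - a) x)) <=
    Q * (last a l - a) * tvar u a l * (expR (k * tvar u a l) * N x).
Proof.
have [Cl Cl1 ClP] := est_local est r; have [Cc Cc1 CcP] := est_comm est r.
have [Cg Cg1 CgP] := est_Gle est r.
have Cl0 : 0 <= Cl by lra. have Cc0 : 0 <= Cc by lra. have Cg0 : 0 <= Cg by lra.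
pose Q := Cg * Cl + Cg * Cc.
have Q0 : 0 <= Q by rewrite addr_ge0// mulr_ge0.
exists Q => // u a l; elim: l a => [|b l IHl] a x.
  by move=> _ _ _ /=; rewrite (est_G0 est) subrr (csg0 cS) subrr nr0 mulr0 !mul0r.
move=> /= /andP[ab pl] tr Dx; have ab' : 0 <= b - a by rewrite subr_ge0 ltW.
have -> : last b l - a = (last b l - b) + (b - a) by ring.
have tau0 : 0 <= last b l - b by rewrite subr_ge0 path_last.
have rho0 := tvar_ge0 u pl; have vrho := cost_norm u pl.
set h := b - a in ab' tr *; set tau := last b l - b in tau0 *.
set rho := tvar u b l in tr rho0 vrho *; set v := cost u b l in vrho *.
have hu0 : 0 <= h * `|u a| by rewrite mulr_ge0.
have huE : `|h * u a| = h * `|u a| by rewrite normrM ger0_norm.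
have hur : h * `|u a| <= r by lra.
have rhor : rho <= r by lra.
have vr : `|v| <= r by lra.
pose x1 := E (u a) h x; have Dx1 : D x1 by exact: (est_Edom est).
pose y := S h x; have Dy : D y by exact: (csg_dom cS).
(* Three errors: that of the remaining segment started at x1, the local error of the first step
   carried along, and the commutation of S tau with the first impulse. *)
have -> : prop u b l (E (u a) (b - a) x) - G (h * u a + v) (S (tau + h) x) =
  (prop u b l x1 - G v (S tau x1)) + (G v (S tau (x1 - G (h * u a) y)) +
     G v (S tau (G (h * u a) y) - G (h * u a) (S tau y))).
  rewrite (rlinB (csg_lin cS tau0)) !(rlinB (Glin _)) [h * u a + v]addrC (est_GD est) (csgD cS)//.
  by rewrite -/h -/x1 -/y; lmod.
apply: le_trans (nrD _ _) _; apply: le_trans (lerD (lexx _) (nrD _ _)) _.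
have h1 := IHl b x1 pl rhor Dx1; rewrite -/v -/tau -/rho in h1.
have h2 : nr (G v (S tau (x1 - G (h * u a) y))) <= Cg * (Cl * h * (h * `|u a|) * (expR (k * (h * `|u a|)) * N x)).
  apply: le_trans (CgP _ _ vr) _; rewrite ler_wpM2l//.
  by apply: le_trans (csg_le cS _ tau0) _; exact: ClP.
have h3 : nr (G v (S tau (G (h * u a) y) - G (h * u a) (S tau y))) <= Cg * (Cc * tau * (h * `|u a|) * N x).
  apply: le_trans (CgP _ _ vr) _; rewrite ler_wpM2l//.
  have hur' : `|h * u a| <= r by rewrite huE.
  apply: le_trans (CcP _ _ _ hur' tau0 Dy) _; rewrite huE ler_wpM2l ?mulr_ge0//.
  exact: est_NS est _ _ ab' Dx.
have h4 := est_NE est (u a) ab' Dx; rewrite -/x1 in h4.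
set W := expR (k * _) * N x.
have W0 : 0 <= W by rewrite mulr_ge0 ?expR_ge0 ?N_ge0.
have W1 : expR (k * (h * `|u a|)) * N x <= W.
  by rewrite ler_wpM2r ?N_ge0// ler_expR ler_wpM2l// lerDl.
have W2 : expR (k * rho) * N x1 <= W.
  by rewrite /W; exact: expR_split_le.
have W3 : N x <= W.
  by rewrite -[leLHS]mul1r ler_wpM2r ?N_ge0// -expR0 ler_expR mulr_ge0// addr_ge0.
have q1 : Q * tau * rho * (expR (k * rho) * N x1) <= Q * tau * rho * W.
  by rewrite ler_wpM2l// !mulr_ge0.
have q2 : Cg * (Cl * h * (h * `|u a|) * (expR (k * (h * `|u a|)) * N x)) <= Q * h * (h * `|u a|) * W.
  have -> : Cg * (Cl * h * (h * `|u a|) * (expR (k * (h * `|u a|)) * N x)) =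
    Cg * Cl * (h * (h * `|u a|)) * (expR (k * (h * `|u a|)) * N x) by ring.
  rewrite -[Q * h * _]mulrA; apply: ler_pM => //.
  - by rewrite !mulr_ge0.
  - by rewrite mulr_ge0 ?expR_ge0 ?N_ge0.
  - by rewrite ler_wpM2r ?mulr_ge0// lerDl mulr_ge0.
have q3 : Cg * (Cc * tau * (h * `|u a|) * N x) <= Q * tau * (h * `|u a|) * W.
  have -> : Cg * (Cc * tau * (h * `|u a|) * N x) = Cg * Cc * (tau * (h * `|u a|)) * N x by ring.
  rewrite -[Q * tau * _]mulrA; apply: ler_pM => //; first by rewrite !mulr_ge0.
    exact: N_ge0.
  by rewrite ler_wpM2r ?mulr_ge0// lerDr mulr_ge0.
have q4 : 0 <= Q * h * rho * W by rewrite mulr_ge0// mulr_ge0// mulr_ge0.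
(* Of the four terms of (tau + h)(h |u a| + rho), three absorb the three errors and the last is
   nonnegative, which closes the induction with the same Q. *)
have -> : Q * (tau + h) * (h * `|u a| + rho) * W =
  Q * tau * rho * W + Q * h * (h * `|u a|) * W + Q * tau * (h * `|u a|) * W + Q * h * rho * W by ring.
by lra.
Qed.

(* Products of n factors [G v (S h _)], that is, of impulses of the control
   separated by free evolutions. *)
Fixpoint words r T n X : set H := if n is m.+1 then
    words r T m [set y | exists v h x, [/\ `|v| <= r, 0 <= h <= T, X x & y = G v (S h x)]]
  else X.

(** [a, last a l] is cut into pieces of length at most eta. The error of a piece is at most Q times
    eta times its own variation, so the sum involves the total variation and no factor n. *)
Lemma prop_words r T : exists2 Q, 0 <= Q & forall eta n u a l x X, 0 < eta <= T ->
    X x -> D x -> path <%R a l -> adapted u a l ->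
    last a l - a <= n%:R * eta -> tvar u a l <= r ->
  exists2 y, words r T n X y &
    nr (prop u a l x - y) <= Q * eta * tvar u a l * (expR (k * tvar u a l) * N x).
Proof.
have [Q Q0 QP] := segment r; exists Q => // eta n u.
elim: n => [|n IHn] a l x X /andP[eta0 etaT] Xx Dx pl al la tr.
  case: l pl al la tr => [|b l] /=; first by exists x => //; rewrite subrr nr0 mulr0 mul0r.
  move=> /andP[ab /path_last bl] _; rewrite mul0r subr_le0 => la.
  by have := lt_le_trans ab (le_trans bl la); rewrite ltxx.
have al0 := path_last pl.
pose p := Num.min (a + eta) (last a l).
have apl : a <= p <= last a l.
  by rewrite /p le_min al0 ge_min lexx orbT !andbT lerDl ltW.
have [l1 [l2 [[p1 last1] [p2 last2] [a1 a2] pE cE]]] := prop_split ED pl apl al.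
have t1 := tvar_ge0 u p1; have t2 := tvar_ge0 u p2.
have v1 := cost_norm u p1.
have pa : p - a <= eta by rewrite lerBlDl /p ge_min lexx.
have pa0 : 0 <= p - a by rewrite subr_ge0; have /andP[] := apl.
pose z := G (cost u a l1) (S (p - a) x).
have Dz : D z by apply: (est_Gdom est); exact: (csg_dom cS).
have [||||y wy yz] := IHn p l2 z [set y | exists v h x, [/\ `|v| <= r, 0 <= h <= T, X x & y = G v (S h x)]] _ _ Dz p2 a2.
- by rewrite eta0.
- exists (cost u a l1), (p - a), x; split => //; first by lra.
  by rewrite pa0; lra.
- rewrite last2 /p; case: (leP (a + eta) (last a l)) => h.
    by move: la; rewrite -natr1 mulrDl mul1r; lra.
  by rewrite subrr mulr_ge0// ltW.
- by lra.
exists y => //; rewrite pE.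
apply: le_trans (nr_dist _ (prop u p l2 z) _) _.
have h1 := prop_leB u (prop u a l1 x) z p2.
have r1 : tvar u a l1 <= r by lra.
have h2 := QP u a l1 x p1 r1 Dx; rewrite last1 -/z in h2.
have Nz : N z <= expR (k * tvar u a l1) * N x.
  apply: le_trans (est_NG est _ (csg_dom cS pa0 Dx)) _.
  apply: ler_pM; rewrite ?expR_ge0 ?N_ge0//; last exact: (est_NS est).
  by rewrite ler_expR ler_wpM2l.
rewrite cE; set W := expR _ * N x.
have W1 : expR (k * tvar u a l1) * N x <= W.
  by rewrite ler_wpM2r ?N_ge0// ler_expR ler_wpM2l// lerDl.
have W2 : expR (k * tvar u p l2) * N z <= W.
  by rewrite /W; exact: expR_split_le.
have q1 : Q * (p - a) * tvar u a l1 * (expR (k * tvar u a l1) * N x) <= Q * eta * tvar u a l1 * W.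
  apply: ler_pM => //; rewrite ?mulr_ge0 ?expR_ge0 ?N_ge0//.
  by rewrite ler_wpM2r// ler_wpM2l.
have q2 : Q * eta * tvar u p l2 * (expR (k * tvar u p l2) * N z) <= Q * eta * tvar u p l2 * W.
  by rewrite ler_wpM2l// !mulr_ge0// ltW.
rewrite mulrDr mulrDl; lra.
Qed.

End prop.
End ControlEstimates.

(** * Compactness of reachable sets *)

Section Compactness.
Context {R : realType} {H : completeNormedModType R[i]}.
Implicit Types (x y z : H) (a b s t r h v e d : R) (X C : set H).

Lemma closureP X x : closure X x <-> forall e, 0 < e -> exists2 y, X y & nr (x - y) < e.
Proof.
split=> [cX e e0|xX B].
  have e0' : (0 : R[i]) < e%:C by rewrite ltcR.
  have [y [Xy]] := cX _ (nbhsx_ballx x e%:C e0').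
  by rewrite -ball_normE/= normE ltcR; exists y.
move=> /nbhs_normP[e /= e0 eB].
have eE : e = (complex.Re e)%:C.
  by move: e0; case: e {eB} => p q; rewrite ltcE/= => /andP[/eqP-> _].
have /xX[y Xy xy] : 0 < complex.Re e by rewrite -ltcR -eE.
by exists y; split => //; apply: eB; rewrite /= eE normE ltcR.
Qed.

(* A set lying in arbitrarily small neighbourhoods of compact sets is relatively
   compact: an ultrafilter on it, pushed to such a compact set, converges there. *)
Lemma compact_closure_approx X :
  (forall e, 0 < e -> exists2 C, compact C & forall x, X x -> exists2 y, C y & nr (x - y) <= e) ->
  compact (closure X).
Proof.
move=> XC; rewrite compact_ultra => F FU FX.
suff /cauchy_cvg/cvg_ex[p Fp] : cauchy F.
  by exists p; split => //; apply: (@closed_cvg _ _ F _ id (closure X)) => //; exact: closed_closure.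
apply: cauchy_exP => e e0.
have eE : e = (complex.Re e)%:C.
  by move: e0; case: e => p q; rewrite ltcE/= => /andP[/eqP-> _].
have e'0 : 0 < complex.Re e by rewrite -ltcR -eE.
set e' := complex.Re e in eE e'0; have e4 : 0 < e' / 4 by rewrite divr_gt0.
have [C cC CP] := XC _ e4.
have near x : closure X x -> exists y, C y /\ nr (x - y) < e' / 2.
  move=> /closureP/(_ _ e4)[z /CP[y Cy zy] xz]; exists y; split => //.
  by have := nr_dist x z y; lra.
pose g x := xget x [set y | C y /\ nr (x - y) < e' / 2].
have gP x : closure X x -> C (g x) /\ nr (x - g x) < e' / 2.
  by move=> /near; exact: xgetPex.
have FgC : F (g @^-1` C) by apply: filterS FX => x /gP[].
have [c [Cc gc]] := cC (g @ F) _ FgC.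
exists c; rewrite eE.
suff W : F [set x | nr (g x - c) < e' / 2].
  apply: filterS2 FX W => x /gP[_ xg] /= gxc; rewrite -ball_normE/= normE ltcR nrBC.
  by have := nr_dist x (g x) c; lra.
(* If the complement belonged to the ultrafilter, c could not be a cluster point of its image under
   g. *)
have [//|nW] := in_ultra_setVsetC [set x | nr (g x - c) < e' / 2] FU.
exfalso; have Bc : nbhs c [set y | nr (y - c) < e' / 2].
  apply/nbhs_normP; exists (e' / 2)%:C; first by rewrite /= ltcR divr_gt0.
  by move=> y; rewrite /= normE ltcR nrBC.
have [y [/= + yc]] := gc [set y | ~ nr (y - c) < e' / 2] _ nW Bc.
by apply.
Qed.

Section words.
Variables (A : operator H) (S G : R -> H -> H) (E : R -> R -> H -> H) (k : R).
Hypothesis est : estimates A S G E k.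
Let cS : csg A S := est_S est.

Lemma S_cont_at s x e : 0 < e -> exists2 d, 0 < d &
  forall t, `|t - s| < d -> nr (S (Num.max 0 t) x - S (Num.max 0 s) x) < e.
Proof.
move=> e0; have [d d0 dP] := csg_cont cS x e0; exists d => // t ts.
have main p q : 0 <= p -> p <= q -> nr (S q x - S p x) <= nr (S (q - p) x - x).
  move=> p0 pq; have -> : S q x = S p (S (q - p) x) by rewrite -(csgD cS) ?subr_ge0// addrC subrK.
  exact: csg_leB cS p0.
have : `|Num.max 0 t - Num.max 0 s| <= `|t - s|.
  case: (leP 0 t) => t0; case: (leP 0 s) => s0 //.
  - by rewrite subr0 (ger0_norm t0) ger0_norm; lra.
  - by rewrite sub0r normrN (ger0_norm s0) distrC ger0_norm; lra.
  - by rewrite subrr normr0.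
move=> /le_lt_trans/(_ ts); have m0 (q : R) : 0 <= Num.max 0 q by rewrite le_max lexx.
move: (m0 t) (m0 s); set p := Num.max 0 t; set q := Num.max 0 s => p0 q0 pq.
have [pq'|qp] := leP p q.
  rewrite nrBC; apply: le_lt_trans (main _ _ p0 pq') _; apply: dP.
  by rewrite subr_ge0 pq'/=; rewrite distrC ger0_norm ?subr_ge0 in pq.
apply: le_lt_trans (main _ _ q0 (ltW qp)) _; apply: dP.
by rewrite subr_ge0 (ltW qp)/=; rewrite gtr0_norm ?subr_gt0 in pq.
Qed.

(** S is unconstrained at negative times; clipping at 0 makes the map continuous on the whole
    product space, so that compact sets have compact images. *)
Definition letter (p : R * R * H) : H := G p.1.1 (S (Num.max 0 p.1.2) p.2).

Lemma letter_continuous : continuous letter.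
Proof.
move=> [[v0 h0] x0]; apply/nr_cvgP => e e0.
have [C C1 CP] := est_Gle est (`|v0| + 1).
have C0 : 0 < C by lra.
have e3 : 0 < e / 3 / C by rewrite !divr_gt0.
pose x1 := S (Num.max 0 h0) x0.
have [d1 d1_gt0 d1P] := est_Gcont est x1 e3.
have [d2 d2_gt0 d2P] := S_cont_at h0 x0 e3.
have n1 : \forall v \near v0, `|v - v0| < Num.min 1 d1.
  apply/nbhs_normP; exists (Num.min 1 d1) => /=; first by rewrite lt_min ltr01.
  by move=> v; rewrite /= distrC.
have n2 : \forall h \near h0, `|h - h0| < d2.
  by apply/nbhs_normP; exists d2 => //= h; rewrite /= distrC.
have n3 : \forall x \near x0, nr (x - x0) < e / 3 / C.
  apply/nbhs_normP; exists (e / 3 / C)%:C; first by rewrite /= ltcR.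
  by move=> x; rewrite /= normE ltcR nrBC.
exists ([set p : R * R | `|p.1 - v0| < Num.min 1 d1 /\ `|p.2 - h0| < d2],
   [set x | nr (x - x0) < e / 3 / C]); first split => //.
  exists ([set v | `|v - v0| < Num.min 1 d1], [set h | `|h - h0| < d2]); first by split.
  by move=> [v h] [].
move=> [[v h] x] [/= [+ hd] xd]; rewrite lt_min => /andP[v1 vd].
rewrite /letter/= -/x1.
have max0 (q : R) : 0 <= Num.max 0 q by rewrite le_max lexx.
have Gv z : nr (G v z) <= C * nr z.
  apply: CP; have := ler_normD (v - v0) v0; rewrite subrK; lra.
have Gv0 z : nr (G v0 z) <= C * nr z by apply: CP; rewrite lerDl.
have -> : G v (S (Num.max 0 h) x) - G v0 x1 =
   G v (S (Num.max 0 h) x - S (Num.max 0 h) x0) + G v (S (Num.max 0 h) x0 - x1) + G v0 (G (v - v0) x1 - x1).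
  rewrite !(rlinB (est_Glin est _)) -(est_GD est) [v0 + _]addrC subrK; lmod.
apply: le_lt_trans (nrD _ _) _; apply: le_lt_trans (lerD (nrD _ _) (lexx _)) _.
have h1 := Gv (S (Num.max 0 h) x - S (Num.max 0 h) x0).
have h2 := Gv (S (Num.max 0 h) x0 - x1).
have h3 := Gv0 (G (v - v0) x1 - x1).
have h4 := csg_leB x x0 cS (max0 h).
have h5 := d1P _ vd; have h6 := d2P _ hd; rewrite -/x1 in h6.
rewrite !ltr_pdivlMr// in h5 h6 xd.
have := ler_wpM2l (ltW C0) h4; lra.
Qed.

Lemma words_compact r T n X : compact X -> compact (words S G r T n X).
Proof.
elim: n X => //= n IHn X cX; apply: IHn.
have cK : compact (`[- r, r]%classic `*` `[0, T]%classic `*` X).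
  by apply: compact_setX => //; apply: compact_setX; exact: segment_compact.
have := continuous_compact (continuous_subspaceT letter_continuous) cK.
congr compact; apply/seteqP; split=> [_ [[[v h] x] [[/= + + Xx] <-]]|_ [v [h [x [vr hT Xx ->]]]]].
  rewrite !in_itv/= -ler_norml => vr hT; exists v, h, x; split => //.
  by have /andP[h0 _] := hT; rewrite /letter/= max_r.
exists ((v, h), x); last by have /andP[h0 _] := hT; rewrite /letter/= max_r.
by split=> //; split; rewrite /= in_itv//= -ler_norml.
Qed.

Definition reach x (n : nat) := [set y | exists u l, [/\ path <%R 0 l, adapted u 0 l,
  last 0 l <= n%:R, cost (fun s => `|u s|) 0 l <= n%:R & y = prop E u 0 l x]].

Lemma reach_compact x n : compact (closure (reach x n)).
Proof.
apply: compact_closure_approx => e e0; have e2 : 0 < e / 2 by rewrite divr_gt0.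
have [y Dy xy] := (denseP (op_dom A)).1 (est_dense est) x _ e2.
(* The + 1 keeps the step T / m positive when n = 0. *)
pose T : R := n%:R + 1; have T0 : 0 < T by rewrite ltr_wpDl.
have [Q Q0 QP] := prop_words est n%:R T.
pose M := Q * T * n%:R * (expR (k * n%:R) * graph_norm A y).
have k0 := est_k est.
have M0 : 0 <= M by rewrite !mulr_ge0 ?expR_ge0 ?N_ge0// ltW.
(* With m letters the approximation error is at most M / m <= e / 2. *)
pose m := (Num.trunc (M / (e / 2))).+1.
have m0 : 0 < m%:R :> R by rewrite ltr0n.
exists (words S G n%:R T m [set y]); first by apply: words_compact; exact: compact_set1.
move=> _ [u [l [pl al lT un ->]]].
have eta0 : 0 < T / m%:R <= T.
  by rewrite divr_gt0//= ler_pdivrMr// ler_peMr ?(ltW T0)// ler1n.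
have [|z wz yz] := QP _ m u 0 l y [set y] eta0 erefl Dy pl al _ un.
  by rewrite subr0 mulrCA divff ?gt_eqF// mulr1 (le_trans lT)// lerDl.
exists z => //.
have t0 : 0 <= cost (fun s => `|u s|) 0 l by apply: cost_ge0.
have h1 : Q * (T / m%:R) * cost (fun s => `|u s|) 0 l * (expR (k * cost (fun s => `|u s|) 0 l) * graph_norm A y) <= M / m%:R.
  have -> : M / m%:R = Q * (T / m%:R) * n%:R * (expR (k * n%:R) * graph_norm A y) by rewrite /M; ring.
  have /andP[/ltW eta0' _] := eta0.
  apply: ler_pM.
  - by rewrite mulr_ge0// mulr_ge0.
  - by rewrite mulr_ge0 ?expR_ge0 ?N_ge0.
  - by apply: ler_wpM2l => //; rewrite mulr_ge0.
  - by rewrite ler_wpM2r ?N_ge0// ler_expR ler_wpM2l.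
have h2 : M / m%:R <= e / 2.
  by rewrite ler_pdivrMr// mulrC -ler_pdivrMr// ltW// truncnS_gt.
have := nr_dist (prop E u 0 l x) (prop E u 0 l y) z.
have := prop_leB est u x y pl; lra.
Qed.

End words.
End Compactness.

(** * Integration of step controls and their density in L^1 *)

Section StepControls.
Context {R : realType}.
Implicit Types (a b s t e T : R) (u w f g : R -> R) (l : seq R).
Local Notation mu := (@lebesgue_measure R).

Lemma mu_itv a b : (mu `[a, b]%classic < +oo)%E.
Proof. by rewrite lebesgue_measure_itv/=; case: ifP => // _; rewrite -EFinD ltry. Qed.

Lemma adapted_measurable f a l : path <%R a l -> adapted f a l ->
  measurable_fun `[a, last a l]%classic f /\
  exists M, forall s, a <= s <= last a l -> `|f s| <= M.
Proof.
elim: l a => [a _ _|b l IHl a /= /andP[ab pl] [fa fl]].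
  split; first by rewrite set_itv1; exact: measurable_fun_set1.
  by exists `|f a| => s /=; rewrite -eq_le => /eqP->.
have [mf [M MP]] := IHl b pl fl; have bl := path_last pl; split.
  have -> : `[a, last b l]%classic = `[a, b[%classic `|` `[b, last b l]%classic.
    by apply: itv_bndbnd_setU; rewrite bnd_simp// ltW.
  apply/measurable_funU => //; split => //.
  apply: (eq_measurable_fun (cst (f a))); last exact: measurable_cst.
  by move=> s; rewrite inE/= in_itv/= => sab; rewrite [RHS]fa.
exists (Num.max `|f a| M) => s /andP[as_ sl]; rewrite le_max.
have [sb|bs] := ltP s b; first by rewrite fa ?as_ ?lexx.
by rewrite MP ?orbT// bs.
Qed.

Lemma adapted_integrable f a l : path <%R a l -> adapted f a l ->
  mu.-integrable `[a, last a l]%classic (EFin \o f).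
Proof.
move=> pl al; have [mf [M MP]] := adapted_measurable pl al.
apply: measurable_bounded_integrable => //.
  exact: mu_itv.
exists M; split; first exact: num_real.
move=> y My s /=; rewrite in_itv/= => /MP fM; exact: le_trans fM (ltW My).
Qed.

Lemma adapted_integral f a l : path <%R a l -> adapted f a l ->
  \int[mu]_(s in `[a, last a l]) f s = cost f a l.
Proof.
elim: l a => [a _ _|b l IHl a pal al]; first by rewrite /= set_itv1 Rintegral_set1.
have /= /andP[ab pl] := pal; have /= [fa fl] := al.
have bl := path_last pl.
have uE : `[a, last b l]%classic = `[a, b[%classic `|` `[b, last b l]%classic.
  by apply: itv_bndbnd_setU; rewrite bnd_simp// ltW.
have int := adapted_integrable pal al; rewrite /= uE in int *.
rewrite Rintegral_setU//; last first.
  apply/disj_setPS => s [/=]; rewrite !in_itv/= => /andP[_ sb] /andP[bs _].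
  by have := lt_le_trans sb bs; rewrite ltxx.
rewrite IHl//; congr (_ + _).
rewrite (eq_Rintegral _ (g := cst (f a))); last first.
  by move=> s; rewrite inE/= in_itv/= => sab; rewrite [LHS]fa.
have muE : mu `[a, b[%classic = (b - a)%:E by rewrite lebesgue_measure_itv/= lte_fin ab.
by rewrite Rintegral_cst// [RHS]mulrC; congr (_ * _); exact: (congr1 fine muE).
Qed.

Lemma L1dist_adapted u w l : path <%R 0 l -> adapted u 0 l -> adapted w 0 l ->
  L1dist (last 0 l) u w = cost (fun s => `|u s - w s|) 0 l.
Proof.
move=> pl au aw; rewrite /L1dist adapted_integral//.
exact: (@adapted2 _ (fun p q => `|p - q|)).
Qed.

Lemma adapted_L1 u l : path <%R 0 l -> adapted u 0 l -> L1 (last 0 l) u.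
Proof. exact: adapted_integrable. Qed.

Lemma L1_diff_norm T u w : L1 T u -> L1 T w ->
  mu.-integrable `[0, T]%classic (EFin \o (fun s => `|u s - w s|)).
Proof.
move=> Lu Lw; apply: (@integrable_norm _ _ _ mu _ (fun s => u s - w s)).
exact: (integrableB _ Lu Lw).
Qed.

Lemma L1dist_triangle T v u w : L1 T u -> L1 T v -> L1 T w ->
  L1dist T u w <= L1dist T u v + L1dist T v w.
Proof.
move=> Lu Lv Lw; rewrite /L1dist -RintegralD//; try exact: L1_diff_norm.
apply: le_Rintegral => //; first exact: L1_diff_norm.
  exact: (integrableD _ (L1_diff_norm Lu Lv) (L1_diff_norm Lv Lw)).
by move=> s _ /=; exact: ler_distD.
Qed.

Lemma L1distC T u w : L1dist T u w = L1dist T w u.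
Proof. by apply: eq_Rintegral => s _; rewrite distrC. Qed.

Lemma L1_cst T : L1 T (cst 0).
Proof.
apply: measurable_bounded_integrable => //.
  exact: mu_itv.
by exists 0; split => // y y0 s _ /=; rewrite normr0 ltW.
Qed.

Fixpoint stepf g a l s := if l is b :: l' then if s < b then g a else stepf g b l' s else g a.

Fixpoint fine_grid g e a l :=
  if l is b :: l' then (forall s, a <= s < b -> `|g s - g a| <= e) /\ fine_grid g e b l' else True.

Lemma stepf_adapted g a l : path <%R a l -> adapted (stepf g a l) a l.
Proof.
suff main f : (forall s, a <= s -> f s = stepf g a l s) -> path <%R a l -> adapted f a l by exact: main.
elim: l a f => //= b l IHl a f fE /andP[ab pl]; split=> [s /andP[as_ sb]|].
  by rewrite !fE// sb ab.
by apply: IHl => // s bs; rewrite fE ?(le_trans (ltW ab))// ltNge bs.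
Qed.

Lemma stepf_close g e a l : 0 <= e -> path <%R a l -> fine_grid g e a l ->
  forall s, a <= s <= last a l -> `|g s - stepf g a l s| <= e.
Proof.
move=> e0; elim: l a => [a _ _ s /=|b l IHl a /= /andP[ab pl] [ga gl] s /andP[as_ sl]].
  by rewrite -eq_le => /eqP->; rewrite subrr normr0.
case: ltP => [sb|bs]; first by rewrite ga ?as_.
by apply: IHl => //; rewrite bs.
Qed.

Lemma fine_grid_rcons g e a l b : fine_grid g e a l ->
  (forall s, last a l <= s < b -> `|g s - g (last a l)| <= e) -> fine_grid g e a (rcons l b).
Proof. by elim: l a => //= c l IHl a [ga gl] gb; split => //; exact: IHl. Qed.

(** Supremum argument: a grid ending close to the supremum s of the reachable times can be prolonged
    beyond s by one step, by continuity of g at s, unless T is reached. *)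
Lemma continuous_fine_grid g T e : continuous g -> 0 <= T -> 0 < e ->
  exists l, [/\ path <%R 0 l, last 0 l = T & fine_grid g e 0 l].
Proof.
move=> cg T0 e0; have e2 : 0 < e / 2 by rewrite divr_gt0.
pose X := [set s | 0 <= s <= T /\ exists l, [/\ path <%R 0 l, last 0 l = s & fine_grid g e 0 l]].
have X0 : X 0 by split; [rewrite lexx|exists [::]].
have supX : has_sup X by split; [exists 0|exists T => s [/andP[]]].
pose s := sup X.
have s0 : 0 <= s by apply: sup_upper_bound.
have sT : s <= T by apply: ge_sup; [exists 0|move=> r [/andP[]]].
have /cvgrPdist_lt/(_ _ e2)/nbhs_normP[d /= d0 dP] := cg s.
have [r [/andP[r0 rT] [l [pl lr gl]]] sdr] := sup_adherent d0 supX.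
have rs : r <= s by apply: sup_upper_bound => //; split; [rewrite r0|exists l].
have [<-|rnT] := eqVneq r T; first by exists l.
have {}rT : r < T by rewrite lt_neqAle rnT.
pose q := Num.min (s + d / 2) T.
have rq : r < q by rewrite lt_min rT andbT; lra.
have qd : q <= s + d / 2 by rewrite ge_min lexx.
have close t : r <= t < q -> `|g s - g t| < e / 2.
  by move=> /andP[rt tq]; apply: dP; rewrite /= ltr_norml; move: sdr; rewrite -/s => sdr; apply/andP; split; lra.
have Xq : X q.
  split; first by rewrite ge_min lexx orbT andbT; lra.
  exists (rcons l q); split; [by rewrite rcons_path pl lr|by rewrite last_rcons|].
  apply: fine_grid_rcons => // t; rewrite lr => tr.
  have := close t tr; have := close r; rewrite lexx rq => /(_ isT).
  have -> : g t - g r = - (g s - g t) + (g s - g r) by ring.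
  move=> h1 h2; apply: le_trans (ler_normD _ _) _; rewrite normrN; lra.
have qs : q <= s by apply: sup_upper_bound.
have qT : q = T.
  have [h|h] := leP (s + d / 2) T; last by rewrite /q min_r// ltW.
  by exfalso; move: qs; rewrite /q min_l//; lra.
by case: Xq => _; rewrite qT.
Qed.

(** Continuous functions are dense in L^1, and sampling one on a fine grid costs at most eta T <= e
    / 2. *)
Lemma step_dense T u e : 0 <= T -> L1 T u -> 0 < e ->
  exists w l, [/\ path <%R 0 l, last 0 l = T, adapted w 0 l & L1dist T u w < e].
Proof.
move=> T0 Lu e0; have e2 : 0 < e / 2 by rewrite divr_gt0.
have mT := mu_itv 0 T.
have [g [cg ig lim]] := approximation_continuous_integrable (measurable_itv _) mT Lu.
have [n gn] : exists n, L1dist T u (g n) < e / 2.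
  have e2' : (0 < (e / 2)%:E)%E by rewrite lte_fin.
  have /fine_cvgP[_ /cvgrPdist_lt/(_ _ e2)[N _ NP]] := lim.
  exists N; have := NP N (leqnn _); rewrite /= sub0r normrN => /ltr_normlW.
  exact.
have M0 : 0 < T + 1 by rewrite ltr_wpDl.
pose eta := e / 2 / (T + 1).
have eta0 : 0 < eta by rewrite divr_gt0.
have [l [pl lT gl]] := continuous_fine_grid (cg n) T0 eta0.
pose w := stepf (g n) 0 l; have aw : adapted w 0 l by exact: stepf_adapted.
have Lw : L1 T w by rewrite -lT; exact: adapted_L1.
exists w, l; split => //.
apply: le_lt_trans (L1dist_triangle Lu (ig n) Lw) _.
suff : L1dist T (g n) w <= e / 2 by lra.
have cint : mu.-integrable `[0, T]%classic (EFin \o cst eta).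
  apply: measurable_bounded_integrable => //.
  by exists eta; split => [|y y0 s _ /=]; [exact: num_real|rewrite ger0_norm ltW].
apply: (@le_trans _ _ (\int[mu]_(s in `[0, T]) cst eta s)).
  apply: le_Rintegral => //; first exact: (L1_diff_norm (ig n) Lw).
  move=> s /=; rewrite in_itv/= -lT => sT.
  exact: stepf_close (ltW eta0) pl gl _ sT.
have muE : mu `[0%R, T]%classic = T%:E.
  rewrite lebesgue_measure_itv/= lte_fin; case: ltP => [_|T0']; first by rewrite -EFinB subr0.
  by have -> : T = 0 by apply/eqP; rewrite eq_le T0 T0'.
rewrite Rintegral_cst//; have -> : fine (mu `[0%R, T]%classic) = T by exact: (congr1 fine muE).
rewrite /eta mulrAC ler_pdivrMr//; nra.
Qed.
End StepControls.

Section PiecewiseConstant.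
Context {R : realType} {H : completeNormedModType R[i]}.
Implicit Types (x : H) (T : R) (u : R -> R) (l : seq R).
Variables (A B : operator H).

Lemma adapted_rcons u a l b : adapted u a (rcons l b) <->
  adapted u a l /\ forall s, last a l <= s < b -> u s = u (last a l).
Proof.
elim: l a => [|c l IHl] a /=; first by split=> [[]|[]].
by split=> [[ua /IHl[]]|[[ua ul] h]]; [|split => //; apply/IHl].
Qed.

Lemma piecewise_adapted T p (tau v : nat -> R) u : piecewise_constant T p tau v u ->
  exists l, [/\ path <%R 0 l, last 0 l = T, adapted u 0 l &
    forall x, pc_propagator A B tau v p x = prop (fun c => expop (op_ctrl A B c)) u 0 l x].
Proof.
move=> [tau0 tauT tauS uv]; rewrite -tauT; move: tauS uv {tauT}.
elim: p => [|p IHp] tauS uv; first by exists [::]; split => //=; rewrite tau0.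
have [||l [pl lT al pE]] := IHp.
- by move=> j jp; apply: tauS; exact: leqW.
- by move=> j jp; apply: uv; exact: leqW.
have up : u (tau p) = v p by apply: uv; rewrite ?ltnSn// lexx tauS.
exists (rcons l (tau p.+1)); split.
- by rewrite rcons_path pl lT tauS.
- by rewrite last_rcons.
- by apply/adapted_rcons; split => // s; rewrite lT up => /uv; apply.
- by move=> x; rewrite prop_rcons lT up -pE.
Qed.

Lemma adapted_piecewise u l : path <%R 0 l -> adapted u 0 l ->
  exists p (tau v : nat -> R), piecewise_constant (last 0 l) p tau v u.
Proof.
move=> pl al; exists (size l), (nth 0 (0 :: l)), (fun j => u (nth 0 (0 :: l) j)); split => //.
- by rewrite (last_nth 0).
- by move=> j jl; have /(pathP 0)/(_ j jl) := pl.
suff main a j s : path <%R a l -> adapted u a l -> (j < size l)%N ->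
    nth 0 (a :: l) j <= s < nth 0 (a :: l) j.+1 -> u s = u (nth 0 (a :: l) j).
  by move=> j jl s; exact: main.
elim: l {pl al} a j => //= b l IHl a [|j] /andP[_ pl] [ua ul] jl; first exact: ua.
exact: IHl.
Qed.
End PiecewiseConstant.

(** * The end-point mapping *)

Section RelativeBound.
Context {R : realType} {H : completeNormedModType R[i]}.
Variable dot : {dot H for @Num.conj R[i]}.
Hypothesis dot_norm : forall x : H, dot x x = `|x| ^+ 2.

(* The difference quotients of [e^{tB} (1 - C)^{-1}] converge pointwise, hence are
   uniformly bounded. *)
Lemma relatively_bounded (B C : operator H) (K : R) G : maximal_dissipative dot C ->
  grp B K G -> (forall x, op_dom C x -> op_dom B x) ->
  exists2 M, 0 <= M & forall x, op_dom C x -> nr (B x) <= M * (nr x + nr (C x)).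
Proof.
move=> Cmax gG CB; pose J := res C 1.
have JD x : op_dom C (J x) by have [] := resP dot_norm Cmax x ltr01.
have Jlin : rlin J := res_lin dot_norm Cmax 1.
pose h n : R := n.+1%:R^-1; have h0 n : 0 < h n by rewrite invr_gt0.
pose T n x := rsc (h n)^-1 (G (h n) (J x) - J x).
have Tlin n : rlin (T n) by move=> a x y; rewrite /T Jlin (grp_lin gG); lmod.
have [n|x|M M0 MP] := uniform_boundedness Tlin.
- apply: (@bounded_hcont _ _ _ ((h n)^-1 * (expR (K * `|h n|) + 1))) => // x.
  rewrite nrZ_ge0 ?invr_ge0 ?(ltW (h0 n))// -mulrA ler_wpM2l ?invr_ge0 ?(ltW (h0 n))//.
  apply: le_trans (nrB _ _) _; rewrite mulrDl mul1r.
  have Jx : nr (J x) <= nr x := res_le dot_norm Cmax 1 x.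
  by rewrite lerD//; apply: le_trans (grp_le gG _ _) _; rewrite ler_wpM2l ?expR_ge0.
- have [d d0 dP] := grp_gen gG (CB _ (JD x)) ltr01.
  have bnd n : h n < d -> nr (T n x) <= nr (B (J x)) + 1.
    move=> hd; have := dP (h n); rewrite gt_eqF// gtr0_norm// => /(_ isT hd); rewrite mul1r => a1.
    have -> : T n x = rsc (h n)^-1 (G (h n) (J x) - J x - rsc (h n) (B (J x))) + B (J x).
      by have hn := h0 n; rewrite /T; lmod.
    apply: le_trans (nrD _ _) _; rewrite addrC lerD2l nrZ_ge0 ?invr_ge0 ?(ltW (h0 n))//.
    by rewrite ler_pdivrMl// mulr1.
  pose m := Num.trunc d^-1; exists (\sum_(n < m) nr (T n x) + (nr (B (J x)) + 1)) => n.
  have s0 : 0 <= \sum_(n < m) nr (T n x) by apply: sumr_ge0 => i _; exact: nr_ge0.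
  have [nm|mn] := ltnP n m.
    rewrite (bigD1 (Ordinal nm))//= -addrA lerDl addr_ge0//.
      by apply: sumr_ge0 => i _; exact: nr_ge0.
    by rewrite addr_ge0 ?nr_ge0.
  have : h n < d.
    rewrite -[d]invrK ltf_pV2 ?posrE ?invr_gt0// (lt_le_trans (truncnS_gt _))// ler_nat.
    by [].
  by move=> /bnd; lra.
exists M => // x Dx; have xE : J (x - C x) = x.
  by apply: (resE dot_norm Cmax); rewrite ?rsc1.
suff h1 : nr (B x) <= M * nr (x - C x).
  by apply: le_trans h1 _; rewrite ler_wpM2l// nrB.
apply/ler_addgt0Pr => e e0.
have [d d0 dP] := grp_gen gG (CB x Dx) e0.
have hd : h (Num.trunc d^-1) < d.
  by rewrite -[X in _ < X]invrK ltf_pV2 ?posrE ?invr_gt0// truncnS_gt.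
set n := Num.trunc d^-1 in hd; have hn := h0 n.
have := dP (h n); rewrite gt_eqF// gtr0_norm// => /(_ isT hd) a1.
have := MP n (x - C x); rewrite /T xE => a2.
have -> : B x = rsc (h n)^-1 (G (h n) x - x) - rsc (h n)^-1 (G (h n) x - x - rsc (h n) (B x)) by lmod.
apply: le_trans (nrB _ _) _; rewrite lerD// nrZ_ge0 ?invr_ge0 ?(ltW hn)//.
by rewrite ler_pdivrMl// mulrC.
Qed.
End RelativeBound.

Section EndPoint.
Context {R : realType} {H : completeNormedModType R[i]}.
Implicit Types (x y psi : H) (T t e d r : R) (u w : R -> R) (l : seq R).
Variables (A B : operator H) (S G : R -> H -> H) (k : R).
Local Notation E := (fun c => expop (op_ctrl A B c)).
Hypothesis est : estimates A S G E k.
Local Notation prop := (prop E).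
Local Notation tvar u := (cost (fun s => `|u s|)).

(* l is the list of switching times in (0, T] of the step control u. *)
Definition step_control T u l := [/\ path <%R 0 l, last 0 l = T & adapted u 0 l].

Lemma adapted_cst (c a : R) l : adapted (cst c) a l.
Proof. by elim: l a => //= b l IHl a; split. Qed.

Lemma path_le_last (a : R) l : path <%R a l -> forall c, c \in a :: l -> c <= last a l.
Proof.
elim: l a => [a _ c|b l IHl a /= /andP[ab pl] c]; first by rewrite inE => /eqP->.
rewrite inE => /predU1P[->|]; last exact: IHl.
exact: le_trans (ltW ab) (path_last pl).
Qed.

(** The sorted union of the switching times; it lets two controls be compared segment by segment. *)
Lemma common_refinement T u w lu lw : step_control T u lu -> step_control T w lw ->
  exists l, [/\ step_control T u l, step_control T w l,
    forall x, prop u 0 lu x = prop u 0 l x & forall x, prop w 0 lw x = prop w 0 l x].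
Proof.
move=> [pu Tu au] [pw Tw aw]; pose l := sort <=%R (undup (lu ++ lw)).
have inl c : (c \in l) = (c \in lu) || (c \in lw) by rewrite mem_sort mem_undup mem_cat.
have pos c : c \in l -> 0 < c.
  by rewrite inl => /orP[]; apply: (allP (order_path_min lt_trans _)).
have pl : path <%R 0 l.
  rewrite (path_sortedE lt_trans) sort_lt_sorted undup_uniq andbT.
  by apply/allP => c /pos.
have Tl : last 0 l = T.
  have lastin : last 0 l \in 0 :: l := mem_last 0 l.
  apply/eqP; rewrite eq_le; apply/andP; split.
    move: lastin; rewrite inE => /predU1P[->|]; first by rewrite -Tu path_last.
    rewrite inl => /orP[cu|cw]; first by rewrite -Tu path_le_last// inE cu orbT.
    by rewrite -Tw path_le_last// inE cw orbT.
  apply: path_le_last => //; have : last 0 lu \in 0 :: lu := mem_last 0 lu.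
  by rewrite Tu !inE => /orP[->//|Tlu]; rewrite inl Tlu orbT.
have [||al uE] := prop_refine (ED est) pu pl _ _ au.
- by move=> c cu; rewrite inl cu.
- by rewrite Tu Tl.
have [||al' wE] := prop_refine (ED est) pw pl _ _ aw.
- by move=> c cw; rewrite inl cw orbT.
- by rewrite Tw Tl.
by exists l; split.
Qed.

Lemma step_L1 T u l : step_control T u l -> L1 T u.
Proof. by move=> [pl <- al]; exact: adapted_L1. Qed.

Lemma step_tvar T u l : step_control T u l -> tvar u 0 l = L1dist T u (cst 0).
Proof.
move=> [pl <- al]; rewrite L1dist_adapted//; last exact: adapted_cst.
by congr cost; apply/funext => s; rewrite /= subr0.
Qed.

Lemma step_uc psi r e : 0 < e -> exists2 d, 0 < d & forall T u lu w lw,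
  step_control T u lu -> step_control T w lw -> L1dist T u (cst 0) <= r ->
  L1dist T u w < d -> nr (prop u 0 lu psi - prop w 0 lw psi) < e.
Proof.
move=> e0; have [d d0 dP] := prop_uc est psi r e0; exists d => // T u lu w lw su sw ur uw.
have [l [su' sw' -> ->]] := common_refinement su sw.
have [pl lT au] := su'; have [_ _ aw] := sw'.
by apply: dP => //; [rewrite (step_tvar su')|rewrite -L1dist_adapted// lT].
Qed.

(** Limit of the propagators as step controls tend to u in L^1, stated without choosing a sequence,
    so that functions equal almost everywhere share it. *)
Definition is_endpoint psi T u y := forall e, 0 < e -> exists2 d, 0 < d &
  forall w l, step_control T w l -> L1dist T u w < d -> nr (y - prop w 0 l psi) < e.

Lemma step_approx T u e : 0 <= T -> L1 T u -> 0 < e ->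
  exists w l, step_control T w l /\ L1dist T u w < e.
Proof.
by move=> T0 Lu e0; have [w [l [pl lT al uw]]] := step_dense T0 Lu e0; exists w, l.
Qed.

Lemma is_endpoint_ex psi T u : 0 <= T -> L1 T u -> exists y, is_endpoint psi T u y.
Proof.
move=> T0 Lu; have L0 := L1_cst T.
have ex n : exists wl : (R -> R) * seq R, step_control T wl.1 wl.2 /\ L1dist T u wl.1 < n.+1%:R^-1.
  have [|w [l [sw uw]]] := step_approx T0 Lu (e := n.+1%:R^-1); first by rewrite invr_gt0.
  by exists (w, l).
pose wl n := projT1 (cid (ex n)).
have wlP n : step_control T (wl n).1 (wl n).2 /\ L1dist T u (wl n).1 < n.+1%:R^-1 by exact: projT2 (cid (ex n)).
(* Step controls within distance 1 of u have L^1 norm at most r, so one modulus of continuity serves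
   for all of them. *)
pose r := L1dist T u (cst 0) + 1.
have wr w l : step_control T w l -> L1dist T u w < 1 -> L1dist T w (cst 0) <= r.
  move=> sw uw; have := L1dist_triangle (step_L1 sw) Lu L0.
  by rewrite (L1distC T w u) /r; lra.
have uc e : 0 < e -> exists2 d, 0 < d & forall w l w' l', step_control T w l -> step_control T w' l' ->
    L1dist T u w < d -> L1dist T u w' < d -> nr (prop w 0 l psi - prop w' 0 l' psi) < e.
  move=> e0; have [d d0 dP] := step_uc psi r e0.
  exists (Num.min 1 (d / 2)); first by rewrite lt_min ltr01 divr_gt0.
  move=> w l w' l' sw sw'; rewrite !lt_min => /andP[w1 wd] /andP[w'1 w'd].
  apply: (dP T) => //; first exact: wr sw w1.
  have := L1dist_triangle (step_L1 sw) Lu (step_L1 sw'); rewrite (L1distC T w u); lra.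
have small d : 0 < d -> exists N, forall n, (N <= n)%N -> n.+1%:R^-1 < d.
  move=> d0; exists (Num.trunc d^-1) => n Nn; rewrite -[d]invrK ltf_pV2 ?posrE ?invr_gt0//.
  by rewrite (lt_le_trans (truncnS_gt _))// ler_nat.
have [y yP] : exists y, cvgs (fun n => prop (wl n).1 0 (wl n).2 psi) y.
  apply: cauchy_cvgs => e e0; have [d d0 dP] := uc e e0; have [N NP] := small d d0.
  exists N => m n Nm Nn; have [sm um] := wlP m; have [sn un] := wlP n.
  by apply: dP => //; [exact: lt_trans um (NP _ Nm)|exact: lt_trans un (NP _ Nn)].
exists y => e e0; have e2 : 0 < e / 2 by rewrite divr_gt0.
have [d d0 dP] := uc _ e2; exists d => // w l sw uw.
have [N NP] := small d d0; have [M MP] := yP _ e2; pose n := maxn N M.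
have [sn un] := wlP n.
have := dP _ _ _ _ sn sw (lt_trans un (NP _ (leq_maxl _ _))) uw.
have := MP n (leq_maxr _ _); have := nr_dist y (prop (wl n).1 0 (wl n).2 psi) (prop w 0 l psi).
by rewrite (nrBC y (prop (wl n).1 0 (wl n).2 psi)); lra.
Qed.

Definition endpoint psi T u := xget 0 (is_endpoint psi T u).

Lemma endpointP psi T u : 0 <= T -> L1 T u -> is_endpoint psi T u (endpoint psi T u).
Proof. by move=> T0 Lu; apply: xgetPex; exact: is_endpoint_ex. Qed.

Lemma pc_step T p (tau v : nat -> R) u : piecewise_constant T p tau v u ->
  exists l, step_control T u l /\ forall x, pc_propagator A B tau v p x = prop u 0 l x.
Proof. by move=> /(piecewise_adapted A B)[l [pl lT al pE]]; exists l. Qed.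

Lemma step_pc T w l : step_control T w l -> exists p (tau v : nat -> R), piecewise_constant T p tau v w.
Proof. by move=> [pl <- al]; exact: adapted_piecewise. Qed.

Lemma endpoint_is_extension psi T : 0 <= T -> endpoint_extension A B psi T (endpoint psi T).
Proof.
move=> T0; split=> [u Lu e e0|p tau v u /pc_step[l [su ->]]].
  have e2 : 0 < e / 2 by rewrite divr_gt0.
  have [d d0 dP] := endpointP psi T0 Lu e2.
  exists (d / 2); rewrite ?divr_gt0// => w Lw uw; rewrite normE ltcR.
  have [d' d'0 d'P] := endpointP psi T0 Lw e2.
  have dd : 0 < Num.min (d / 2) d' by rewrite lt_min divr_gt0.
  have [w' [l [sw']]] := step_approx T0 Lw dd; rewrite lt_min => /andP[ww1 ww2].
  have uw' : L1dist T u w' < d by have := L1dist_triangle Lu Lw (step_L1 sw'); lra.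
  have := dP w' l sw' uw'; have := d'P w' l sw' ww2.
  have := nr_dist (endpoint psi T u) (prop w' 0 l psi) (endpoint psi T w).
  by rewrite (nrBC (prop w' 0 l psi)); lra.
(* A step control is at distance 0 from itself, so its propagator is the limit. *)
apply: eq_nr_small => e e0; have [d d0 dP] := endpointP psi T0 (step_L1 su) e0.
rewrite ltW//; apply: dP => //; rewrite /L1dist (eq_Rintegral _ (g := cst 0)).
  by rewrite Rintegral_cst// mul0r.
by move=> s _; rewrite subrr normr0.
Qed.

Lemma extension_step psi T Phi u e : 0 <= T -> L1 T u -> endpoint_extension A B psi T Phi -> 0 < e ->
  exists w l, [/\ step_control T w l, L1dist T u w < e & nr (Phi u - prop w 0 l psi) < e].
Proof.
move=> T0 Lu [cPhi pcPhi] e0; have [d d0 dP] := cPhi u Lu e e0.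
have de : 0 < Num.min d e by rewrite lt_min d0.
have [w [l [sw]]] := step_approx T0 Lu de; rewrite lt_min => /andP[uwd uwe].
have [p [tau [v pcw]]] := step_pc sw.
have [l' [sw' pE]] := pc_step pcw; exists w, l'; split => //.
by have := dP w (step_L1 sw) uwd; rewrite normE ltcR (pcPhi _ _ _ _ pcw) pE.
Qed.

Lemma extension_unique psi T Phi u : 0 <= T -> L1 T u -> endpoint_extension A B psi T Phi ->
  Phi u = endpoint psi T u.
Proof.
move=> T0 Lu ePhi; apply: eq_nr_small => e e0; have e2 : 0 < e / 2 by rewrite divr_gt0.
have [d d0 dP] := endpointP psi T0 Lu e2.
have de : 0 < Num.min d (e / 2) by rewrite lt_min d0.
have [w [l [sw]]] := extension_step T0 Lu ePhi de; rewrite !lt_min => /andP[uwd _] /andP[_ uwe].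
have := dP w l sw uwd; have := nr_dist (Phi u) (prop w 0 l psi) (endpoint psi T u).
by rewrite (nrBC (prop w 0 l psi)); lra.
Qed.

Lemma attainable_reach psi : attainable_set A B psi `<=` \bigcup_n closure (reach E psi n).
Proof.
move=> _ [T [u [t [Phi [T0 LuT /andP[t0 tT] ePhi ->]]]]].
have Lu : L1 t u.
  apply: integrableS LuT => // s /=; rewrite !in_itv/= => /andP[-> st].
  exact: le_trans st tT.
(* The approximating step control is taken within 1 of u, hence the + 1. *)
pose M := Num.max t (L1dist t u (cst 0) + 1).
exists (Num.trunc M).+1 => //; apply/closureP => e e0.
have e1 : 0 < Num.min 1 e by rewrite lt_min ltr01.
have [w [l [sw]]] := extension_step t0 Lu ePhi e1; rewrite !lt_min => /andP[uw1 _] /andP[_ Pw].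
have tM : t <= M by rewrite le_max lexx.
have uM : L1dist t u (cst 0) + 1 <= M by rewrite le_max lexx orbT.
have Mn := ltW (truncnS_gt M).
exists (prop w 0 l psi) => //; exists w, l; have [pl lT al] := sw; split => //.
  by rewrite lT (le_trans tM).
rewrite (step_tvar sw); have := L1dist_triangle (step_L1 sw) Lu (L1_cst t).
rewrite (L1distC t w u); lra.
Qed.
End EndPoint.

Unset Implicit Arguments.

Theorem theorem1 (R : realType) (H : completeNormedModType R[i])
  (dot : {dot H for @Num.conj R[i]})
  (dot_norm : forall x : H, dot x x = `|x| ^+ 2)
  (H_infdim : infinite_dimensional H)
  (A B : operator H) (c c' : R)
  (A_maxdiss : maximal_dissipative dot A)
  (c_ge0 : 0 <= c) (c'_ge0 : 0 <= c')
  (Bc_gen : generates_contractions (op_add B (op_scale (- c%:C) op_id)))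
  (NBc'_gen :
     generates_contractions (op_add (op_scale (-1) B) (op_scale (- c'%:C) op_id)))
  (Bc_inv : forall t x, 0 <= t -> op_dom A x ->
     op_dom A (expop (op_add B (op_scale (- c%:C) op_id)) t x))
  (NBc'_inv : forall t x, 0 <= t -> op_dom A x ->
     op_dom A
       (expop (op_add (op_scale (-1) B) (op_scale (- c'%:C) op_id)) t x))
  (AuB_maxdiss : forall u : R,
     maximal_dissipative dot (op_ctrl A B u) /\
     op_dom (op_ctrl A B u) = op_dom A)
  (lip : locally_lipschitz_graph A
     (fun t x => expgrp B t (A (expgrp B (- t) x)))) :
  (forall (T : R) (psi0 : H), 0 < T ->
     exists Phi, endpoint_extension A B psi0 T Phi /\
       forall Phi', endpoint_extension A B psi0 T Phi' ->
         forall u, L1 T u -> Phi' u = Phi u) /\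
  (forall psi0 : H, exists K : nat -> set H,
     (forall n, compact (K n)) /\
     attainable_set A B psi0 `<=` \bigcup_n K n).
Proof.
have dA := Adense A_maxdiss.
(* The domain of A + 0 B is the intersection of both domains, and it equals that of A. *)
have AB x : op_dom A x -> op_dom B x by have [_ <-] := AuB_maxdiss 0; case.
have dB : dense (op_dom B).
  by apply/denseP => x e e0; have [y /AB Dy xy] := (denseP _).1 dA x e e0; exists y.
pose Bp := op_add B (op_scale (- c%:C) op_id).
have [gSp cSp] : generates_semigroup Bp (expop Bp) /\ csg Bp (expop Bp).
  have [Sp gSp contr] := Bc_gen; apply: expop_csg gSp contr.
  by apply/denseP => x e e0; have [y Dy xy] := (denseP _).1 dB x e e0; exists y.
pose Bm := op_add (op_scale (-1) B) (op_scale (- c'%:C) op_id).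
have [gSm cSm] : generates_semigroup Bm (expop Bm) /\ csg Bm (expop Bm).
  have [Sm gSm contr] := NBc'_gen; apply: expop_csg gSm contr.
  by apply/denseP => x e e0; have [y Dy xy] := (denseP _).1 dB x e e0; exists y.
have gG := expgrp_grp c_ge0 c'_ge0 dB gSp gSm cSp cSm.
have GA t x : op_dom A x -> op_dom A (expgrp B t x).
  move=> Dx; apply: (expgrp_inv c_ge0 c'_ge0 dB gSp gSm cSp cSm (D := op_dom A)) => //.
  by move=> a y Dy; exact: op_domZ.
have domE u : op_dom (op_ctrl A B u) = op_dom A by have [] := AuB_maxdiss u.
have cE u : csg (op_ctrl A B u) (expop (op_ctrl A B u)).
  by have [mu _] := AuB_maxdiss u; exact: (expop_max dot_norm mu).2.
have cS := (expop_max dot_norm A_maxdiss).2.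
have Bbd u : exists2 M, 0 <= M & forall x, op_dom A x -> nr (B x) <= M * (nr x + nr (A x + rsc u (B x))).
  have [mu _] := AuB_maxdiss u.
  have [|M M0 MP] := relatively_bounded dot_norm mu gG; first by move=> x; rewrite domE; exact: AB.
  by exists M => // x Dx; apply: MP; rewrite domE.
have [d d0 [L L0 lipL]] : exists2 d, 0 < d & exists2 L, 0 <= L & forall t x, `|t| < d -> op_dom A x ->
    nr (expgrp B (- t) (A (expgrp B t x)) - A x) <= L * `|t| * graph_norm A x.
  have [_ /(_ 0)[U /nbhs_normP[d /= d0 dU] [L LP]]] := lip.
  exists d => //; exists `|L| => // t x td Dx.
  have U0 : U 0 by apply: dU; rewrite /= subrr normr0.
  (* The hypothesis concerns e^{tB} A e^{-tB}; its value at - t gives the order of conjugation used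
     in the estimates. *)
  have Ut : U (- t) by apply: dU; rewrite /= sub0r opprK.
  have := LP 0 (- t) U0 Ut x Dx; rewrite oppr0 !(grp0 gG) opprK addr0 normrN.
  rewrite !normE -rmorphD -rmorphM lecR => /le_trans; apply.
  by rewrite ler_wpM2r ?N_ge0// ler_wpM2r// ler_norm.
have K0 : 0 <= c + c' by rewrite addr_ge0.
have est := control_estimates dA cS cE domE gG GA K0 L0 d0 lipL Bbd.
split=> [T psi0 T0|psi0].
  exists (endpoint A B psi0 T); split.
    by apply: (endpoint_is_extension est); exact: ltW.
  by move=> Phi' ePhi' u Lu; apply: (extension_unique est) => //; exact: ltW.
exists (fun n => closure (reach (fun u => expop (op_ctrl A B u)) psi0 n)); split.
  by move=> n; exact: reach_compact est psi0 n.
exact: attainable_reach.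
Qed.
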